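(* Let $(M,g,J)$ be a pseudo-Kählerian manifold of signature $(2p,2q)$, $p+q=n\ge2$. Then the covariant derivative $\nabla R$ of the curvature tensor $R$ of $(M,g,J)$ admits the decomposition $$\nabla R=Q_0+Q'+Q_1,$$ where $$Q_0=\nabla B+\frac{1}{n+2}\psi_1+\psi_2,\qquad Q'=\psi_1-\psi_2,\qquad (Q_1)_X=T_X\wedge_Jg,$$ and this is the explicit form of the decomposition $\mathcal{R}^\nabla(\mathfrak{u}(T_xM))=\mathcal{Q}_0\oplus\mathcal{Q}'\oplus\mathcal{Q}_1$ into irreducible $\mathfrak{u}(T_xM)$-modules; that is, at each $x\in M$ the values of $Q_0,Q',Q_1$ lie in $\mathcal{Q}_0,\mathcal{Q}',\mathcal{Q}_1$, respectively.
   Context: **Notation.** $\mathfrak{so}(T_xM)$ is identified with $\Lambda^2T_xM$ by $(X\wedge Y)Z=g(X,Z)Y-g(Y,Z)X$, and $X\wedge_JY:=X\wedge Y+JX\wedge JY\in\mathfrak{u}(T_xM)$, where $\mathfrak{u}(T_xM)\simeq\mathfrak{u}(p,q)$ is the subalgebra of $\mathfrak{so}(T_xM)$ commuting with $J$. Equivalently, $(X\wedge_JY)Z=h(Z,X)Y-h(Z,Y)X$ with $h(X,Y)=g(X,Y)+g(X,JY)\mathrm{i}$, where $\mathrm{i}$ acts as $J$. For a symmetric endomorphism $H$ commuting with $J$ (identified with the symmetric bilinear form $g(H\cdot,\cdot)$), define the curvature-type tensor $$(H\wedge_Jg)(X,Y)=HX\wedge_JY+X\wedge_JHY+2g(HJX,Y)J+2g(JX,Y)JH.$$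 In particular $\left(\frac{\mathrm{Id}}{2}\wedge_Jg\right)(X,Y)=X\wedge_JY+2g(JX,Y)J$. **Curvature.** $R(X,Y)=\nabla_X\nabla_Y-\nabla_Y\nabla_X-\nabla_{[X,Y]}$, $\mathrm{Ric}(X,Y)=\mathrm{tr}(Z\mapsto R(Z,X)Y)$, $s$ is the scalar curvature and $\mathrm{grad}\,s$ its gradient. The Bochner tensor $B$ is defined by $R=B+K\wedge_Jg$ with $K=-\frac{1}{2(n+2)}\left(\mathrm{Ric}-\frac{s}{4(n+1)}g\right)$. With $X_1,\dots,X_{2n}$ a local frame, the tensor $\tilde D$ is $$\tilde D(Z)=-g^{ab}(\nabla_{X_a}R)(Z,X_b)+\frac{1}{4(n+1)}\left(\frac{\mathrm{Id}}{2}\wedge_Jg\right)(\mathrm{grad}\,s,Z)\in\mathfrak{u}(TM).$$ **Auxiliary tensors.** $$T_X=\frac{1}{8(n+2)(n+1)}\Big(J\circ(X\wedge_JJ\,\mathrm{grad}\,s)-g(\mathrm{grad}\,s,X)\mathrm{Id}\Big),$$ $$(\psi_1)_X=-\frac{1}{2(n+3)}\,\big(J\tilde D(JX)\big)\wedge_Jg,$$ $$(\psi_2)_X(Y,Z)=-\frac{1}{2(n+3)}\Big(\tilde D\big((Y\wedge_JZ)X\big)+X\wedge_J\big(\tilde D(Z)Y-\tilde D(Y)Z\big)\Big).$$ **Modules.** For $E=T_xM\simeq\mathbb{R}^{2p,2q}$, $\mathcal{R}(\mathfrak{u}(E))$ is the space of $R\in\mathrm{Hom}(\Lambda^2E,\mathfrak{u}(E))$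 with $R(X,Y)Z+R(Y,Z)X+R(Z,X)Y=0$, and $\mathcal{R}^\nabla(\mathfrak{u}(E))$ is the space of $S\in\mathrm{Hom}(E,\mathcal{R}(\mathfrak{u}(E)))$ with $S_X(Y,Z)+S_Y(Z,X)+S_Z(X,Y)=0$. It is a direct sum $\mathcal{Q}_0\oplus\mathcal{Q}'\oplus\mathcal{Q}_1$ of three pairwise non-isomorphic irreducible real $\mathfrak{u}(p,q)$-modules. For $n\ge3$ these are isomorphic respectively to $V_{3\pi_1+2\pi_{n-1}}$, $V_{\pi_1+2\pi_{n-1}}\simeq(\odot^2(\mathbb{C}^n)^*\otimes\mathbb{C}^n)_0$ (tensors for which the contraction of the upper index with a lower index is zero) and $\mathbb{R}^{2p,2q}$, where $V_\Lambda$ is the irreducible $\mathfrak{gl}(n,\mathbb{C})$-module of $\mathfrak{sl}(n,\mathbb{C})$-highest weight $\Lambda$ restricted to $\mathfrak{u}(p,q)$ ($\pi_i$ the fundamental weights of $\mathfrak{sl}(n,\mathbb{C})$), with $J$ acting as a complex structure. For $n=2$ they have complex dimensions $6$, $4$, $2$ respectively, with $\mathcal{Q}_1\simeq\mathbb{R}^{2p,2q}$. *)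

(* Defs.v *)
From HB Require Import structures.
From mathcomp Require Import all_boot all_order all_algebra.
From mathcomp Require Import all_classical all_reals all_analysis.
From mathcomp Require Import complex.

Set Implicit Arguments.
Unset Strict Implicit.
Unset Printing Implicit Defensive.

Import Order.TTheory GRing.Theory Num.Theory.
Import numFieldNormedType.Exports.

Local Open Scope classical_set_scope.
Local Open Scope ring_scope.

(* Conventions.  [n] is the complex dimension, so coordinates are row vectors
   in 'rV[R]_(n.*2).  Endomorphisms given by matrices act on the right: J is
   stored as a matrix with J v = v *m J.  A bilinear form is stored as its Gram
   matrix. *)

(** * Smooth manifolds *)

Section Smooth.
Variables (R : realType) (m : nat).
Local Notation E := 'rV[R]_m.

Fixpoint iter_partial (s : seq 'I_m) (f : E -> R) : E -> R :=
  if s is i :: s' then iter_partial s' (fun x => 'D_(delta_mx 0 i) f x) else f.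

(* C^infty on an open set: all iterated partial derivatives exist and are
   continuous. *)
Definition smooth_on (U : set E) (f : E -> R) : Prop :=
  forall (s : seq 'I_m) (x : E), U x ->
    {for x, continuous (iter_partial s f)} /\
    (forall i, derivable (iter_partial s f) x (delta_mx 0 i)).

Definition smooth_mx_on k l (U : set E) (F : E -> 'M[R]_(k, l)) : Prop :=
  forall i j, smooth_on U (fun x => F x i j).

End Smooth.

(* [chart_inv] is only meaningful on the image of [chart_dom]. *)
Record chart (R : realType) (M : topologicalType) (m : nat) := Chart {
  chart_dom : set M;
  chart_map : M -> 'rV[R]_m;
  chart_inv : 'rV[R]_m -> M }.

Section Manifold.
Variables (R : realType) (M : topologicalType) (m : nat).
Implicit Types (c d : chart R M m) (A : set (chart R M m)).
Local Notation E := 'rV[R]_m.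

Definition chart_im c : set E := chart_map c @` chart_dom c.

Definition is_chart c : Prop :=
  [/\ open (chart_dom c), open (chart_im c),
      (forall x, chart_dom c x -> chart_inv c (chart_map c x) = x),
      (forall x, chart_dom c x -> {for x, continuous (chart_map c)}) &
      (forall y, chart_im c y -> {for y, continuous (chart_inv c)})].

Definition transition c d : E -> E := chart_map d \o chart_inv c.

Definition smooth_atlas A : Prop :=
  [/\ (forall c, A c -> is_chart c),
      (forall x, exists2 c, A c & chart_dom c x) &
      (forall c d, A c -> A d ->
         smooth_mx_on (chart_map c @` (chart_dom c `&` chart_dom d))
                      (transition c d))].

Definition smooth_manifold A : Prop :=
  [/\ hausdorff_space M, @second_countable M & smooth_atlas A].

Definition transition_diff c d (x : M) (u : E) : E :=
  'D_u (transition c d) (chart_map c x).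

End Manifold.

(** * Connections and curvature in a coordinate domain *)

Definition bilin (R : realType) (m : nat) (G : 'M[R]_m) (x y : 'rV[R]_m) : R :=
  (x *m G *m y^T) 0 0.

(* Trace of the endomorphism f of 'rV[R]_m. *)
Definition endo_trace (R : realType) (m : nat) (f : 'rV[R]_m -> 'rV[R]_m) : R :=
  \tr (lin1_mx f).

Section Connection.
Variables (R : realType) (m : nat).
Local Notation E := 'rV[R]_m.
(* [Gam i j] is the coordinate expression of the vector field
   nabla_(d_i) d_j. *)
Variable Gam : 'I_m -> 'I_m -> E -> E.

Definition cov (X Y : E -> E) (x : E) : E :=
  'D_(X x) Y x + \sum_i \sum_j (X x 0 i * Y x 0 j) *: Gam i j x.

Definition bracket (X Y : E -> E) (x : E) : E := 'D_(X x) Y x - 'D_(Y x) X x.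

Definition curvature_op (X Y Z : E -> E) : E -> E := fun x =>
  cov X (cov Y Z) x - cov Y (cov X Z) x - cov (bracket X Y) Z x.

(* Tangent vectors are extended to the coordinate domain with constant
   coordinates; by tensoriality the extension is immaterial. *)
Definition curv (x : E) (u v w : E) : E :=
  curvature_op (cst u) (cst v) (cst w) x.

(* [cov_tensor F x t u v w] is ((nabla_t F)(u, v)) w at the point x, for a field
   F of tensors of the type of R. *)
Definition cov_tensor (F : E -> E -> E -> E -> E) (x t u v w : E) : E :=
  cov (cst t) (fun y => F y u v w) x
  - F x (cov (cst t) (cst u) x) v w
  - F x u (cov (cst t) (cst v) x) w
  - F x u v (cov (cst t) (cst w) x).

Definition torsion_free (U : set E) : Prop :=
  forall X Y, smooth_mx_on U X -> smooth_mx_on U Y ->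
  forall x, U x -> cov X Y x - cov Y X x = bracket X Y x.

Definition metric_connection (U : set E) (g : E -> 'M[R]_m) : Prop :=
  forall X Y Z, smooth_mx_on U X -> smooth_mx_on U Y -> smooth_mx_on U Z ->
  forall x, U x ->
    'D_(X x) (fun y => bilin (g y) (Y y) (Z y)) x =
    bilin (g x) (cov X Y x) (Z x) + bilin (g x) (Y x) (cov X Z x).

Definition levi_civita (U : set E) (g : E -> 'M[R]_m) : Prop :=
  [/\ forall i j, smooth_mx_on U (Gam i j), torsion_free U &
      metric_connection U g].

Definition parallel_endo (U : set E) (J : E -> 'M[R]_m) : Prop :=
  forall X Y, smooth_mx_on U X -> smooth_mx_on U Y ->
  forall x, U x -> cov X (fun y => Y y *m J y) x = cov X Y x *m J x.

End Connection.

(** * Pseudo-Kaehlerian manifolds *)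

Definition has_signature (R : realType) (m r : nat) (G : 'M[R]_m) : Prop :=
  exists2 P : 'M[R]_m, P \in unitmx &
    P *m G *m P^T = diag_mx (\row_i (if (i < r)%N then 1 else -1)).

Section PseudoKaehler.
Variables (R : realType) (p q : nat) (M : topologicalType).
Local Notation m := ((p + q).*2).
Local Notation E := 'rV[R]_m.
Variable A : set (chart R M m).
(* Tensor fields on M are given by their components in the charts of A. *)
Variables (g J : chart R M m -> E -> 'M[R]_m).
Variable Gam : chart R M m -> 'I_m -> 'I_m -> E -> E.

Definition pseudo_riemannian_metric : Prop :=
  [/\ forall c, A c -> smooth_mx_on (chart_im c) (g c),
      forall c x, A c -> chart_im c x ->
        (g c x)^T = g c x /\ has_signature p.*2 (g c x) &
      forall c d x, A c -> A d -> chart_dom c x -> chart_dom d x ->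
      forall u v, bilin (g c (chart_map c x)) u v =
        bilin (g d (chart_map d x))
              (transition_diff c d x u) (transition_diff c d x v)].

Definition almost_complex_structure : Prop :=
  [/\ forall c, A c -> smooth_mx_on (chart_im c) (J c),
      forall c x, A c -> chart_im c x -> J c x *m J c x = - 1%:M &
      forall c d x, A c -> A d -> chart_dom c x -> chart_dom d x ->
      forall u, transition_diff c d x (u *m J c (chart_map c x)) =
        transition_diff c d x u *m J d (chart_map d x)].

(* [Gam] gives the Levi-Civita connection of g; its expressions in different
   charts match because a metric has only one such connection. *)
Definition pseudo_kaehler : Prop :=
  [/\ smooth_manifold A,
      pseudo_riemannian_metric,
      almost_complex_structure,
      (forall c x, A c -> chart_im c x -> forall u v,
         bilin (g c x) (u *m J c x) (v *m J c x) = bilin (g c x) u v) &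
      forall c, A c -> levi_civita (Gam c) (chart_im c) (g c) /\
                       parallel_endo (Gam c) (chart_im c) (J c)].

End PseudoKaehler.

(** * Pointwise algebra *)

Section Wedge.
Variables (R : realType) (m : nat) (G Jx : 'M[R]_m).
Local Notation E := 'rV[R]_m.
Local Notation J v := (v *m Jx).

Definition wedge (x y z : E) : E := bilin G x z *: y - bilin G y z *: x.

Definition wedgeJ (x y z : E) : E := wedge x y z + wedge (J x) (J y) z.

(* [wedgeJg H x y] is the endomorphism (H /\_J g)(x, y). *)
Definition wedgeJg (H : E -> E) (x y z : E) : E :=
  wedgeJ (H x) y z + wedgeJ x (H y) z
  + (2 * bilin G (H (J x)) y) *: J z + (2 * bilin G (J x) y) *: J (H z).

(* The vector dual to the linear form alpha. *)
Definition sharp (alpha : E -> R) : E :=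
  (\row_j alpha (delta_mx 0 j)) *m invmx G.

End Wedge.

(** * Tensors on a pseudo-Kaehlerian coordinate domain *)

Section Tensors.
Variables (R : realType) (n : nat).
Local Notation E := 'rV[R]_(n.*2).
Variables (g J : E -> 'M[R]_(n.*2)) (Gam : 'I_(n.*2) -> 'I_(n.*2) -> E -> E).
Local Notation e i := (delta_mx 0 i : E).

Definition ric (x u v : E) : R := endo_trace (fun z => curv Gam x z u v).

Definition ric_endo (x u : E) : E := sharp (g x) (ric x u).

Definition scal (x : E) : R :=
  \sum_a \sum_b invmx (g x) a b * ric x (e a) (e b).

Definition grad_scal (x : E) : E := sharp (g x) (fun u => 'D_u scal x).

Definition K_endo (x u : E) : E :=
  - (2 * (n%:R + 2))^-1 *: (ric_endo x u - (scal x / (4 * (n%:R + 1))) *: u).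

Definition bochner (x u v w : E) : E :=
  curv Gam x u v w - wedgeJg (g x) (J x) (K_endo x) u v w.

Definition nablaR : E -> E -> E -> E -> E -> E := cov_tensor Gam (curv Gam).

Definition nablaB : E -> E -> E -> E -> E -> E := cov_tensor Gam bochner.

Definition tildeD (x z w : E) : E :=
  - (\sum_a \sum_b invmx (g x) a b *: nablaR x (e a) z (e b) w)
  + (4 * (n%:R + 1))^-1 *:
      wedgeJg (g x) (J x) (fun u => 2^-1 *: u) (grad_scal x) z w.

Definition T_endo (x u w : E) : E :=
  (8 * (n%:R + 2) * (n%:R + 1))^-1 *:
    (wedgeJ (g x) (J x) u (grad_scal x *m J x) w *m J x
     - bilin (g x) (grad_scal x) u *: w).

Definition psi1 (x u v w z : E) : E :=
  - (2 * (n%:R + 3))^-1 *: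
    wedgeJg (g x) (J x) (fun t => tildeD x (u *m J x) t *m J x) v w z.

Definition psi2 (x u v w z : E) : E :=
  - (2 * (n%:R + 3))^-1 *:
    (tildeD x (wedgeJ (g x) (J x) v w u) z
     + wedgeJ (g x) (J x) u (tildeD x w v - tildeD x v w) z).

Definition Q0_tensor (x u v w z : E) : E :=
  nablaB x u v w z + (n%:R + 2)^-1 *: psi1 x u v w z + psi2 x u v w z.

Definition Q'_tensor (x u v w z : E) : E := psi1 x u v w z - psi2 x u v w z.

Definition Q1_tensor (x u v w z : E) : E :=
  wedgeJg (g x) (J x) (T_endo x u) v w z.

End Tensors.

(** * Modules over the unitary Lie algebra of (E, G, J) *)

Section Modules.
Variables (R : realType) (n : nat) (G Jx : 'M[R]_(n.*2)).
Local Notation E := 'rV[R]_(n.*2).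
Local Notation J v := (v *m Jx).

Definition in_u (a : 'End(E)) : Prop :=
  (forall x y, bilin G (a x) y + bilin G x (a y) = 0) /\
  (forall x, a (J x) = J (a x)).

(* Action on Hom(V, W) induced by the actions [a] on V and [b] on W. *)
Definition hom_act (V W : vectType R) (a : V -> V) (b : W -> W)
    (f : 'Hom(V, W)) : 'Hom(V, W) := linfun (fun x => b (f x) - f (a x)).

(* A module is a subspace W of a vectType V, with [act a] the action on V of an
   element a of u(E). *)
Definition submodule (V : vectType R) (act : 'End(E) -> V -> V)
    (W : {vspace V}) : Prop :=
  forall a, in_u a -> forall w, w \in W -> act a w \in W.

Definition irreducible (V : vectType R) (act : 'End(E) -> V -> V)
    (W : {vspace V}) : Prop :=
  [/\ submodule act W, W <> 0%VS &
      forall U : {vspace V}, submodule act U -> (U <= W)%VS ->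
        U = 0%VS \/ U = W].

Definition module_iso (V1 V2 : vectType R) (act1 : 'End(E) -> V1 -> V1)
    (act2 : 'End(E) -> V2 -> V2) (W1 : {vspace V1}) (W2 : {vspace V2}) : Prop :=
  exists f : 'Hom(V1, V2),
    [/\ (f @: W1)%VS = W2, (W1 :&: lker f)%VS = 0%VS &
        forall a, in_u a -> forall w, w \in W1 -> f (act1 a w) = act2 a (f w)].

Definition act_vec (a : 'End(E)) : E -> E := a.

Definition act_bil (a : 'End(E)) :
    'Hom(E, 'End(E)) -> 'Hom(E, 'End(E)) := hom_act a (hom_act a a).

Definition tensor5 := 'Hom(E, 'Hom(E, 'Hom(E, 'End(E)))).

Definition act_tensor5 (a : 'End(E)) : tensor5 -> tensor5 :=
  hom_act a (hom_act a (hom_act a (hom_act a a))).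

(* The space R(u(E)). *)
Definition curvature_tensor (S : 'Hom(E, 'Hom(E, 'End(E)))) : Prop :=
  [/\ forall x y, S x y = - S y x,
      forall x y, in_u (S x y) &
      forall x y z, S x y z + S y z x + S z x y = 0].

(* The space R^nabla(u(E)). *)
Definition nabla_curvature_tensor (S : tensor5) : Prop :=
  (forall x, curvature_tensor (S x)) /\
  (forall x y z, S x y z + S y z x + S z x y = 0).

(* Trace-free elements of Sym^2 (C^n)^* (x) C^n, where C^n is E with i acting
   as J: C-bilinear symmetric maps b : E x E -> E such that the complex trace of
   b(x, .) vanishes.  The complex trace of a C-linear endomorphism f is
   (tr f - i tr (J f)) / 2, with real traces on the right. *)
Definition tracefree_sym (b : 'Hom(E, 'End(E))) : Prop :=
  [/\ forall x y, b x y = b y x,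
      forall x y, b (J x) y = J (b x y) &
      forall x, endo_trace (b x) = 0 /\ endo_trace (fun y => J (b x y)) = 0].

Definition iso_tracefree_sym (Q : {vspace tensor5}) : Prop :=
  exists2 W : {vspace 'Hom(E, 'End(E))},
    (forall b, b \in W <-> tracefree_sym b) &
    module_iso act_tensor5 act_bil Q W.

(* A complex irreducible gl(n, C)-module with sl(n, C)-highest weight
   sum_k lam k * pi_k, 1 <= k <= n - 1 (upper triangular Borel subalgebra), on
   which the scalar matrix i squares to - Id. *)
Definition highest_weight_module (V : vectType R[i])
    (rho : 'M[R[i]]_n -> 'End(V)) (lam : nat -> nat) : Prop :=
  [/\ (forall (k : R[i]) a b, rho (k *: a + b) = k *: rho a + rho b) /\
      (forall a b v, rho (a *m b - b *m a) v = rho a (rho b v) - rho b (rho a v)),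
      (forall U : {vspace V}, (forall a v, v \in U -> rho a v \in U) ->
        U = 0%VS \/ U = fullv),
      (exists v : V, [/\ v <> 0,
         forall i j : 'I_n, (i < j)%N -> rho (delta_mx i j) v = 0 &
         forall i j : 'I_n, j = i.+1 :> nat ->
           rho (delta_mx i i - delta_mx j j) v = (lam i.+1)%:R *: v]) &
      forall v, rho ((0 +i* 1)%C%:M) (rho ((0 +i* 1)%C%:M) v) = - v].

(* Q is isomorphic over u(E) to the restriction of the module V_lam; u(E) is
   embedded in gl(n, C) by an isomorphism of complex vector spaces
   (E, J) -> C^n. *)
Definition iso_highest_weight (Q : {vspace tensor5}) (lam : nat -> nat) : Prop :=
  exists (V : vectType R[i]) (rho : 'M[R[i]]_n -> 'End(V))
         (phi : E -> 'cV[R[i]]_n) (f : tensor5 -> V),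
    [/\ highest_weight_module rho lam,
        bijective phi /\
        (forall (k : R) x y, phi (k *: x + y) = (k +i* 0)%C *: phi x + phi y) /\
        (forall x, phi (J x) = (0 +i* 1)%C *: phi x),
        (forall (k : R) S S', f (k *: S + S') = (k +i* 0)%C *: f S + f S'),
        (forall v, exists2 S, S \in Q & f S = v) /\
        (forall S, S \in Q -> f S = 0 -> S = 0) &
        forall (a : 'End(E)) (b : 'M[R[i]]_n), in_u a ->
          (forall x, phi (a x) = b *m phi x) ->
          forall S, S \in Q -> f (act_tensor5 a S) = rho b (f S)].

(* J, as an element of u(E), acts on Q as a complex structure for which Q has
   dimension d. *)
Definition complex_dim (Q : {vspace tensor5}) (d : nat) : Prop :=
  (forall S, S \in Q ->
     act_tensor5 (linfun (fun v => J v)) (act_tensor5 (linfun (fun v => J v)) S)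
     = - S) /\
  \dim Q = d.*2.

(* The decomposition R^nabla(u(E)) = Q0 (+) Q' (+) Q1 into irreducible modules,
   identified by their isomorphism types. *)
Record nabla_decomposition (Q0 Q' Q1 : {vspace tensor5}) : Prop := {
  dec_direct : directv (Q0 + Q' + Q1);
  dec_sum : forall S, S \in (Q0 + Q' + Q1)%VS <-> nabla_curvature_tensor S;
  dec_irr0 : irreducible act_tensor5 Q0;
  dec_irr' : irreducible act_tensor5 Q';
  dec_irr1 : irreducible act_tensor5 Q1;
  dec_niso0' : ~ module_iso act_tensor5 act_tensor5 Q0 Q';
  dec_niso01 : ~ module_iso act_tensor5 act_tensor5 Q0 Q1;
  dec_niso'1 : ~ module_iso act_tensor5 act_tensor5 Q' Q1;
  dec_vec : module_iso act_tensor5 act_vec Q1 fullv;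
  dec_ge3 : (3 <= n)%N ->
    [/\ iso_highest_weight Q0
          (fun k => 3 * (k == 1%N) + 2 * (k == n.-1))%N,
        iso_highest_weight Q'
          (fun k => (k == 1%N) + 2 * (k == n.-1))%N &
        iso_tracefree_sym Q'];
  dec_eq2 : n = 2%N ->
    [/\ complex_dim Q0 6, complex_dim Q' 4 & complex_dim Q1 2] }.

(* The multilinear map F, a tensor of the type of nabla R, belongs to Q. *)
Definition tensor_in (Q : {vspace tensor5}) (F : E -> E -> E -> E -> E) : Prop :=
  exists2 S : tensor5, S \in Q & forall x y z w, S x y z w = F x y z w.

End Modules.

(* Main.v *)
(* Set D = D~(nabla R) and v = grad s.  The maps D |-> psi_1 - psi_2 and
   v |-> T /\_J g embed the tensors of the algebraic type of D~ and the vectors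
   equivariantly into R^nabla(u(E)), and D~ and the gradient are equivariant left
   inverses of these embeddings, each vanishing on the image of the other.  Hence
   S |-> psi_1 - psi_2 and S |-> T /\_J g are orthogonal equivariant idempotents of
   R^nabla(u(E)).  By Schur's lemma they act on each of the three pairwise
   non-isomorphic irreducible summands as zero or the identity.  The second is the
   projection onto Q_1, being nonzero and factoring through E.  The first is nonzero
   and factors through the trace-free part of Sym^2 (C^n)^* (x) C^n, so that it is
   not the identity on Q_0: for n >= 3 that part is isomorphic to Q', for n = 2 its
   dimension is too small.  Hence it is the projection onto Q'.

   On the geometric side, nabla R satisfies the algebraic identities of
   R^nabla(u(E)).  As nabla (K /\_J g) = (nabla K) /\_J g and nabla K is determined
   by D and v, one gets
   nabla_X (K /\_J g) = (n+3)/(n+2) (psi_1)_X + T_X /\_J g, so that Q_0 is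
   nabla R - (psi_1 - psi_2) - T /\_J g. *)

Require Import Defs.
From mathcomp Require Import all_boot all_order all_algebra.
From mathcomp Require Import all_classical all_reals all_analysis.
From mathcomp Require Import ring lra.
From HB Require Import structures.

Set Implicit Arguments.
Unset Strict Implicit.
Unset Printing Implicit Defensive.

Import Order.TTheory GRing.Theory Num.Theory.
Local Open Scope ring_scope.

(** * Schur's lemma *)

Section Schur.
Variables (R : realType) (n : nat) (G J : 'M[R]_(n.*2)).
Local Notation E := 'rV[R]_(n.*2).

Definition equivariant (V1 V2 : vectType R) (act1 : 'End(E) -> V1 -> V1)
    (act2 : 'End(E) -> V2 -> V2) (W : {vspace V1}) (f : V1 -> V2) : Prop :=
  forall a, in_u G J a -> forall w, w \in W -> f (act1 a w) = act2 a (f w).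

Lemma schur (V1 V2 : vectType R) (act1 : 'End(E) -> V1 -> V1)
    (act2 : 'End(E) -> V2 -> V2) (W1 : {vspace V1}) (W2 : {vspace V2})
    (f : 'Hom(V1, V2)) :
  (forall a, act2 a 0 = 0) -> irreducible G J act1 W1 ->
  irreducible G J act2 W2 -> (f @: W1 <= W2)%VS ->
  equivariant act1 act2 W1 f ->
  (forall w, w \in W1 -> f w = 0) \/ module_iso G J act1 act2 W1 W2.
Proof.
move=> act0 [subW1 _ irrW1] [_ _ irrW2] fW feq.
have subK : submodule G J act1 (W1 :&: lker f)%VS.
  move=> a ua w /[!memv_cap] /andP[wW1]; rewrite !memv_ker => /eqP fw0.
  by rewrite subW1// feq// fw0 act0 eqxx.
have subI : submodule G J act2 (f @: W1)%VS.
  move=> a ua _ /memv_imgP[w wW1 ->].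
  by rewrite -feq// memv_img// subW1.
have [K0|KW] := irrW1 _ subK (capvSl _ _); last first.
  left=> w wW1; apply/eqP; rewrite -memv_ker.
  by move: wW1; rewrite -{1}KW memv_cap => /andP[].
have [I0|IW] := irrW2 _ subI fW.
  by left=> w wW1; apply/eqP; rewrite -memv0 -I0 memv_img.
by right; exists f.
Qed.

Lemma module_iso_sym (V1 V2 : vectType R) (act1 : 'End(E) -> V1 -> V1)
    (act2 : 'End(E) -> V2 -> V2) (W1 : {vspace V1}) (W2 : {vspace V2}) :
  submodule G J act1 W1 ->
  module_iso G J act1 act2 W1 W2 -> module_iso G J act2 act1 W2 W1.
Proof.
move=> subW1 [f [fW fK feq]].
have [B [BW Bf]] : exists B : 'Hom(V2, V1),
    (forall w, w \in W2 -> B w \in W1) /\ (forall w, w \in W2 -> f (B w) = w).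
  pose pi := projv W1; pose h := (f \o pi)%VF.
  exists (pi \o h^-1)%VF; split=> w wW2; first by rewrite comp_lfunE memv_proj.
  rewrite comp_lfunE; suff : h (h^-1 w)%VF = w by rewrite comp_lfunE.
  apply: limg_lfunVK; move: wW2; rewrite -fW => /memv_imgP[v vW1 ->].
  have -> : f v = h v by rewrite comp_lfunE/= projv_id.
  exact: memv_img (memvf _).
have inj v w : v \in W1 -> w \in W1 -> f v = f w -> v = w.
  move=> vW wW fvw; apply/eqP; rewrite -subr_eq0 -memv0 -fK memv_cap memvB//=.
  by rewrite memv_ker linearB/= fvw subrr.
exists B; split.
- apply/eqP; rewrite eqEsubv; apply/andP; split.
    by apply/subvP=> _ /memv_imgP[w wW2 ->]; exact: BW.
  apply/subvP=> v vW1; have fv : f v \in W2 by rewrite -fW memv_img.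
  have -> : v = B (f v) by apply: inj => //; [exact: BW | rewrite Bf].
  exact: memv_img.
- apply/eqP; rewrite -subv0; apply/subvP=> w; rewrite memv_cap memv_ker.
  by case/andP=> wW2 /eqP Bw; rewrite -(Bf w)// Bw linear0 mem0v.
- move=> a ua w wW2.
  have aw : act2 a w = f (act1 a (B w)) by rewrite feq ?Bf//; exact: BW.
  have bW := subW1 a ua _ (BW _ wW2).
  have awW : act2 a w \in W2 by rewrite aw -fW memv_img.
  by apply: inj; rewrite ?BW// Bf// aw.
Qed.

Lemma module_iso_trans (V1 V2 V3 : vectType R) (act1 : 'End(E) -> V1 -> V1)
    (act2 : 'End(E) -> V2 -> V2) (act3 : 'End(E) -> V3 -> V3)
    (W1 : {vspace V1}) (W2 : {vspace V2}) (W3 : {vspace V3}) :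
  module_iso G J act1 act2 W1 W2 -> module_iso G J act2 act3 W2 W3 ->
  module_iso G J act1 act3 W1 W3.
Proof.
move=> [f [fW fK feq]] [h [hW hK heq]]; exists (h \o f)%VF; split.
- by rewrite limg_comp fW.
- apply/eqP; rewrite -subv0; apply/subvP=> w; rewrite memv_cap memv_ker.
  rewrite comp_lfunE => /andP[wW1 hfw].
  rewrite -fK memv_cap wW1 memv_ker -memv0 -hK memv_cap memv_ker hfw andbT.
  by rewrite -fW memv_img.
- by move=> a ua w wW1; rewrite !comp_lfunE/= feq// heq// -fW memv_img.
Qed.

Section Projection.
Variables (V : vectType R) (act : 'End(E) -> V -> V).
Hypothesis actD : forall a, {morph act a : u v / u + v}.

Lemma daddv_pi_equivariant (W W' : {vspace V}) :
  submodule G J act W -> submodule G J act W' -> (W :&: W' = 0)%VS ->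
  equivariant act act (W + W')%VS (daddv_pi W W').
Proof.
move=> sW sW' d a ua _ /memv_addP[u uW [v vW' ->]].
have d' : (W' :&: W = 0)%VS by rewrite capvC.
have pi0 x : x \in W' -> daddv_pi W W' x = 0.
  move=> xW'; have := daddv_pi_add d (subvP (addvSr W W') _ xW').
  by rewrite (daddv_pi_id d' xW') => /(canRL (addrK _)); rewrite subrr.
rewrite actD !linearD/= (pi0 v)// (pi0 (act a v)) ?sW'// !addr0.
by rewrite !(daddv_pi_id d) ?sW.
Qed.

Lemma submoduleD (W W' : {vspace V}) :
  submodule G J act W -> submodule G J act W' -> submodule G J act (W + W')%VS.
Proof.
move=> sW sW' a ua _ /memv_addP[u uW [v vW' ->]].
by rewrite actD memv_add ?sW ?sW'.
Qed.

Lemma irreducible_submoduleD (A B C : {vspace V}) :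
  irreducible G J act A -> irreducible G J act B -> irreducible G J act C ->
  submodule G J act (A + B + C)%VS.
Proof. by move=> [sA _ _] [sB _ _] [sC _ _]; exact: submoduleD (submoduleD sA sB) sC. Qed.

Lemma act_0 a : act a 0 = 0.
Proof. by apply: (addrI (act a 0)); rewrite -actD !addr0. Qed.

Lemma idempotent_on_summand (W A B : {vspace V}) (P : 'End(V)) :
  irreducible G J act W -> irreducible G J act A -> irreducible G J act B ->
  ~ module_iso G J act act W A -> ~ module_iso G J act act W B ->
  (W :&: (A + B) = 0)%VS -> (A :&: B = 0)%VS ->
  (forall w, w \in (W + (A + B))%VS -> P w \in (W + (A + B))%VS) ->
  equivariant act act (W + (A + B))%VS P ->
  (forall w, w \in (W + (A + B))%VS -> P (P w) = P w) ->
  (forall w, w \in W -> P w = 0) \/ (forall w, w \in W -> P w = w).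
Proof.
move=> iW iA iB nA nB dW dAB PU Peq PP.
have [sW _ irrW] := iW; have [sA _ _] := iA; have [sB _ _] := iB.
have sAB := submoduleD sA sB.
have WU := subvP (addvSl W (A + B)).
have dBA : (B :&: A = 0)%VS by rewrite capvC.
have dABW : ((A + B) :&: W = 0)%VS by rewrite capvC.
have PWW w : w \in W -> P w \in W.
  move=> wW; pose r := daddv_pi (A + B) W.
  have req : equivariant act act (W + (A + B))%VS r.
    by rewrite addvC; exact: daddv_pi_equivariant.
  suff r0 : r (P w) = 0.
    rewrite -(daddv_pi_add dW (PU _ (WU _ wW))) -/r r0 addr0.
    exact: memv_pi.
  rewrite -(daddv_pi_add dAB (memv_pi _ _ _ : r (P w) \in A + B)%VS).
  have zero X Y : irreducible G J act X -> irreducible G J act Y ->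
      (X :&: Y = 0)%VS -> (A + B = X + Y)%VS -> ~ module_iso G J act act W X ->
      daddv_pi X Y (r (P w)) = 0.
    move=> iX iY dXY ABXY nX; have [sX _ _] := iX; have [sY _ _] := iY.
    pose f := (daddv_pi X Y \o (r \o P))%VF.
    have fW : (f @: W <= X)%VS.
      by apply/subvP=> _ /memv_imgP[v _ ->]; rewrite comp_lfunE memv_pi.
    have feq : equivariant act act W f.
      move=> a ua v vW; rewrite !comp_lfunE/=.
      rewrite Peq ?WU// req ?PU ?WU// daddv_pi_equivariant//.
      by rewrite -ABXY; exact: memv_pi.
    have [f0|//] := schur act_0 iW iX fW feq.
    by have := f0 w wW; rewrite !comp_lfunE.
  by rewrite (zero A B)// (zero B A)// ?addr0// addvC.
have subK : submodule G J act (W :&: lker P)%VS.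
  move=> a ua w /[!memv_cap] /andP[wW]; rewrite !memv_ker => /eqP Pw0.
  by rewrite sW// Peq ?WU// Pw0 act_0 eqxx.
have [K0|KW] := irrW _ subK (capvSl _ _); last first.
  left=> w wW1; apply/eqP; rewrite -memv_ker.
  by move: wW1; rewrite -{1}KW memv_cap => /andP[].
right=> w wW; apply/eqP; rewrite -subr_eq0 -memv0 -K0 memv_cap memvB ?PWW//=.
by rewrite memv_ker linearB/= PP ?WU// subrr.
Qed.

End Projection.
End Schur.

(** * Multilinear maps and traces *)

Section RowVectors.
Variables (R : comPzRingType) (k l : nat).
Implicit Types A B : 'M[R]_(k, l).

Lemma mx_addE A B i j : (A + B) i j = A i j + B i j. Proof. exact: mxE. Qed.
Lemma mx_oppE A i j : (- A) i j = - A i j. Proof. exact: mxE. Qed.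
Lemma mx_scaleE c A i j : (c *: A) i j = c * A i j. Proof. exact: mxE. Qed.
Lemma mx_zeroE i j : (0 : 'M[R]_(k, l)) i j = 0. Proof. exact: mxE. Qed.

Definition mx_linE := (mx_addE, mx_oppE, mx_scaleE, mx_zeroE).
End RowVectors.

(* Identities between linear combinations of vectors, checked coordinatewise. *)
Ltac vring := apply/matrixP => ? ?; rewrite ?mx_linE; ring.
Ltac vfield := apply/matrixP => ? ?; rewrite ?mx_linE; field.

Section Linfun.
Variable R : realType.

Definition lin (V W : lmodType R) (f : V -> W) : Prop :=
  forall k x y, f (k *: x + y) = k *: f x + f y.

Lemma lin_lfun (V W : vectType R) (f : 'Hom(V, W)) : lin f.
Proof. by move=> k x y; rewrite linearP. Qed.

Definition to_linear (V W : lmodType R) (f : V -> W) (hf : lin f) :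
  {linear V -> W} := HB.pack f (GRing.isLinear.Build R V W *:%R f hf).

Lemma linfunE (V W : vectType R) (f : V -> W) : lin f -> linfun f =1 f.
Proof. by move=> hf x; rewrite (lfunE (to_linear hf)). Qed.

Lemma lin0 (V W : lmodType R) (f : V -> W) : lin f -> f 0 = 0.
Proof. by move=> hf; rewrite -[f]/(to_linear hf : V -> W) linear0. Qed.

Lemma linD (V W : lmodType R) (f : V -> W) : lin f -> {morph f : x y / x + y}.
Proof. by move=> hf x y; rewrite -[f]/(to_linear hf : V -> W) linearD. Qed.

Lemma linZ (V W : lmodType R) (f : V -> W) : lin f ->
  forall k, {morph f : x / k *: x}.
Proof. by move=> hf k x; rewrite -[f]/(to_linear hf : V -> W) linearZ. Qed.

Lemma linN (V W : lmodType R) (f : V -> W) : lin f -> {morph f : x / - x}.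
Proof. by move=> hf x; rewrite -[f]/(to_linear hf : V -> W) linearN. Qed.

Section LinOps.
Variables V W X : lmodType R.

Lemma lin_add (f h : V -> W) : lin f -> lin h -> lin (fun x => f x + h x).
Proof. by move=> hf hh k x y; rewrite hf hh scalerDr addrACA. Qed.

Lemma lin_opp (f : V -> W) : lin f -> lin (fun x => - f x).
Proof. by move=> hf k x y; rewrite hf opprD scalerN. Qed.

Lemma lin_sub (f h : V -> W) : lin f -> lin h -> lin (fun x => f x - h x).
Proof. by move=> hf hh; apply: lin_add => //; exact: lin_opp. Qed.

Lemma lin_scale c (f : V -> W) : lin f -> lin (fun x => c *: f x).
Proof. by move=> hf k x y; rewrite hf scalerDr !scalerA mulrC. Qed.

Lemma lin_comp (h : W -> X) (f : V -> W) : lin h -> lin f -> lin (fun x => h (f x)).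
Proof. by move=> hh hf k x y; rewrite hf hh. Qed.
End LinOps.

Section HomAct.
Variable m : nat.
Local Notation E := 'rV[R]_m.

Lemma hom_actE (V W : vectType R) (a : V -> V) (b : W -> W) (f : 'Hom(V, W)) x :
  lin a -> lin b -> hom_act a b f x = b (f x) - f (a x).
Proof.
move=> ha hb; rewrite /hom_act linfunE// => k y z.
by rewrite linearP hb ha linearP scalerBr addrACA opprD.
Qed.

Lemma hom_act_lin (V W : vectType R) (a : V -> V) (b : W -> W) :
  lin a -> lin b -> lin (hom_act a b).
Proof.
move=> ha hb k f h; apply/lfunP=> x.
rewrite add_lfunE scale_lfunE !hom_actE// add_lfunE scale_lfunE hb.
by rewrite add_lfunE scale_lfunE scalerBr addrACA opprD.
Qed.

End HomAct.

Definition hom2 m (f : 'rV[R]_m -> 'rV[R]_m -> 'rV[R]_m) :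
  'Hom('rV[R]_m, 'End('rV[R]_m)) := linfun (fun x => linfun (f x)).

Definition hom4 m (f : 'rV[R]_m -> 'rV[R]_m -> 'rV[R]_m -> 'rV[R]_m -> 'rV[R]_m) :
  'Hom('rV[R]_m, 'Hom('rV[R]_m, 'Hom('rV[R]_m, 'End('rV[R]_m)))) :=
  linfun (fun x => linfun (fun y => linfun (fun z => linfun (f x y z)))).

Section MultiLin.
Variable m : nat.
Local Notation E := 'rV[R]_m.

Definition lin2 (f : E -> E -> E) : Prop :=
  (forall y, lin (f^~ y)) /\ (forall x, lin (f x)).

Definition lin4 (f : E -> E -> E -> E -> E) : Prop :=
  [/\ forall y z w, lin (fun x => f x y z w), forall x z w, lin (fun y => f x y z w),
      forall x y w, lin (fun z => f x y z w) & forall x y z, lin (f x y z)].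

Lemma hom2E f x y : lin2 f -> hom2 f x y = f x y.
Proof.
move=> [h1 h2]; rewrite /hom2 linfunE => [|k u v]; first by rewrite linfunE.
by apply/lfunP=> z; rewrite add_lfunE scale_lfunE !linfunE// h1.
Qed.

Lemma hom4E f x y z w : lin4 f -> hom4 f x y z w = f x y z w.
Proof.
move=> [h1 h2 h3 h4].
have e4 a b c v : linfun (f a b c) v = f a b c v by rewrite linfunE.
have e3 a b c v : linfun (fun z => linfun (f a b z)) c v = f a b c v.
  rewrite linfunE => [|k s t]; first by rewrite e4.
  by apply/lfunP=> r; rewrite add_lfunE scale_lfunE !e4 h3.
have e2 a b c v : linfun (fun y => linfun (fun z => linfun (f a y z))) b c v = f a b c v.
  rewrite linfunE => [|k s t]; first by rewrite e3.
  by do 2![apply/lfunP=> ?; rewrite add_lfunE scale_lfunE]; rewrite !e3 h2.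
rewrite /hom4 linfunE => [|k s t]; first by rewrite e2.
by do 3![apply/lfunP=> ?; rewrite add_lfunE scale_lfunE]; rewrite !e2 h1.
Qed.

End MultiLin.
End Linfun.

Section Metric.
Variables (R : realType) (n : nat) (G Jx : 'M[R]_(n.*2)).
Local Notation E := 'rV[R]_(n.*2).
Local Notation J v := (v *m Jx).
Local Notation g := (bilin G).
Local Notation e i := (delta_mx 0 i : E).

Lemma gDl x y z : g (x + y) z = g x z + g y z.
Proof. by rewrite /bilin !mulmxDl mxE. Qed.
Lemma gDr x y z : g x (y + z) = g x y + g x z.
Proof. by rewrite /bilin linearD/= mulmxDr mxE. Qed.
Lemma gZl k x y : g (k *: x) y = k * g x y.
Proof. by rewrite /bilin -!scalemxAl mxE. Qed.
Lemma gZr k x y : g x (k *: y) = k * g x y.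
Proof. by rewrite /bilin linearZ/= -scalemxAr mxE. Qed.
Lemma gNl x y : g (- x) y = - g x y.
Proof. by rewrite -scaleN1r gZl mulN1r. Qed.
Lemma gNr x y : g x (- y) = - g x y.
Proof. by rewrite -scaleN1r gZr mulN1r. Qed.
Lemma g0l y : g 0 y = 0. Proof. by rewrite -(scale0r 0) gZl mul0r. Qed.
Lemma g0r y : g y 0 = 0. Proof. by rewrite -(scale0r 0) gZr mul0r. Qed.
Definition gE := (gDl, gDr, gNl, gNr, gZl, gZr, g0l, g0r).

Lemma JD (x y : E) : J (x + y) = J x + J y. Proof. exact: mulmxDl. Qed.
Lemma JN (x : E) : J (- x) = - J x. Proof. exact: mulNmx. Qed.
Lemma JZ k (x : E) : J (k *: x) = k *: J x. Proof. by rewrite scalemxAl. Qed.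
Lemma J0 : J (0 : E) = 0. Proof. exact: mul0mx. Qed.

Lemma endo_traceE (f : E -> E) : endo_trace f = \sum_i f (e i) 0 i.
Proof. by rewrite /endo_trace /mxtrace; apply: eq_bigr => i _; rewrite !mxE. Qed.

Lemma eq_trace (f h : E -> E) : f =1 h -> endo_trace f = endo_trace h.
Proof. by move=> fh; rewrite !endo_traceE; apply: eq_bigr => i _; rewrite fh. Qed.
Lemma trD (f h : E -> E) :
  endo_trace (fun z => f z + h z) = endo_trace f + endo_trace h.
Proof. by rewrite !endo_traceE -big_split; apply: eq_bigr => i _; rewrite mxE. Qed.
Lemma trN (f : E -> E) : endo_trace (fun z => - f z) = - endo_trace f.
Proof. by rewrite !endo_traceE -sumrN; apply: eq_bigr => i _; rewrite mxE. Qed.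
Lemma trZ k (f : E -> E) : endo_trace (fun z => k *: f z) = k * endo_trace f.
Proof. by rewrite !endo_traceE mulr_sumr; apply: eq_bigr => i _; rewrite mxE. Qed.
Definition trE := (trD, trN, trZ).

Lemma tr_id : endo_trace (fun z : E => z) = 2 * n%:R.
Proof.
rewrite endo_traceE (eq_bigr (fun=> 1)) => [|i _]; last by rewrite mxE !eqxx.
by rewrite big_const_ord iter_addr_0 -muln2 natrM mulrC.
Qed.

Lemma tr_rank1 (al : E -> R) (q : E) : (forall k x y, al (k *: x + y) = k * al x + al y) ->
  endo_trace (fun z => al z *: q) = al q.
Proof.
move=> hal; rewrite endo_traceE (eq_bigr (fun i => q 0 i * al (e i))); last first.
  by move=> i _; rewrite mxE mulrC.
have al0 : al 0 = 0 by have := hal 1 0 0; rewrite scaler0 addr0; lra.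
rewrite [q in RHS](row_sum_delta q).
by elim/big_rec2: _ => [|i x y _ ->]; rewrite ?hal.
Qed.

Lemma endo_mx (f : E -> E) : lin f -> forall z, f z = z *m lin1_mx f.
Proof. by move=> hf z; rewrite (mul_rV_lin1 (to_linear hf)). Qed.

Lemma tr_mx (M : 'M[R]_(n.*2)) : endo_trace (fun z : E => z *m M) = \tr M.
Proof. by rewrite endo_traceE; apply: eq_bigr => i _; rewrite -rowE mxE. Qed.

Lemma tr_comp (f h : E -> E) : lin f -> lin h ->
  endo_trace (fun z => f (h z)) = endo_trace (fun z => h (f z)).
Proof.
move=> hf hh; under eq_trace do rewrite (endo_mx hf) (endo_mx hh) -mulmxA.
by under [RHS]eq_trace do rewrite (endo_mx hf) (endo_mx hh) -mulmxA; rewrite !tr_mx mxtrace_mulC.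
Qed.

Hypotheses (Gsym : G^T = G) (Gunit : G \in unitmx).
Hypotheses (JJ : Jx *m Jx = - 1%:M) (GJ : forall u v, g (J u) (J v) = g u v).

Lemma gC x y : g x y = g y x.
Proof.
have -> : g x y = (x *m G *m y^T)^T 0 0 by rewrite mxE.
by rewrite !trmx_mul trmxK Gsym mulmxA.
Qed.

Lemma JK x : J (J x) = - x :> E.
Proof. by rewrite -mulmxA JJ mulmxN mulmx1. Qed.

Lemma gJr x y : g x (J y) = - g (J x) y.
Proof. by rewrite -GJ JK gNr. Qed.

Lemma gJC x y : g (J x) y = - g (J y) x.
Proof. by rewrite gC gJr. Qed.

Lemma g_inj x y : (forall z, g x z = g y z) -> x = y.
Proof.
move=> xy; apply: (can_inj (mulmxK Gunit)).
apply/rowP=> i; have := xy (e i); rewrite /bilin trmx_delta -!colE.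
by rewrite [col i (x *m G) 0 0]mxE [col i (y *m G) 0 0]mxE.
Qed.

Lemma tr_adj (f h : E -> E) : lin f -> lin h ->
  (forall x y, g (f x) y = g x (h y)) -> endo_trace f = endo_trace h.
Proof.
move=> hf hh fh; rewrite (eq_trace (endo_mx hf)) (eq_trace (endo_mx hh)) !tr_mx.
set A := lin1_mx f; set B := lin1_mx h.
have AB : A *m G = G *m B^T.
  apply/matrixP=> i j; have := fh (e i) (e j).
  rewrite (endo_mx hf) (endo_mx hh) -/A -/B /bilin trmx_mul mulmxA trmx_delta -!mulmxA !mulmxA.
  by rewrite -!mulmxA -!rowE !mulmxA -!colE !mxE.
have -> : A = G *m B^T *m invmx G by rewrite -AB mulmxK.
by rewrite mxtrace_mulC mulmxA mulVmx// mul1mx mxtrace_tr.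
Qed.

Lemma contract_g (f : E -> E) :
  \sum_a \sum_b invmx G a b * g (f (e a)) (e b) = endo_trace f.
Proof.
rewrite endo_traceE; apply: eq_bigr => a _.
rewrite -[f (e a) in RHS](mulmxK Gunit) [RHS]mxE; apply: eq_bigr => b _.
rewrite mulrC; congr (_ * _); first by rewrite /bilin trmx_delta -colE mxE.
by rewrite -[in RHS]Gsym -trmx_inv mxE.
Qed.

Lemma tr_gl p q : endo_trace (fun z => g z p *: q) = g p q.
Proof. by rewrite gC (tr_rank1 q (al := g^~ p))// => k x y; rewrite gDl gZl. Qed.
Lemma tr_gr p q : endo_trace (fun z => g p z *: q) = g p q.
Proof. by rewrite (tr_rank1 q (al := g p))// => k x y; rewrite gDr gZr. Qed.
Lemma tr_gJl p q : endo_trace (fun z => g (J z) p *: q) = - g (J p) q.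
Proof.
rewrite -gJC (tr_rank1 q (al := fun z => g (J z) p))// => k x y.
by rewrite JD JZ gDl gZl.
Qed.

Lemma tr_J : endo_trace (fun z : E => J z) = 0.
Proof.
have hJ : lin (fun z : E => J z) by move=> k x y; rewrite JD JZ.
have hJN : lin (fun z : E => - J z) by move=> k x y; rewrite JD JZ; vring.
have := tr_adj hJ hJN; rewrite trN => h.
have {}h : endo_trace (fun z : E => J z) = - endo_trace (fun z : E => J z).
  by apply: h => x y; rewrite gNr gJr opprK.
by lra.
Qed.

Lemma tr_JfJ (f : E -> E) : lin f -> endo_trace (fun z => J (f (J z))) = - endo_trace f.
Proof.
move=> hf; have hJ : lin (fun z : E => J z) by move=> k x y; rewrite JD JZ.
have hJf : lin (fun z : E => J (f z)) by move=> k x y; rewrite hf JD JZ.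
by rewrite (tr_comp hJf hJ) -trN; apply: eq_trace => z; rewrite JK.
Qed.

Lemma sharpE (al : E -> R) : (forall k x y, al (k *: x + y) = k * al x + al y) ->
  forall y, g (sharp G al) y = al y.
Proof.
move=> hal y; rewrite /bilin /sharp mulmxKV//.
rewrite -[RHS](tr_rank1 y hal) endo_traceE [LHS]mxE.
by apply: eq_bigr => i _; rewrite !mxE.
Qed.

End Metric.

(** * Curvature-like tensors *)

Section Operators.
Variables (R : realType) (n : nat) (G Jx : 'M[R]_(n.*2)).
Local Notation E := 'rV[R]_(n.*2).
Local Notation J v := (v *m Jx).
Local Notation g := (bilin G).
Local Notation wJ := (wedgeJ G Jx).
Local Notation wJg := (wedgeJg G Jx).
Local Notation e i := (delta_mx 0 i : E).

Lemma wedgeJE x y z :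
  wJ x y z = g x z *: y - g y z *: x + (g (J x) z *: J y - g (J y) z *: J x).
Proof. by []. Qed.

Lemma wedgeJgE H x y z : wJg H x y z =
  wJ (H x) y z + wJ x (H y) z
  + (2 * g (H (J x)) y) *: J z + (2 * g (J x) y) *: J (H z).
Proof. by []. Qed.

Lemma wedgeJ_lin1 y z : lin (fun x => wJ x y z).
Proof. by move=> k x x'; rewrite !wedgeJE !(JD, JZ, gE); vring. Qed.

Lemma wedgeJ_lin2 x z : lin (fun y => wJ x y z).
Proof. by move=> k y y'; rewrite !wedgeJE !(JD, JZ, gE); vring. Qed.

Lemma wedgeJ_lin3 x y : lin (wJ x y).
Proof. by move=> k z z'; rewrite !wedgeJE !(JD, JZ, gE); vring. Qed.

Lemma wedgeJg_lin1 (H : E -> E) y z : lin H -> lin (fun x => wJg H x y z).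
Proof.
move=> hH k x x'; rewrite /= !wedgeJgE JD JZ !hH ?JD ?JZ.
rewrite ?JZ (wedgeJ_lin1 _ _ k (H x)) (wedgeJ_lin1 _ _ k x) !gE; vring.
Qed.

Lemma wedgeJg_lin2 (H : E -> E) x z : lin H -> lin (fun y => wJg H x y z).
Proof.
move=> hH k y y'; rewrite /= !wedgeJgE !hH.
rewrite (wedgeJ_lin2 _ _ k y) (wedgeJ_lin2 _ _ k (H y)) !gE; vring.
Qed.

Lemma wedgeJg_lin3 (H : E -> E) x y : lin H -> lin (wJg H x y).
Proof.
move=> hH k z z'; rewrite /= !wedgeJgE !hH ?JD ?JZ.
by rewrite (wedgeJ_lin3 _ _ k z) (wedgeJ_lin3 _ _ k z); vring.
Qed.

Lemma wedgeJg_lin0 (H H' : E -> E) k x y z :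
  wJg (fun u => k *: H u + H' u) x y z = k *: wJg H x y z + wJg H' x y z.
Proof. by rewrite !wedgeJgE !wedgeJE !(JD, JZ, gE); vring. Qed.

Lemma eq_wedgeJg (H H' : E -> E) x y z : H =1 H' -> wJg H x y z = wJg H' x y z.
Proof. by move=> HH; rewrite !wedgeJgE !HH. Qed.

(* From here on the constructions of [nablaR] in Defs are applied to an arbitrary
   multilinear map S of the type of nabla R, or D of the type of D~(nabla R). *)
Definition ricf (S : E -> E -> E -> E -> E) (x u v : E) : R :=
  endo_trace (fun z => S x z u v).

Definition dscalf (S : E -> E -> E -> E -> E) (x : E) : R :=
  \sum_a \sum_b invmx G a b * ricf S x (e a) (e b).

Definition gradf S : E := sharp G (dscalf S).

Definition divf (S : E -> E -> E -> E -> E) (z w : E) : E :=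
  - (\sum_a \sum_b invmx G a b *: S (e a) z (e b) w).

Definition halfv (u : E) : E := 2^-1 *: u.

(* [tildef] and [embed] are locked so that rewriting with the bilinearity lemmas
   does not see through them. *)
Fact tilde_key : unit. Proof. exact: tt. Qed.
Definition tildef : (E -> E -> E -> E -> E) -> E -> E -> E := locked_with tilde_key
  (fun S z w => divf S z w + (4 * (n%:R + 1))^-1 *: wJg halfv (gradf S) z w).

Lemma tilde_div S z w :
  tildef S z w = divf S z w + (4 * (n%:R + 1))^-1 *: wJg halfv (gradf S) z w.
Proof. by rewrite /tildef unlock. Qed.

Definition psi1f (D : E -> E -> E) (u v w z : E) : E :=
  - (2 * (n%:R + 3))^-1 *: wJg (fun t => J (D (J u) t)) v w z.

Definition psi2f (D : E -> E -> E) (u v w z : E) : E :=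
  - (2 * (n%:R + 3))^-1 *: (D (wJ v w u) z + wJ u (D w v - D v w) z).

Fact embed_key : unit. Proof. exact: tt. Qed.
Definition embed : (E -> E -> E) -> E -> E -> E -> E -> E := locked_with embed_key
  (fun D u v w z => psi1f D u v w z - psi2f D u v w z).

Lemma embed_psi D u v w z : embed D u v w z = psi1f D u v w z - psi2f D u v w z.
Proof. by rewrite /embed unlock. Qed.

Definition Tf (v u w : E) : E :=
  (8 * (n%:R + 2) * (n%:R + 1))^-1 *: (J (wJ u (J v) w) - g v u *: w).

Definition embedT (v u : E) : E -> E -> E -> E := wJg (Tf v u).

Record nabla_curv (S : E -> E -> E -> E -> E) : Prop := {
  nc_lin : lin4 S;
  nc_skew : forall x y z w, S x y z w = - S x z y w;
  nc_u : forall x y z v w, g (S x y z v) w = - g (S x y z w) v;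
  nc_J : forall x y z v, S x y z (J v) = J (S x y z v);
  nc_b1 : forall x y z w, S x y z w + S x z w y + S x w y z = 0;
  nc_b2 : forall x y z w, S x y z w + S y z x w + S z x y w = 0 }.

(* The algebraic type of D~(nabla R). *)
Record div_type (D : E -> E -> E) : Prop := {
  dt_lin : lin2 D;
  dt_u : forall x y z, g (D x y) z = - g (D x z) y;
  dt_J : forall x y, D x (J y) = J (D x y);
  dt_sym : forall x y, D x y - D y x = J (D (J x) y - D (J y) x);
  dt_tr : forall x, endo_trace (fun y => J (D x y)) = 0 }.

Hypotheses (Gsym : G^T = G) (Gunit : G \in unitmx).
Hypotheses (JJ : Jx *m Jx = - 1%:M) (GJ : forall u v, g (J u) (J v) = g u v).
Local Notation gC := (gC Gsym).
Local Notation JK := (JK JJ).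
Local Notation gJr := (gJr JJ GJ).
Local Notation gJC := (gJC Gsym JJ GJ).
Local Notation g_inj := (g_inj Gunit).

Lemma wedgeJJr x y z : wJ x (J y) z = wJ y (J x) z.
Proof. by rewrite !wedgeJE !JK !gE; vring. Qed.

Lemma wedgeJJ x y z : wJ x y (J z) = J (wJ x y z).
Proof. by rewrite !wedgeJE !(JD, JN, JZ, JK) !gJr !JK !gE; vring. Qed.

Section WedgeG.
Variable H : E -> E.
Hypotheses (Hlin : lin H) (Hsym : forall x y, g (H x) y = g x (H y)).
Hypothesis HJ : forall x, H (J x) = J (H x).

Lemma g_wedgeJg x y z w : g (wJg H x y z) w =
  g (H x) z * g y w - g y z * g (H x) w
  + (g (J (H x)) z * g (J y) w - g (J y) z * g (J (H x)) w)
  + (g x z * g (H y) w - g (H y) z * g x w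
  + (g (J x) z * g (J (H y)) w - g (J (H y)) z * g (J x) w))
  + 2 * g (J (H x)) y * g (J z) w + 2 * g (J x) y * g (J (H z)) w.
Proof. by rewrite !wedgeJgE !wedgeJE !gE !HJ; ring. Qed.

Lemma HgC x y : g (H y) x = g (H x) y. Proof. by rewrite Hsym gC. Qed.
Lemma HgJC x y : g (J (H y)) x = - g (J (H x)) y.
Proof. by rewrite -HJ HgC -gJr gC. Qed.

Lemma wedgeJg_skew x y z : wJg H x y z = - wJg H y x z.
Proof.
apply: g_inj => w; rewrite !gE !HJ (HgJC y x) (gJC y x); ring.
Qed.

Lemma wedgeJg_u x y z w : g (wJg H x y z) w = - g (wJg H x y w) z.
Proof. by rewrite !g_wedgeJg (HgJC z w) (gJC w z); ring. Qed.

Lemma wedgeJg_J x y z : wJg H x y (J z) = J (wJg H x y z).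
Proof. by rewrite !wedgeJgE !wedgeJJ !HJ !(JD, JZ). Qed.

Lemma wedgeJg_b1 x y z : wJg H x y z + wJg H y z x + wJg H z x y = 0.
Proof.
apply: g_inj => w; rewrite !gE !HJ.
rewrite (HgC x y) (HgC x z) (HgC y z) (HgJC x y) (HgJC x z) (HgJC y z).
by rewrite (gC y x) (gC z x) (gC z y) (gJC y x) (gJC z x) (gJC z y); ring.
Qed.

Lemma ric_wedgeJg u v : endo_trace (fun z => wJg H z u v) =
  - (2 * n%:R + 4) * g (H u) v - endo_trace H * g u v.
Proof.
transitivity (endo_trace (fun z =>
   (g z (H v) *: u + - (g u v *: H z) + (g (J z) (H v) *: J u + - (g (J u) v *: J (H z))))
 + (g z v *: H u + - (g (H u) v *: z) + (g (J z) v *: J (H u) + - (g (J (H u)) v *: J z)))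
 + 2 *: (g (J z) (H u) *: J v) + 2 *: (g (J z) u *: J (H v)))).
  apply: eq_trace => z; rewrite !wedgeJgE !wedgeJE !HJ -!HJ !Hsym !HJ.
  by rewrite -!scalerA; vring.
have trJH : endo_trace (fun z => J (H z)) = 0.
  have h1 : lin (fun z => J (H z)) by move=> k x y; rewrite Hlin JD JZ.
  have h2 : lin (fun z => - J (H z)) by move=> k x y; rewrite Hlin JD JZ; vring.
  have := tr_adj Gunit h1 h2; rewrite trN => h; suff: endo_trace (fun z => J (H z)) = - endo_trace (fun z => J (H z)) by lra.
  by apply: h => x y; rewrite HgJC gNr gC.
rewrite !trE !(tr_gl Gsym) !(tr_gJl Gsym JJ GJ) tr_id (tr_J Gunit JJ GJ) trJH.
by rewrite !GJ -(Hsym u v); ring.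
Qed.

End WedgeG.
End Operators.

Section Ricci.
Variables (R : realType) (n : nat) (G Jx : 'M[R]_(n.*2)).
Local Notation E := 'rV[R]_(n.*2).
Local Notation J v := (v *m Jx).
Local Notation g := (bilin G).
Local Notation wJ := (wedgeJ G Jx).
Local Notation wJg := (wedgeJg G Jx).
Local Notation e i := (delta_mx 0 i : E).
Hypotheses (Gsym : G^T = G) (Gunit : G \in unitmx).
Hypotheses (JJ : Jx *m Jx = - 1%:M) (GJ : forall u v, g (J u) (J v) = g u v).
Local Notation gC := (gC Gsym).
Local Notation JK := (JK JJ).
Local Notation gJr := (gJr JJ GJ).
Local Notation gJC := (gJC Gsym JJ GJ).
Local Notation g_inj := (g_inj Gunit).

Variable S : E -> E -> E -> E -> E.
Hypothesis hS : nabla_curv G Jx S.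

Local Notation ric := (ricf S).
Definition ricE (x u : E) : E := sharp G (ric x u).

Let Slin : lin4 S := nc_lin hS.
Let S1 y z w : lin (fun x => S x y z w). Proof. by have [] := Slin. Qed.
Let S2 x z w : lin (fun y => S x y z w). Proof. by have [] := Slin. Qed.
Let S3 x y w : lin (fun z => S x y z w). Proof. by have [] := Slin. Qed.
Let S4 x y z : lin (S x y z). Proof. by have [] := Slin. Qed.

Lemma nc_pair x y z u v : g (S x y z u) v = g (S x u v y) z.
Proof.
have b1 y' z' u' v' : g (S x y' z' u') v' + g (S x z' u' y') v' + g (S x u' y' z') v' = 0.
  by rewrite -!gDl (nc_b1 hS) g0l.
have sk y' z' u' v' : g (S x y' z' u') v' = - g (S x z' y' u') v'.
  by rewrite (nc_skew hS) gNl.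
have h1 := b1 y z u v; have h2 := b1 z u v y; have h3 := b1 u v y z.
have h4 := b1 v y z u.
have sk2 a b c d : g (S x a b c) d = - g (S x a b d) c by exact: (nc_u hS).
have := sk u y z v; have := sk2 z u v y; have := sk2 u v z y.
have := sk v z u y; have := sk2 z v u y; have := sk v y u z.
have := sk2 y v u z; have := sk2 y u v z; have := sk v y z u.
by have := sk2 y z v u; lra.
Qed.

Lemma nc_JJ x y z v : S x (J y) (J z) v = S x y z v.
Proof. by apply: g_inj => w; rewrite nc_pair (nc_J hS) GJ -nc_pair. Qed.

Lemma nc_Jl x y z v : S x (J y) z v = - S x y (J z) v.
Proof. by rewrite -nc_JJ JK (linN (S2 x _ v)). Qed.

Lemma ric_sym x u v : ric x u v = ric x v u.
Proof.
apply: (tr_adj Gunit) => // y z.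
by rewrite nc_pair (nc_skew hS) gNl -(nc_u hS) gC.
Qed.

Lemma ric_J x u v : ric x (J u) (J v) = ric x u v.
Proof.
rewrite -[RHS]opprK -(tr_JfJ JJ (S2 x u v)) -trN; apply: eq_trace => z.
by rewrite (nc_J hS) nc_Jl JN opprK.
Qed.

Lemma ric_lin1 u v k x y : ric (k *: x + y) u v = k * ric x u v + ric y u v.
Proof. by rewrite /ricf -trZ -trD; apply: eq_trace => z; rewrite S1. Qed.
Lemma ric_lin2 x v k u u' : ric x (k *: u + u') v = k * ric x u v + ric x u' v.
Proof. by rewrite /ricf -trZ -trD; apply: eq_trace => z; rewrite S3. Qed.
Lemma ric_lin3 x u k v v' : ric x u (k *: v + v') = k * ric x u v + ric x u v'.
Proof. by rewrite /ricf -trZ -trD; apply: eq_trace => z; rewrite S4. Qed.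

Lemma ric_Jl x u v : ric x (J u) v = - ric x u (J v).
Proof.
rewrite -(ric_J x u) JK; have := ric_lin3 x (J u) (-1) v 0.
have := ric_lin3 x (J u) 1 0 0; rewrite scaleN1r !addr0 scaler0 => h0 ->; lra.
Qed.

(* The Ricci form is the complex trace of the curvature. *)
Lemma tr_JS x y z : endo_trace (fun w => J (S x y z w)) = 2 * ric x (J y) z.
Proof.
transitivity (ric x z (J y) - ric x y (J z)).
  rewrite /ricf -trN -trD; apply: eq_trace => w; rewrite !(nc_J hS) -JN -JD.
  congr (J _); apply/eqP; rewrite -subr_eq0 -[X in _ == X](nc_b1 hS x y z w).
  by rewrite (nc_skew hS x z w); apply/eqP; vring.
by rewrite [ric x z _]ric_sym ric_Jl; ring.
Qed.

Lemma ric_cyc x y z : ric x (J y) z + ric y (J z) x + ric z (J x) y = 0.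
Proof.
suff: 2 * (ric x (J y) z + ric y (J z) x + ric z (J x) y) = 0 by lra.
rewrite !mulrDr -!tr_JS -!trD -(mul0r (endo_trace (fun z : E => z))) -trZ.
by apply: eq_trace => w; rewrite -!JD (nc_b2 hS) J0 scale0r.
Qed.

Lemma g_ricE x u v : g (ricE x u) v = ric x u v.
Proof. by rewrite (sharpE Gunit)// => k y z; rewrite ric_lin3. Qed.

Lemma g_JricE x u v : g (J (ricE x u)) v = - ric x u (J v).
Proof. by rewrite -g_ricE gJr opprK. Qed.

Lemma ricE_lin1 u : lin (fun x => ricE x u).
Proof. by move=> k x y; apply: g_inj => v; rewrite gDl gZl !g_ricE ric_lin1. Qed.
Lemma ricE_lin2 x : lin (ricE x).
Proof. by move=> k u v; apply: g_inj => w; rewrite gDl gZl !g_ricE ric_lin2. Qed.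
Lemma ricE_sym x u v : g (ricE x u) v = g u (ricE x v).
Proof. by rewrite [RHS]gC !g_ricE ric_sym. Qed.
Lemma ricE_J x u : ricE x (J u) = J (ricE x u).
Proof. by apply: g_inj => v; rewrite -[RHS]opprK -gJr !g_ricE ric_Jl. Qed.

Lemma dscalE x : dscalf G S x = endo_trace (ricE x).
Proof.
rewrite -(contract_g Gsym Gunit); apply: eq_bigr => a _; apply: eq_bigr => b _.
by rewrite g_ricE.
Qed.

Lemma dscal_lin k x y : dscalf G S (k *: x + y) = k * dscalf G S x + dscalf G S y.
Proof. by rewrite !dscalE -trZ -trD; apply: eq_trace => z; rewrite ricE_lin1. Qed.

Lemma g_gradf x : g (gradf G S) x = dscalf G S x.
Proof. by rewrite (sharpE Gunit)//; exact: dscal_lin. Qed.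

Lemma ricN x u v : ric (- x) u v = - ric x u v.
Proof.
have := ric_lin1 u v 1 0 0; have := ric_lin1 u v (-1) x 0.
by rewrite scaler0 !addr0 scaleN1r => -> h0; lra.
Qed.

Lemma ricN2 x u v : ric x (- u) v = - ric x u v.
Proof.
have := ric_lin2 x v 1 0 0; have := ric_lin2 x v (-1) u 0.
by rewrite scaler0 !addr0 scaleN1r => -> h0; lra.
Qed.

Lemma ric_J1 z w v : ric (J z) w (J v) = ric w v z - ric v w z.
Proof.
have := ric_cyc (J z) w v; rewrite JK (ric_Jl (J z)) ric_J ricN2 (ric_sym v); lra.
Qed.

Lemma divE z w : divf G S z w = J (ricE (J z) w).
Proof.
apply: g_inj => v; rewrite gNl -[RHS]opprK -gJr g_ricE; congr (- _).
rewrite ric_J1.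
rewrite /ricf -trN -trD -(contract_g Gsym Gunit).
have gsum (I : Type) (r : seq I) (f : I -> E) u : g (\sum_(i <- r) f i) u = \sum_(i <- r) g (f i) u.
  by elim/big_rec2: _ => [|i x y _ <-]; rewrite ?g0l ?gDl.
rewrite gsum; apply: eq_bigr => a _; rewrite gsum; apply: eq_bigr => b _.
rewrite gZl; congr (_ * _); rewrite nc_pair; congr (bilin G _ _).
have := nc_b2 hS (e a) w v z; rewrite (nc_skew hS w v) => /eqP.
by rewrite -addrA addr_eq0 => /eqP ->; vring.
Qed.

Local Notation hf := (@halfv R n).
Local Notation td := (tildef G Jx S).

Lemma half_J (x : E) : hf (J x) = J (hf x). Proof. by rewrite /halfv JZ. Qed.
Lemma half_lin : lin hf. Proof. by move=> k x y; rewrite /half; vring. Qed.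
Lemma half_sym x y : g (hf x) y = g x (hf y).
Proof. by rewrite /halfv !gE. Qed.

Lemma tildeE z w : td z w = J (ricE (J z) w)
  + (4 * (n%:R + 1))^-1 *: wJg hf (gradf G S) z w.
Proof. by rewrite tilde_div divE. Qed.

Lemma wJg_half x y z : wJg hf x y z = wJ x y z + (2 * g (J x) y) *: J z.
Proof. by rewrite !wedgeJgE !wedgeJE /halfv !(JZ, gE); apply/matrixP=> i j; rewrite !mx_linE; field. Qed.

Lemma n1_neq0 : n%:R + 1 != 0 :> R.
Proof. by rewrite natr1 pnatr_eq0. Qed.

Lemma tilde_div_type : div_type G Jx td.
Proof.
have n1 := n1_neq0; set v := gradf G S.
split.
- split=> [y|x] k a b; rewrite !tildeE.
    by rewrite JD JZ ricE_lin1 JD JZ (@wedgeJg_lin2 R n G Jx hf v y half_lin); vring.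
  by rewrite ricE_lin2 JD JZ (@wedgeJg_lin3 R n G Jx hf v x half_lin); vring.
- move=> x y z; rewrite !tildeE !gDl !gZl.
  rewrite (wedgeJg_u Gsym JJ GJ half_sym half_J).
  by rewrite (HgJC Gsym JJ GJ (ricE_sym (J x)) (ricE_J (J x)) z y); ring.
- move=> x y; rewrite !tildeE ricE_J JD JZ; congr (_ + _ *: _).
  by rewrite (wedgeJg_J JJ GJ half_J).
- move=> x y; rewrite !tildeE !wJg_half !JK; apply: g_inj => z.
  rewrite !gE !(JD, JZ, JN, JK) !gE !g_JricE !g_ricE !ric_J1.
  rewrite !ricN !GJ (gC y x) (gJC y x) (ric_sym y z) (ric_sym x z) (ric_sym z y).
  by ring.
- move=> x; transitivity (endo_trace (fun y => - ricE (J x) y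
      + (4 * (n%:R + 1))^-1 *: (g v y *: J x + - (g x y *: J v)
          + (- (g (J v) y *: x) + g (J x) y *: v) + - (2 * g (J v) x) *: y))).
    apply: eq_trace => y; rewrite tildeE wJg_half wedgeJE !(JD, JN, JZ, JK).
    by rewrite -/v; vring.
  rewrite !trE !tr_gr -!dscalE -g_gradf -/v tr_id !gJr (gJC x v).
  by field.
Qed.

End Ricci.

(** * The two equivariant embeddings *)

Section ScalarCore.
Variables (R : comPzRingType) (T : Type).
Variables (be ga : T -> T -> T -> R) (g k : T -> T -> R).

(* Components of the curvature-like tensor built from a tensor be symmetric in
   its first two arguments; ga and k stand for be and g with J applied to the
   first argument. *)
Definition sc_psi1 u v w z q : R :=
  (- be u v z - be u z v) * g w q - g w z * (- be u v q - be u q v) +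
  (- (ga u v z - ga u z v) * k w q - k w z * - (ga u v q - ga u q v)) +
  (g v z * (- be u w q - be u q w) - (- be u w z - be u z w) * g v q +
   (k v z * - (ga u w q - ga u q w) + (ga u w z - ga u z w) * k v q)) +
  2 * - (ga u v w - ga u w v) * k z q +
  2 * k v w * - (ga u z q - ga u q z).

Definition sc_psi2 u v w z q : R :=
  g v u * (be w z q - be w q z) - g w u * (be v z q - be v q z)
   + (k v u * (ga w z q - ga w q z) - k w u * (ga v z q - ga v q z))
   + (g u z * (be w v q - be w q v - (be v w q - be v q w))
   - (be w v z - be w z v - (be v w z - be v z w)) * g u q
   + (k u z * (ga w v q + ga w q v - (ga v w q + ga v q w))
   - (ga w v z + ga w z v - (ga v w z + ga v z w)) * k u q)).

Definition sc_core u v w z q := sc_psi1 u v w z q - sc_psi2 u v w z q.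

Hypotheses (beC : forall x y z, be x y z = be y x z).
Hypotheses (gaC : forall x y z, ga x y z = ga y x z).
Hypotheses (gC : forall x y, g x y = g y x) (kC : forall x y, k x y = - k y x).

Ltac sortp a b := rewrite ?(beC b a) ?(gaC b a) ?(gC b a) ?(kC b a).

Lemma sc_core_skew u v w z q : sc_core u v w z q = - sc_core u w v z q.
Proof.
by rewrite /sc_core /sc_psi1 /sc_psi2; sortp u v; sortp u w; sortp v w; ring.
Qed.

Lemma sc_core_u u v w z q : sc_core u v w z q = - sc_core u v w q z.
Proof. by rewrite /sc_core /sc_psi1 /sc_psi2; sortp z q; ring. Qed.

Lemma sc_core_b1 x y z w q :
  sc_core x y z w q + sc_core x z w y q + sc_core x w y z q = 0.
Proof.
rewrite /sc_core /sc_psi1 /sc_psi2.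
by sortp x y; sortp x z; sortp x w; sortp y z; sortp y w; sortp z w; ring.
Qed.

Lemma sc_core_b2 x y z w q :
  sc_core x y z w q + sc_core y z x w q + sc_core z x y w q = 0.
Proof.
rewrite /sc_core /sc_psi1 /sc_psi2.
by sortp x y; sortp x z; sortp x w; sortp y z; sortp y w; sortp z w; ring.
Qed.
End ScalarCore.

Section Embedding.
Variables (R : realType) (n : nat) (G Jx : 'M[R]_(n.*2)).
Local Notation E := 'rV[R]_(n.*2).
Local Notation J v := (v *m Jx).
Local Notation g := (bilin G).
Local Notation wJ := (wedgeJ G Jx).
Local Notation wJg := (wedgeJg G Jx).
Local Notation hf := (@halfv R n).
Hypotheses (Gsym : G^T = G) (Gunit : G \in unitmx).
Hypotheses (JJ : Jx *m Jx = - 1%:M) (GJ : forall u v, g (J u) (J v) = g u v).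
Local Notation gC := (gC Gsym).
Local Notation JK := (JK JJ).
Local Notation gJr := (gJr JJ GJ).
Local Notation gJC := (gJC Gsym JJ GJ).
Local Notation g_inj := (g_inj Gunit).

Section Div.
Variable D : E -> E -> E.
Hypothesis hD : div_type G Jx D.

Let D1 y : lin (fun x => D x y). Proof. by have [] := dt_lin hD. Qed.
Let D2 x : lin (D x). Proof. by have [] := dt_lin hD. Qed.
Let D1D x x' y : D (x + x') y = D x y + D x' y. Proof. exact: (linD (D1 y)). Qed.
Let D1Z k x y : D (k *: x) y = k *: D x y. Proof. exact: (linZ (D1 y)). Qed.
Let D1N x y : D (- x) y = - D x y. Proof. exact: (linN (D1 y)). Qed.
Let D2D x y y' : D x (y + y') = D x y + D x y'. Proof. exact: (linD (D2 x)). Qed.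
Let D2Z k x y : D x (k *: y) = k *: D x y. Proof. exact: (linZ (D2 x)). Qed.
Let D2N x y : D x (- y) = - D x y. Proof. exact: (linN (D2 x)). Qed.
Let DE := (D1D, D1Z, D1N, D2D, D2Z, D2N).

(* The C-bilinear part of D; it is symmetric, and D x is its skew-Hermitian
   part. *)
Definition hol (x y : E) : E := 2^-1 *: (D x y - J (D (J x) y)).
Definition be x y z := g (hol x y) z.
Definition ga x y z := g (J (hol x y)) z.

Lemma holC x y : hol x y = hol y x.
Proof.
rewrite /hol; congr (_ *: _); apply/eqP; rewrite -subr_eq0; apply/eqP.
transitivity ((D x y - D y x) - J (D (J x) y - D (J y) x)).
  by rewrite JD JN; vring.
by rewrite (dt_sym hD) subrr.
Qed.

Lemma hol_Jl x y : hol (J x) y = J (hol x y).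
Proof. by rewrite /hol JZ JD JN !JK D1N JN; vring. Qed.

Lemma hol_Jr x y : hol x (J y) = J (hol x y).
Proof. by rewrite holC hol_Jl holC. Qed.

Lemma beC x y z : be x y z = be y x z. Proof. by rewrite /be holC. Qed.
Lemma gaC x y z : ga x y z = ga y x z. Proof. by rewrite /ga holC. Qed.

Lemma g_D x y z : g (D x y) z = be x y z - be x z y.
Proof.
rewrite /be /hol !gE (dt_u hD x z y).
have -> : g (J (D (J x) z)) y = g (J (D (J x) y)) z.
  by rewrite -(dt_J hD) (dt_u hD) gJr opprK.
by field.
Qed.

Lemma g_JD x y z : g (J (D x y)) z = ga x y z + ga x z y.
Proof.
rewrite -[LHS]opprK -gJr g_D /be /ga hol_Jr gJr; ring.
Qed.

Lemma g_DJ x y z : g (D (J x) y) z = ga x y z - ga x z y.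
Proof. by rewrite g_D /be !hol_Jl. Qed.

Lemma g_JDJ x y z : g (J (D (J x) y)) z = - be x y z - be x z y.
Proof. by rewrite g_JD /ga !hol_Jl !JK !gNl. Qed.

Lemma tr_hol x : endo_trace (hol x) = 0.
Proof.
have tr0 x' : endo_trace (D x') = 0.
  have := tr_adj Gunit (D2 x') (h := fun y => - D x' y); rewrite trN => h.
  suff: endo_trace (D x') = - endo_trace (D x') by lra.
  by apply: h => [k y z|y z]; rewrite ?D2D ?D2Z; [vring|rewrite gNr (dt_u hD) gC].
by rewrite /hol trZ trD trN (dt_tr hD) tr0 subr0 mulr0.
Qed.

Lemma lin_hol2 x : lin (hol x).
Proof. by move=> k y z; rewrite /hol !DE !(JD, JZ); vring. Qed.

Lemma hol_lin1 y : lin (fun x => hol x y).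
Proof. by move=> k x z; rewrite holC lin_hol2 !(holC y). Qed.

(* The covariant derivative of the Ricci endomorphism of the embedded tensor. *)
Definition hop (x t : E) : E := J (D (J x) t).

Lemma hop_lin x : lin (hop x).
Proof. by move=> k y z; rewrite /hop !DE !(JD, JZ). Qed.
Lemma hop_sym x y z : g (hop x y) z = g y (hop x z).
Proof. by rewrite /hop [RHS]gC !g_JDJ; ring. Qed.
Lemma hop_J x y : hop x (J y) = J (hop x y).
Proof. by rewrite /hop (dt_J hD). Qed.

Fact core_key : unit. Proof. exact: tt. Qed.
Definition core : E -> E -> E -> E -> E := locked_with core_key (fun u v w z =>
  wJg (hop u) v w z - (D (wJ v w u) z + wJ u (D w v - D v w) z)).

Lemma coreE u v w z :
  core u v w z = wJg (hop u) v w z - (D (wJ v w u) z + wJ u (D w v - D v w) z).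
Proof. by rewrite /core unlock. Qed.

Lemma embedE u v w z : embed G Jx D u v w z = - (2 * (n%:R + 3))^-1 *: core u v w z.
Proof. by rewrite coreE embed_psi /psi1f /psi2f scalerBr. Qed.

Lemma g_core u v w z q :
  g (core u v w z) q = sc_core be ga g (fun x y => g (J x) y) u v w z q.
Proof.
rewrite coreE gDl gNl; congr (_ - _).
  rewrite (g_wedgeJg G (hop_J u)) /hop !JK !gE !(g_JDJ, g_DJ) /sc_psi1.
  by generalize be ga (bilin G) => be' ga' g'; ring.
rewrite gDl wedgeJE !DE wedgeJE !(JD, JN) !gE !(g_DJ, g_D, g_JD) /sc_psi2.
by generalize be ga (bilin G) => be' ga' g'; ring.
Qed.

Lemma core_lin : lin4 core.
Proof.
rewrite /core unlock; split=> [y z w|x z w|x y w|x y z]; apply: lin_sub.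
- move=> k a b; rewrite -wedgeJg_lin0; apply: eq_wedgeJg => t.
  by rewrite /hop JD JZ D1 JD JZ.
- by apply: lin_add; [exact: (lin_comp (D1 w) (@wedgeJ_lin3 R n G Jx y z))
                     |exact: wedgeJ_lin1].
- exact: (wedgeJg_lin1 _ _ _ _ (hop_lin x)).
- apply: lin_add; first exact: (lin_comp (D1 w) (@wedgeJ_lin1 R n G Jx z x)).
  apply: (lin_comp (@wedgeJ_lin2 R n G Jx x w)).
  by apply: lin_sub; [exact: D2 | exact: D1].
- exact: (wedgeJg_lin2 _ _ _ _ (hop_lin x)).
- apply: lin_add; first exact: (lin_comp (D1 w) (@wedgeJ_lin2 R n G Jx y x)).
  apply: (lin_comp (@wedgeJ_lin2 R n G Jx x w)).
  by apply: lin_sub; [exact: D1 | exact: D2].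
- exact: (wedgeJg_lin3 _ _ _ _ (hop_lin x)).
- by apply: lin_add; [exact: D2 | exact: wedgeJ_lin3].
Qed.

Lemma core_nabla_curv : nabla_curv G Jx core.
Proof.
have kC x y : g (J x) y = - g (J y) x by exact: gJC.
split; first exact: core_lin.
- move=> u v w z; apply: g_inj => q; rewrite gNl !g_core.
  exact: (sc_core_skew beC gaC gC kC).
- move=> u v w z q; rewrite !g_core; exact: sc_core_u.
- move=> u v w z; rewrite !coreE (wedgeJg_J JJ GJ (hop_J u)) (dt_J hD) (wedgeJJ JJ GJ).
  by rewrite -!JD -JN -JD.
- move=> x y z w; apply: g_inj => q; rewrite !gDl g0l !g_core.
  exact: (sc_core_b1 beC gaC gC kC).
- move=> x y z w; apply: g_inj => q; rewrite !gDl g0l !g_core.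
  exact: (sc_core_b2 beC gaC gC kC).
Qed.

End Div.
End Embedding.

Section ScalarGrad.
Variables (R : comPzRingType) (T : Type) (g k : T -> T -> R) (v : T).

Definition sc_t u w z : R :=
  - (g u w * g v z + g v w * g u z) - (k v w * k u z + k u w * k v z) - g v u * g w z.

Definition sc_s u w z : R :=
  - (g u w * k v z + g v w * k u z - k v w * g u z - k u w * g v z + g v u * k w z).

Definition sc_grad x y z w q : R :=
  sc_t x y w * g z q - g z w * sc_t x y q
  + (sc_s x y w * k z q - k z w * sc_s x y q)
  + (g y w * sc_t x z q - sc_t x z w * g y q
  + (k y w * sc_s x z q - sc_s x z w * k y q))
  + 2 * sc_s x y z * k w q + 2 * k y z * sc_s x w q.

Hypotheses (gC : forall x y, g x y = g y x) (kC : forall x y, k x y = - k y x).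

Lemma sc_grad_b2 x y z w q :
  sc_grad x y z w q + sc_grad y z x w q + sc_grad z x y w q = 0.
Proof.
rewrite /sc_grad /sc_t /sc_s (gC y x) (gC z x) (gC z y) (kC y x) (kC z x) (kC z y).
rewrite ?(gC w x) ?(gC w y) ?(gC w z) ?(kC w x) ?(kC w y) ?(kC w z).
by ring.
Qed.
End ScalarGrad.

Section Embedding2.
Variables (R : realType) (n : nat) (G Jx : 'M[R]_(n.*2)).
Local Notation E := 'rV[R]_(n.*2).
Local Notation J v := (v *m Jx).
Local Notation g := (bilin G).
Local Notation wJ := (wedgeJ G Jx).
Local Notation wJg := (wedgeJg G Jx).
Local Notation hf := (@halfv R n).
Local Notation e i := (delta_mx 0 i : E).
Hypotheses (Gsym : G^T = G) (Gunit : G \in unitmx).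
Hypotheses (JJ : Jx *m Jx = - 1%:M) (GJ : forall u v, g (J u) (J v) = g u v).
Local Notation gC := (gC Gsym).
Local Notation JK := (JK JJ).
Local Notation gJr := (gJr JJ GJ).
Local Notation gJC := (gJC Gsym JJ GJ).
Local Notation g_inj := (g_inj Gunit).

Lemma nabla_curvZ c S : nabla_curv G Jx S -> nabla_curv G Jx (fun x y z w => c *: S x y z w).
Proof.
move=> [[l1 l2 l3 l4] sk u j b1 b2]; split.
- by split=> *; apply: lin_scale.
- by move=> x y z w; rewrite sk scalerN.
- by move=> x y z v w; rewrite !gZl u mulrN.
- by move=> x y z v; rewrite j JZ.
- by move=> x y z w; rewrite -!scalerDr b1 scaler0.
- by move=> x y z w; rewrite -!scalerDr b2 scaler0.
Qed.

Lemma eq_nabla_curv S S' : (forall x y z w, S x y z w = S' x y z w) ->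
  nabla_curv G Jx S -> nabla_curv G Jx S'.
Proof.
by move=> SS'; have -> : S = S' by do 4![apply/funext=> ?].
Qed.

Lemma sharp0 (al : E -> R) : (forall x, al x = 0) -> sharp G al = 0.
Proof.
move=> al0; rewrite /sharp; have -> : \row_j al (e j) = 0.
  by apply/rowP => j; rewrite !mxE.
by rewrite mul0mx.
Qed.

Lemma contract_linear (f : E -> E -> R) (h : E -> E) :
  (forall u v, f u v = g (h u) v) ->
  \sum_a \sum_b invmx G a b * f (e a) (e b) = endo_trace h.
Proof.
move=> fh; rewrite -(contract_g Gsym Gunit).
by apply: eq_bigr => a _; apply: eq_bigr => b _; rewrite fh.
Qed.

Lemma wJg0 z w : wJg hf 0 z w = 0.
Proof. by rewrite (lin0 (@wedgeJg_lin1 R n G Jx _ z w (@half_lin R n))). Qed.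

Section Div.
Variable D : E -> E -> E.
Hypothesis hD : div_type G Jx D.
Local Notation hl := (hol Jx D).
Local Notation hp := (hop Jx D).
Local Notation F := (embed G Jx D).

Let D1 y : lin (fun x => D x y). Proof. by have [] := dt_lin hD. Qed.
Let D2 x : lin (D x). Proof. by have [] := dt_lin hD. Qed.

Lemma embed_nabla_curv : nabla_curv G Jx F.
Proof.
apply: (eq_nabla_curv _ (nabla_curvZ (- (2 * (n%:R + 3))^-1)
  (core_nabla_curv Gsym Gunit JJ GJ hD))) => x y z w.
by rewrite embedE.
Qed.

(* The C-antilinear part of D in its first argument. *)
Let anti z v := hl z v - D z v.

Let anti_lin v : lin (fun z => anti z v).
Proof. by apply: lin_sub; [exact: (hol_lin1 hD) | exact: D1]. Qed.

Let anti_J z v : anti (J z) v = - J (anti z v).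
Proof.
rewrite /anti (hol_Jl JJ hD) /hol JD JN JZ JD JN JK.
by apply/matrixP => i j; rewrite !mx_linE; field.
Qed.

Let tr_anti v : endo_trace (fun z => anti z v) = 0.
Proof.
have := tr_JfJ JJ (@anti_lin v); suff -> :
  endo_trace (fun z => J (anti (J z) v)) = endo_trace (fun z => anti z v) by lra.
by apply: eq_trace => z; rewrite anti_J JN JK opprK.
Qed.

Let tr_Janti v : endo_trace (fun z => J (anti z v)) = 0.
Proof.
have hJl : lin (fun z => J (anti z v)).
  by move=> k x y; rewrite anti_lin JD JZ.
have := tr_JfJ JJ hJl; suff -> :
  endo_trace (fun z => J (J (anti (J z) v))) = endo_trace (fun z => J (anti z v)) by lra.
by apply: eq_trace => z; rewrite anti_J !JN JK opprK.
Qed.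

Let tr_D x : endo_trace (D x) = 0.
Proof.
have := tr_adj Gunit (D2 x) (h := fun y => - D x y); rewrite trN => h.
suff: endo_trace (D x) = - endo_trace (D x) by lra.
apply: h => [|y z]; first exact: lin_opp.
by rewrite gNr (dt_u hD) gC.
Qed.

Let tr_Jhol x : endo_trace (fun z => J (hl z x)) = 0.
Proof.
transitivity (endo_trace (fun z => 2^-1 *: (J (D x z) + D (J x) z))).
  apply: eq_trace => z; rewrite (holC hD) /hol JZ JD JN JK.
  by rewrite opprK.
by rewrite trZ trD (dt_tr hD) tr_D addr0 mulr0.
Qed.

Lemma tr_D1 v : endo_trace (fun z => D z v) = 0.
Proof.
transitivity (endo_trace (fun z => hl z v - anti z v)).
  by apply: eq_trace => z; rewrite /anti subKr.
rewrite trD trN tr_anti oppr0 addr0 -[RHS](tr_hol Gsym Gunit hD v).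
by apply: eq_trace => z; rewrite (holC hD).
Qed.

Lemma tr_JD1 v : endo_trace (fun z => J (D z v)) = 0.
Proof.
transitivity (endo_trace (fun z => J (hl z v) - J (anti z v))).
  by apply: eq_trace => z; rewrite -JN -JD /anti subKr.
by rewrite trD trN tr_Janti tr_Jhol subrr.
Qed.

Lemma tr_D1J v : endo_trace (fun z => D (J z) v) = 0.
Proof.
transitivity (endo_trace (fun z => J (hl z v) + J (anti z v))).
  apply: eq_trace => z; rewrite -(hol_Jl JJ hD) -[J (anti z v)]opprK -anti_J.
  by rewrite /anti subKr.
by rewrite trD tr_Janti tr_Jhol addr0.
Qed.

Lemma ric_core x u v :
  ricf (core G Jx D) x u v = - (2 * (n%:R + 3)) * g (hp x u) v.
Proof.
have [P PE] : exists P, forall z, P z = D u z - D z u.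
  by exists (fun z => D u z - D z u).
transitivity (endo_trace (fun z => wJg (hp x) z u v
  - ((g z x *: D u v - g u x *: D z v) + (g (J z) x *: D (J u) v - g (J u) x *: D (J z) v)
  + (g x v *: P z - g (P z) v *: x
   + (g (J x) v *: J (P z) - g (J (P z)) v *: J x))))).
  apply: eq_trace => z; rewrite coreE; congr (_ - (_ + _)).
    have DE := (linD (D1 v), linZ (D1 v), linN (D1 v)).
    by rewrite wedgeJE !DE.
  by rewrite wedgeJE PE.
have trP : endo_trace P = 0.
  by rewrite (eq_trace PE) trD trN tr_D tr_D1 subrr.
have trJP : endo_trace (fun z => J (P z)) = 0.
  transitivity (endo_trace (fun z => J (D u z) - J (D z u))).
    by apply: eq_trace => z; rewrite PE JD JN.
  by rewrite trD trN (dt_tr hD) tr_JD1 subrr.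
have linP : lin P.
  by move=> k a b; rewrite !PE D1 D2; vring.
have tr1 : endo_trace (fun z => g (P z) v *: x) = g (P x) v.
  by rewrite (tr_rank1 x (al := fun z => g (P z) v))// => k a b; rewrite linP gDl gZl.
have tr2 : endo_trace (fun z => g (J (P z)) v *: J x) = g (J (P (J x))) v.
  rewrite (tr_rank1 (J x) (al := fun z => g (J (P z)) v))// => k a b.
  by rewrite linP JD JZ gDl gZl.
have trh : endo_trace (hp x) = 0 by exact: (dt_tr hD (J x)).
rewrite (trD (fun z => wJg (hp x) z u v)).
rewrite (ric_wedgeJg Gsym Gunit JJ GJ (hop_lin hD x) (hop_sym Gsym JJ GJ hD x) (hop_J hD x)) trh.
rewrite !trE tr1 tr2 trP trJP tr_D1 tr_D1J (tr_gl Gsym) (tr_gJl Gsym JJ GJ).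
have -> : g (P x) v = g (D u x) v - g (D x u) v by rewrite PE gDl gNl.
have -> : g (J (P (J x))) v = - g (D u x) v - g (hp x u) v.
  by rewrite PE (dt_J hD) JD JN JK gDl !gNl.
have -> : g x (D u v) = - g (D u x) v by rewrite gC (dt_u hD).
have -> : g (J x) (D (J u) v) = - g (hp u x) v.
  by rewrite gC (dt_u hD) (dt_J hD).
rewrite /hp !(g_D JJ GJ hD) !(g_JDJ JJ GJ hD) (beC hD x u).
by generalize (be G Jx D) => b; ring.
Qed.

Lemma ric_embed x u v : ricf F x u v = g (hp x u) v.
Proof.
have n3 : n%:R + 3 != 0 :> R by rewrite -natrD pnatr_eq0 addn3.
transitivity (- (2 * (n%:R + 3))^-1 * ricf (core G Jx D) x u v).
  by rewrite /ricf -trZ; apply: eq_trace => z; rewrite embedE.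
by rewrite ric_core; field.
Qed.

Lemma grad_embed : gradf G F = 0.
Proof.
apply: sharp0 => x; rewrite /dscalf (contract_linear (ric_embed x)).
exact: (dt_tr hD (J x)).
Qed.

Lemma tilde_embed z w : tildef G Jx F z w = D z w.
Proof.
rewrite tilde_div grad_embed wJg0 scaler0 addr0.
rewrite (divE Gsym Gunit JJ GJ embed_nabla_curv).
have -> : ricE G F (J z) w = hp (J z) w.
  by apply: g_inj => v; rewrite (g_ricE Gunit embed_nabla_curv) ric_embed.
by rewrite /hop !JK (linN (D1 w)) opprK.
Qed.

End Div.
Section Grad.
Variable v : E.
Local Notation H := (Tf G Jx v).
Local Notation c := ((8 * (n%:R + 2) * (n%:R + 1))^-1 : R).
Local Notation F := (embedT G Jx v).
Local Notation k := (fun x y : E => g (J x) y).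

Lemma TfE u w : H u w = c *: (- (g u w *: v) - g (J v) w *: J u
  - g (J u) w *: J v - g v w *: u - g v u *: w).
Proof.
rewrite /Tf; congr (_ *: _).
rewrite wedgeJE !JK !(JD, JN, JZ) !JK !gNl; move: (g u w) (g v w) (g (J u) w) (g (J v) w) (g v u) => *.
by vring.
Qed.

Lemma g_Tf u w z : g (H u w) z = c * sc_t g k v u w z.
Proof. by rewrite TfE /sc_t !gE; generalize (bilin G) => g'; ring. Qed.

Lemma g_JTf u w z : g (J (H u w)) z = c * sc_s g k v u w z.
Proof.
rewrite TfE /sc_s !(JD, JN, JZ) !JK !gE (gJC u z) (gJC w z) (gJC v z).
by generalize (bilin G) => g'; ring.
Qed.

Lemma Tf_lin1 w : lin (fun u => H u w).
Proof.
by move=> d a b; rewrite !TfE !(JD, JZ, gE); generalize (bilin G) => g'; vring.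
Qed.

Lemma Tf_lin2 u : lin (H u).
Proof. by move=> d a b; rewrite !TfE !gE; generalize (bilin G) => g'; vring. Qed.

Lemma Tf_linv u w d a b :
  Tf G Jx (d *: a + b) u w = d *: Tf G Jx a u w + Tf G Jx b u w.
Proof.
have E' v' : Tf G Jx v' u w = c *: (J (wJ u (J v') w) - g v' u *: w) by [].
rewrite !E' (JD Jx (d *: a)) (JZ Jx d a) (@wedgeJ_lin2 R n G Jx u w).
rewrite (JD Jx (d *: _)) (JZ Jx d) gDl gZl.
generalize (J (wJ u (J a) w)) (J (wJ u (J b) w)) => p q; vring.
Qed.

Lemma Tf_J u w : H u (J w) = J (H u w).
Proof.
have E' w' : H u w' = c *: (J (wJ u (J v) w') - g v u *: w') by [].
rewrite !E' (wedgeJJ JJ GJ) [RHS]JZ; congr (_ *: _).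
by rewrite [RHS]JD JN JZ.
Qed.

Lemma Tf_sym u w z : g (H u w) z = g w (H u z).
Proof.
rewrite [RHS]gC !g_Tf /sc_t (gC z w); congr (_ * _).
by generalize (bilin G) => g'; ring.
Qed.

Lemma embedT_nabla_curv : nabla_curv G Jx F.
Proof.
have kC x y : g (J x) y = - g (J y) x by exact: gJC.
split.
- split=> [y z w|x z w|x y w|x y z].
  + move=> d a b; rewrite /embedT -wedgeJg_lin0; apply: eq_wedgeJg => u.
    exact: Tf_lin1.
  + exact: (wedgeJg_lin1 _ _ _ _ (Tf_lin2 x)).
  + exact: (wedgeJg_lin2 _ _ _ _ (Tf_lin2 x)).
  + exact: (wedgeJg_lin3 _ _ _ _ (Tf_lin2 x)).
- by move=> x y z w; exact: (wedgeJg_skew Gsym Gunit JJ GJ (Tf_sym x) (Tf_J x)).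
- by move=> x y z w q; exact: (wedgeJg_u Gsym JJ GJ (Tf_sym x) (Tf_J x)).
- by move=> x y z w; exact: (wedgeJg_J JJ GJ (Tf_J x)).
- by move=> x y z w; exact: (wedgeJg_b1 Gsym Gunit JJ GJ (Tf_sym x) (Tf_J x)).
- move=> x y z w; apply: g_inj => q; rewrite g0l.
  have gF x' y' z' : g (F x' y' z' w) q = c * sc_grad g k v x' y' z' w q.
    rewrite /embedT (g_wedgeJg G (Tf_J x')) !g_Tf !g_JTf /sc_grad.
    by generalize (sc_t g k v) (sc_s g k v) (bilin G) => t s' g'; ring.
  have -> : g (F x y z w + F y z x w + F z x y w) q =
    g (F x y z w) q + g (F y z x w) q + g (F z x y w) q.
    by generalize (F x y z w) (F y z x w) (F z x y w) => p1 p2 p3; rewrite !gDl.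
  by rewrite !gF -!mulrDr (sc_grad_b2 v gC kC) mulr0.
Qed.

Lemma c_neq0 : (n%:R + 2 != 0 :> R) /\ (n%:R + 1 != 0 :> R).
Proof. by rewrite -natrD natr1 !pnatr_eq0 addn2. Qed.

Lemma tr_Tf u : endo_trace (H u) = - (4 * (n%:R + 1))^-1 * g v u.
Proof.
have [n2 n1] := c_neq0.
transitivity (endo_trace (fun w => c *: (- (g u w *: v) + - (g (J v) w *: J u)
  + - (g (J u) w *: J v) + - (g v w *: u) + - (g v u *: w)))).
  by apply: eq_trace => w; rewrite TfE.
rewrite !trE !tr_gr tr_id !GJ (gC u v); field.
by rewrite n1 n2.
Qed.

Lemma ric_embedT x u w :
  ricf F x u w = - (2 * n%:R + 4) * g (H x u) w - endo_trace (H x) * g u w.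
Proof. exact: (ric_wedgeJg Gsym Gunit JJ GJ (Tf_lin2 x) (Tf_sym x) (Tf_J x)). Qed.

Lemma grad_embedT : gradf G F = v.
Proof.
have [n2 n1] := c_neq0.
apply: g_inj => x; rewrite (g_gradf Gsym Gunit embedT_nabla_curv) /dscalf.
rewrite (contract_linear (h := fun u => - (2 * n%:R + 4) *: H x u + - endo_trace (H x) *: u)).
  rewrite (trD (fun u => - (2 * n%:R + 4) *: H x u)) (trZ _ (H x)).
  rewrite (trZ _ (fun z : E => z)) tr_id tr_Tf; field; exact: n1.
by move=> u w; rewrite ric_embedT [RHS]gDl (gZl G _ (H x u)) (gZl G _ u) !mulNr.
Qed.

Lemma tilde_embedT z w : tildef G Jx F z w = 0.
Proof.
have [n2 n1] := c_neq0.
rewrite tilde_div grad_embedT (divE Gsym Gunit JJ GJ embedT_nabla_curv).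
have -> : ricE G F (J z) w = - (2 * n%:R + 4) *: H (J z) w - endo_trace (H (J z)) *: w.
  apply: g_inj => q; rewrite (g_ricE Gunit embedT_nabla_curv) ric_embedT.
  by rewrite [RHS]gDl gNl (gZl G _ (H (J z) w)) (gZl G _ w).
rewrite wJg_half wedgeJE TfE tr_Tf !(JD, JN, JZ, JK) !gE (gJr v z).
generalize (bilin G) => g'; apply/matrixP => i j; rewrite !mx_linE; field.
by rewrite n1 n2.
Qed.

End Grad.
End Embedding2.

Section Equivariance.
Variables (R : realType) (n : nat) (G Jx : 'M[R]_(n.*2)).
Local Notation E := 'rV[R]_(n.*2).
Local Notation J v := (v *m Jx).
Local Notation g := (bilin G).
Local Notation wJ := (wedgeJ G Jx).
Local Notation wJg := (wedgeJg G Jx).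
Local Notation hf := (@halfv R n).
Local Notation e i := (delta_mx 0 i : E).
Hypotheses (Gsym : G^T = G) (Gunit : G \in unitmx).
Hypotheses (JJ : Jx *m Jx = - 1%:M) (GJ : forall u v, g (J u) (J v) = g u v).
Local Notation gC := (gC Gsym).
Local Notation JK := (JK JJ).
Local Notation gJr := (gJr JJ GJ).
Local Notation gJC := (gJC Gsym JJ GJ).
Local Notation g_inj := (g_inj Gunit).

Variable a : 'End(E).
Hypothesis ua : in_u G Jx a.

Definition actf2 (D : E -> E -> E) x y : E := a (D x y) - D (a x) y - D x (a y).

Definition actf4 (S : E -> E -> E -> E -> E) x y z w : E :=
  a (S x y z w) - S (a x) y z w - S x (a y) z w - S x y (a z) w - S x y z (a w).

Lemma u_skew x y : g (a x) y = - g x (a y).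
Proof. by have [h _] := ua; apply/eqP; rewrite -addr_eq0 h. Qed.
Lemma u_J x : a (J x) = J (a x).
Proof. by have [_ h] := ua. Qed.

Let aD x y : a (x + y) = a x + a y. Proof. exact: linearD. Qed.
Let aN x : a (- x) = - a x. Proof. exact: linearN. Qed.
Let aZ k x : a (k *: x) = k *: a x. Proof. exact: linearZ. Qed.

Lemma u_wedgeJ x y z :
  a (wJ x y z) = wJ (a x) y z + wJ x (a y) z + wJ x y (a z).
Proof.
rewrite !wedgeJE !(aD, aN, aZ) !u_J !u_skew.
have sk u v : g (J u) (a v) = - g (J (a u)) v by rewrite -u_J u_skew opprK.
rewrite !sk; generalize (bilin G) => g'; vring.
Qed.

Lemma wedgeJg0 x y z : wJg (fun=> 0) x y z = 0.
Proof. by rewrite wedgeJgE !wedgeJE !(J0, g0l, g0r); vring. Qed.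

Definition bracket_u (H : E -> E) (t : E) : E := a (H t) - H (a t).

Lemma u_wedgeJg H x y z : lin H ->
  a (wJg H x y z) = wJg (bracket_u H) x y z
    + wJg H (a x) y z + wJg H x (a y) z + wJg H x y (a z).
Proof.
move=> hH; rewrite !wedgeJgE.
rewrite (aD (_ + _ + _)) (aD (_ + _)) (aD (wJ _ _ _)) (u_wedgeJ (H x)) (u_wedgeJ x).
rewrite (aZ (2 * g (H (J x)) y)) (aZ (2 * g (J x) y)).
have l1 y' z' u v : wJ (u - v) y' z' = wJ u y' z' - wJ v y' z'.
  by rewrite (linD (@wedgeJ_lin1 R n G Jx y' z')) (linN (@wedgeJ_lin1 R n G Jx y' z')).
have l2 y' z' u v : wJ y' (u - v) z' = wJ y' u z' - wJ y' v z'.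
  by rewrite (linD (@wedgeJ_lin2 R n G Jx y' z')) (linN (@wedgeJ_lin2 R n G Jx y' z')).
rewrite /bracket_u l1 l2 !u_J.
have -> : g (a (H (J x)) - H (J (a x))) y = - g (H (J x)) (a y) - g (H (J (a x))) y.
  by rewrite gDl gNl u_skew.
have -> : g (J (a x)) y = - g (J x) (a y) by rewrite -u_J u_skew.
rewrite (JD Jx (a (H z))) (JN Jx (H (a z))).
move: (wJ _ _ _) (wJ _ _ _) (wJ _ _ _) (wJ _ _ _) (wJ _ _ _) (wJ _ _ _) (wJ _ _ _) (wJ _ _ _).
by move=> *; generalize (bilin G) => g'; vring.
Qed.

Section Curv.
Variable S : E -> E -> E -> E -> E.
Hypotheses (hS : nabla_curv G Jx S) (hS' : nabla_curv G Jx (actf4 S)).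
Local Notation S' := (actf4 S).

Lemma ric_act x u v :
  ricf S' x u v = - ricf S (a x) u v - ricf S x (a u) v - ricf S x u (a v).
Proof.
have [S1 S2 S3 S4] := nc_lin hS.
rewrite /ricf.
transitivity (endo_trace (fun z => (a (S x z u v) - S x (a z) u v)
  + (- S (a x) z u v - S x z (a u) v - S x z u (a v)))).
  by apply: eq_trace => z; rewrite /actf4; vring.
rewrite trD trD trN (tr_comp (@lin_lfun _ _ _ a) (S2 x u v)) subrr add0r.
by rewrite !trD !trN.
Qed.

Lemma ricE_act x u :
  ricE G S' x u = a (ricE G S x u) - ricE G S (a x) u - ricE G S x (a u).
Proof.
apply: g_inj => v; rewrite (g_ricE Gunit hS') ric_act !gDl !gNl.
by rewrite u_skew !(g_ricE Gunit hS); ring.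
Qed.

Lemma dscal_act x : dscalf G S' x = - dscalf G S (a x).
Proof.
rewrite (dscalE Gsym Gunit hS') (dscalE Gsym Gunit hS).
transitivity (endo_trace (fun u => (a (ricE G S x u) - ricE G S x (a u)) - ricE G S (a x) u)).
  by apply: eq_trace => u; rewrite ricE_act; vring.
by rewrite trD trD !trN (tr_comp (@lin_lfun _ _ _ a) (ricE_lin2 Gunit hS x)) subrr add0r.
Qed.

Lemma grad_act : gradf G S' = a (gradf G S).
Proof.
apply: g_inj => x; rewrite (g_gradf Gsym Gunit hS') dscal_act u_skew.
by rewrite (g_gradf Gsym Gunit hS).
Qed.

Lemma tilde_act z w : tildef G Jx S' z w = actf2 (tildef G Jx S) z w.
Proof.
rewrite /actf2 !(tildeE Gsym Gunit JJ GJ hS) (tildeE Gsym Gunit JJ GJ hS').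
rewrite ricE_act grad_act (aD (J _)) (aZ _ (wJg _ _ _ _)) !u_J (JD Jx (_ - _)) !JN (JD Jx (a _)) JN.
rewrite (u_wedgeJg _ _ _ (@half_lin R n)).
have -> : wJg (bracket_u hf) (gradf G S) z w = 0.
  rewrite -[RHS](wedgeJg0 (gradf G S) z w); apply: eq_wedgeJg => t.
  by rewrite /bracket_u /halfv aZ subrr.
generalize (wJg hf) => W; vring.
Qed.

End Curv.
Lemma wedgeJg_subl (H H' : E -> E) x y z :
  wJg (fun t => H t - H' t) x y z = wJg H x y z - wJg H' x y z.
Proof.
have := wedgeJg_lin0 G Jx H' H (-1) x y z; rewrite scaleN1r addrC => <-.
by apply: eq_wedgeJg => t; rewrite scaleN1r addrC.
Qed.

Lemma hol_act D x y : hol Jx (actf2 D) x y = actf2 (hol Jx D) x y.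
Proof.
rewrite /actf2 /hol !aZ aD aN !u_J !(JD, JN).
by vring.
Qed.

Lemma embed_act D u v w z : div_type G Jx D ->
  actf4 (embed G Jx D) u v w z = embed G Jx (actf2 D) u v w z.
Proof.
move=> hD; have [D1 D2] := dt_lin hD.
have cE D' u' v' w' z' : embed G Jx D' u' v' w' z' = - (2 * (n%:R + 3))^-1 *:
   (wJg (hop Jx D' u') v' w' z' - (D' (wJ v' w' u') z' + wJ u' (D' w' v' - D' v' w') z')).
  by rewrite embed_psi /psi1f /psi2f scalerBr.
rewrite /actf4 !cE aZ -!scalerBr; congr (_ *: _).
have -> : wJg (hop Jx (actf2 D) u) v w z =
    wJg (bracket_u (hop Jx D u)) v w z - wJg (hop Jx D (a u)) v w z.
  rewrite -wedgeJg_subl; apply: eq_wedgeJg => t.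
  by rewrite /bracket_u /hop /actf2 !u_J !(JD, JN); vring.
have -> : actf2 D (wJ v w u) z = a (D (wJ v w u) z) - (D (wJ (a v) w u) z
    + D (wJ v (a w) u) z + D (wJ v w (a u)) z) - D (wJ v w u) (a z).
  by rewrite /actf2 u_wedgeJ !(linD (D1 z)).
have -> : wJ u (actf2 D w v - actf2 D v w) z =
    wJ u (a (D w v - D v w)) z - wJ u (D w (a v) - D (a v) w) z - wJ u (D (a w) v - D v (a w)) z.
  have l2 p q : wJ u (p - q) z = wJ u p z - wJ u q z.
    by rewrite (linD (@wedgeJ_lin2 R n G Jx u z)) (linN (@wedgeJ_lin2 R n G Jx u z)).
  rewrite -!l2; congr (wJ u _ z); rewrite /actf2 aD aN; vring.
rewrite (aD (wJg _ _ _ _)) aN (aD (D _ _)) (u_wedgeJ u) (u_wedgeJg _ _ _ (hop_lin hD u)).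
generalize (wJg (hop Jx D u)) (wJg (hop Jx D (a u))) => W W'.
generalize (wJg (bracket_u (hop Jx D u)) v w z) => W2.
move: (wJ (a v) w u) (wJ v (a w) u) (wJ v w (a u)) (wJ v w u) => p1 p2 p3 p4.
by generalize wJ => w'; vring.
Qed.

Lemma embedT_act v x y z w :
  actf4 (embedT G Jx v) x y z w = embedT G Jx (a v) x y z w.
Proof.
rewrite /actf4 /embedT (u_wedgeJg _ _ _ (Tf_lin2 G JJ v x)).
have -> : wJg (Tf G Jx (a v) x) y z w =
  wJg (bracket_u (Tf G Jx v x)) y z w - wJg (Tf G Jx v (a x)) y z w.
  rewrite -wedgeJg_subl; apply: eq_wedgeJg => t.
  have h : a (J (wJ x (J v) t)) = J (wJ (a x) (J v) t) + J (wJ x (J (a v)) t)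
      + J (wJ x (J v) (a t)).
    by rewrite u_J u_wedgeJ u_J -!mulmxDl.
  rewrite /bracket_u /Tf aZ (aD (J _)) h aN aZ u_skew.
  move: (J (wJ _ _ _)) (J (wJ _ _ _)) (J (wJ _ _ _)) => *.
  by generalize (bilin G) => g'; vring.
generalize (wJg (bracket_u (Tf G Jx v x)) y z w) => W1.
generalize (wJg (Tf G Jx v x)) (wJg (Tf G Jx v (a x))) => W2 W3; vring.
Qed.

End Equivariance.

(** * The projections onto the summands *)

Section NonzeroDiv.
Variables (R : realType) (n : nat) (G Jx : 'M[R]_(n.*2)).
Local Notation E := 'rV[R]_(n.*2).
Local Notation J v := (v *m Jx).
Local Notation g := (bilin G).
Hypotheses (Gsym : G^T = G) (Gunit : G \in unitmx).
Hypotheses (JJ : Jx *m Jx = - 1%:M) (GJ : forall u v, g (J u) (J v) = g u v).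
Local Notation gC := (gC Gsym).
Local Notation JK := (JK JJ).
Local Notation gJr := (gJr JJ GJ).
Local Notation gJC := (gJC Gsym JJ GJ).
Local Notation g_inj := (g_inj Gunit).

Lemma lc_eq0 (x : E) c d : x != 0 -> c *: x + d *: J x = 0 -> c = 0 /\ d = 0.
Proof.
move=> x0 h; have hJ : c *: J x - d *: x = 0.
  by rewrite -[RHS](J0 Jx) -h JD !JZ JK scalerN.
have : (c ^+ 2 + d ^+ 2) *: x = 0.
  transitivity (c *: (c *: x + d *: J x) - d *: (c *: J x - d *: x)).
    by generalize (J x) => y; vring.
  by rewrite h hJ !scaler0 subr0.
move/eqP; rewrite scaler_eq0 (negPf x0) orbF paddr_eq0 ?sqr_ge0// !sqrf_eq0.
by case/andP=> /eqP-> /eqP->.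
Qed.

Lemma orthogonal_pair : (2 <= n)%N ->
  exists v w : E, [/\ v != 0, w != 0, g w v = 0 & g (J w) v = 0].
Proof.
move=> n2.
have n20 : (0 < n.*2)%N by rewrite double_gt0 (leq_trans _ n2).
pose v : E := const_mx 1.
have v0 : v != 0.
  apply/eqP => /rowP /(_ (Ordinal n20)); rewrite !mxE; exact/eqP/oner_neq0.
pose M := G *m row_mx (trmx v) (trmx (J v)).
have : kermx M != 0.
  rewrite -mxrank_eq0 mxrank_ker -lt0n subn_gt0.
  apply: leq_ltn_trans (rank_leq_col M) _.
  by rewrite -addnn (leq_trans _ (leq_add n2 n2)).
case/rowV0Pn => w /sub_kermxP wM w0.
exists v, w; rewrite v0 w0; split=> //.
  have := congr1 (fun A : 'rV_(1 + 1) => A 0 (lshift 1 0)) wM.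
  by rewrite /M mulmxA mul_mx_row row_mxEl [X in _ = X]mxE.
have := congr1 (fun A : 'rV_(1 + 1) => A 0 (rshift 1 0)) wM.
rewrite /M mulmxA mul_mx_row row_mxEr [X in _ = X]mxE => h.
by apply: oppr_inj; rewrite -gJr oppr0.
Qed.

Section Explicit.
Variables v w : E.
Hypotheses (wv : g w v = 0) (Jwv : g (J w) v = 0).

(* With alpha the C-linear form x |-> h(x, v), [sqD] below is the skew-Hermitian part
   of alpha (x) alpha (x) w; it is trace free because alpha(w) = 0. *)
Fact sq_key : unit. Proof. exact: tt. Qed.

Definition sq_b : E -> E -> E := locked_with sq_key (fun x y =>
  (g x v * g y v - g (J x) v * g (J y) v) *: w
  - (g x v * g (J y) v + g (J x) v * g y v) *: J w).

Definition sq_a : E -> E -> E := locked_with sq_key (fun x y =>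
  (g x v * g w y - g (J x) v * g (J w) y) *: v
  + (g (J x) v * g w y + g x v * g (J w) y) *: J v).

Lemma sq_bE x y : sq_b x y = (g x v * g y v - g (J x) v * g (J y) v) *: w
  - (g x v * g (J y) v + g (J x) v * g y v) *: J w.
Proof. by rewrite /sq_b unlock. Qed.

Lemma sq_aE x y : sq_a x y = (g x v * g w y - g (J x) v * g (J w) y) *: v
  + (g (J x) v * g w y + g x v * g (J w) y) *: J v.
Proof. by rewrite /sq_a unlock. Qed.

Definition sqD x y := sq_b x y - sq_a x y.

Lemma g_sq_b x y z : g (sq_b x y) z =
  (g x v * g y v - g (J x) v * g (J y) v) * g w z
  - (g x v * g (J y) v + g (J x) v * g y v) * g (J w) z.
Proof. by rewrite !sq_bE gDl gNl !gZl. Qed.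

Lemma g_sq_a x y z : g (sq_a x y) z = g (sq_b x z) y.
Proof.
rewrite g_sq_b sq_aE gDl !gZl (gC v z) (gJC v z).
by generalize (bilin G) => g'; ring.
Qed.

Lemma g_sqD x y z : g (sqD x y) z = g (sq_b x y) z - g (sq_b x z) y.
Proof. by rewrite /sqD (gDl G (sq_b x y)) gNl g_sq_a. Qed.

Lemma sq_b_J x y : sq_b x (J y) = J (sq_b x y).
Proof.
rewrite !sq_bE JK gNl JD JN !JZ JK.
by generalize (bilin G) => g'; vring.
Qed.

Lemma sq_bC x y : sq_b x y = sq_b y x.
Proof. by rewrite !sq_bE; generalize (bilin G) => g'; vring. Qed.

Lemma sq_a_J x y : sq_a x (J y) = J (sq_a x y).
Proof.
by apply: g_inj => z; rewrite -[RHS]opprK -gJr !g_sq_a sq_b_J gJr.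
Qed.

Lemma sq_a_Jl x y : sq_a (J x) y = - J (sq_a x y).
Proof.
apply: g_inj => z; rewrite gNl -gJr !g_sq_a sq_bC sq_b_J sq_b_J sq_bC.
by [].
Qed.

Lemma sqD_div_type : div_type G Jx sqD.
Proof.
have sqJ x y : sqD x (J y) = J (sqD x y).
  by rewrite /sqD sq_b_J sq_a_J JD JN.
split=> //.
- split=> [y|x] k a b; rewrite /sqD !sq_bE !sq_aE !(JD, JZ, gDl, gDr, gZl, gZr);
    by generalize (bilin G) => g'; vring.
- by move=> x y z; rewrite !g_sqD opprB.
- move=> x y; rewrite /sqD (sq_bC (J x)) (sq_bC (J y)) !sq_b_J !sq_a_Jl (sq_bC y x).
  rewrite !(JD, JN) !JK.
  by generalize (sq_b x y) (sq_a x y) (sq_a y x) => p q r; vring.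
- move=> x.
  transitivity (endo_trace (fun y => (g x v *: (g y v *: J w) + - g (J x) v *: (g (J y) v *: J w))
    + (g x v *: (g (J y) v *: w) + g (J x) v *: (g y v *: w))
    + (- g x v *: (g w y *: J v) + g (J x) v *: (g (J w) y *: J v))
    + (g (J x) v *: (g w y *: v) + g x v *: (g (J w) y *: v)))).
    apply: eq_trace => y; rewrite /sqD !sq_bE !sq_aE !(JD, JN, JZ, JK).
    by generalize (bilin G) => g'; vring.
  rewrite !trE !(tr_gl Gsym) !(tr_gJl Gsym JJ GJ) !tr_gr !GJ.
  by rewrite !gJr (gC v w) (gJC v w) wv Jwv; ring.
Qed.

Lemma sqD_neq0 : v != 0 -> w != 0 -> ~ (forall x y, sqD x y = 0).
Proof.
move=> v0 w0 h; have b0 x y : sq_b x y = 0.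
  have h1 := h x y; have h2 : J (sqD (J x) y) = 0 by rewrite h J0.
  move: h1 h2; rewrite /sqD (sq_bC (J x)) sq_b_J (sq_bC y x) sq_a_Jl JD JN JN !JK.
  move=> h1 h2; have : 2 *: sq_b x y = 0.
    rewrite -[RHS]addr0 -{2}h1 -[in X in _ = X + _]oppr0 -h2.
    by generalize (sq_b x y) (sq_a x y) => p q; vring.
  by move/eqP; rewrite scaler_eq0 pnatr_eq0 => /eqP.
suff : v = 0 by apply/eqP.
apply: g_inj => x; rewrite g0l gC.
have := b0 x x; rewrite !sq_bE -[- (_ *: J w)]scaleNr => hx; have [h1 h2] := lc_eq0 w0 hx.
have : (g x v * g x v - g (J x) v * g (J x) v) ^+ 2 +
  (g x v * g (J x) v + g (J x) v * g x v) ^+ 2 = 0.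
  by rewrite h1 -[X in _ + X ^+ 2]opprK h2; ring.
have -> : (g x v * g x v - g (J x) v * g (J x) v) ^+ 2 +
  (g x v * g (J x) v + g (J x) v * g x v) ^+ 2 = (g x v ^+ 2 + g (J x) v ^+ 2) ^+ 2 by ring.
move/eqP; rewrite sqrf_eq0 paddr_eq0 ?sqr_ge0// sqrf_eq0.
by case/andP=> /eqP.
Qed.
End Explicit.

Lemma exists_div_type : (2 <= n)%N ->
  exists2 D, div_type G Jx D & ~ (forall x y, D x y = 0).
Proof.
move=> /orthogonal_pair[v [w [v0 w0 wv Jwv]]].
by exists (sqD v w); [exact: sqD_div_type | exact: sqD_neq0].
Qed.
End NonzeroDiv.

Section ComplexPlane.
Variables (R : realType) (n : nat) (Jx : 'M[R]_(n.*2)).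
Local Notation E := 'rV[R]_(n.*2).
Local Notation J v := (v *m Jx).
Hypotheses (JJ : Jx *m Jx = - 1%:M) (n2 : n = 2%N).
Local Notation JK := (JK JJ).

Lemma complex_basis : exists u v : E,
  basis_of fullv [tuple u; J u; v; J v].
Proof.
have dimE : \dim {:E} = 4%N by rewrite dimvf /dim /= n2.
have E0 : (0 < \dim {:E})%N by rewrite dimE.
have [u u0] : exists u : E, u != 0.
  exists (vpick {:E}); rewrite vpick0 -dimv_eq0 dimE//.
pose V := (<[u]> + <[J u]>)%VS.
have VJ x : x \in V -> J x \in V.
  case/memv_addP => _ /vlineP[a ->] [_ /vlineP[b ->] ->].
  rewrite JD !JZ JK scalerN addrC memv_add// ?rpredN memvZ ?memv_line//.
have dV : (\dim V <= 2)%N.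
  by rewrite (leq_trans (dimv_add_leqif _ _).1)// !dim_vline; case: eqP; case: eqP.
have [v vV] : exists v : E, v \notin V.
  apply/not_existsP => h; have : ({:E} <= V)%VS.
    by apply/subvP => x _; have := h x; case: (x \in V) => //= /(_ isT).
  by move/dimvS; rewrite dimE; move: dV; case: (\dim V) => [|[|[|[|k]]]].
exists u, v; rewrite basisEfree subvf dimE !andbT.
have indep (W : {vspace E}) x c d : (forall x, x \in W -> J x \in W) ->
    x \notin W -> c *: x + d *: J x \in W -> c = 0 /\ d = 0.
  move=> WJ xW h; have hJ : c *: J x - d *: x \in W.
    have -> : c *: J x - d *: x = J (c *: x + d *: J x) by rewrite JD !JZ JK scalerN.
    exact: WJ.
  have : (c ^+ 2 + d ^+ 2) *: x \in W.
    have -> : (c ^+ 2 + d ^+ 2) *: x =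
        c *: (c *: x + d *: J x) - d *: (c *: J x - d *: x).
      by generalize (J x) => y; vring.
    by rewrite memvB// memvZ.
  rewrite rpredZeq (negPf xW) orbF paddr_eq0 ?sqr_ge0// !sqrf_eq0.
  by case/andP=> /eqP-> /eqP->.
apply/freeP => k; rewrite !big_ord_recl big_ord0 /= addr0 => h.
have [k2 k3] : k (lift ord0 (lift ord0 ord0)) = 0 /\ k (lift ord0 (lift ord0 (lift ord0 ord0))) = 0.
  apply: (indep V v) => //.
  set s := _ + _.
  have -> : s = - (k ord0 *: u + k (lift ord0 ord0) *: J u).
    by apply/eqP; rewrite -addr_eq0 addrC -addrA; apply/eqP.
  by rewrite rpredN memv_add// memvZ ?memv_line.
have [k0 k1] : k ord0 = 0 /\ k (lift ord0 ord0) = 0.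
  apply: (indep 0%VS u); first by move=> x /[!memv0] /eqP ->; rewrite J0.
    by rewrite memv0.
  by rewrite memv0; apply/eqP; move: h; rewrite k2 k3 !scale0r !addr0.
move=> i; have : i \in enum 'I_4 by rewrite mem_enum.
rewrite !enum_ordSl enum_ord0/= !inE.
by do ![case/orP]; move=> /eqP ->.
Qed.

Variables (u v : E).
Let X := [tuple u; J u; v; J v].
Hypothesis bX : basis_of fullv X.
Local Notation al i := (coord X i).
Local Notation i0 := (@Ordinal 4 0 isT).
Local Notation i1 := (@Ordinal 4 1 isT).
Local Notation i2 := (@Ordinal 4 2 isT).
Local Notation i3 := (@Ordinal 4 3 isT).

Lemma X_sum c0 c1 c2 c3 (x : E) : x = c0 *: u + c1 *: J u + c2 *: v + c3 *: J v ->
  [/\ al i0 x = c0, al i1 x = c1, al i2 x = c2 & al i3 x = c3].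
Proof.
move=> ->; have fX := basis_free bX.
pose k (i : 'I_4) := [:: c0; c1; c2; c3]`_i.
have -> : c0 *: u + c1 *: J u + c2 *: v + c3 *: J v = \sum_(i < 4) k i *: X`_i.
  by rewrite !big_ord_recl big_ord0 /k /= addr0 !addrA.
by rewrite !coord_sum_free.
Qed.

Lemma X_expand x : x = al i0 x *: u + al i1 x *: J u + al i2 x *: v + al i3 x *: J v.
Proof.
rewrite {1}(coord_basis bX (memvf x)) !big_ord_recl big_ord0 /= addr0 !addrA.
by congr (_ + _ + _ + _); congr (coord X _ x *: _); apply: val_inj.
Qed.

Lemma al_J x : [/\ al i0 (J x) = - al i1 x, al i1 (J x) = al i0 x,
  al i2 (J x) = - al i3 x & al i3 (J x) = al i2 x].
Proof.
apply: X_sum; rewrite {1}[x]X_expand !JD !JZ !JK.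
by vring.
Qed.

(* f is C-linear of rank at most one, so that its complex trace vanishes iff
   it is nilpotent. *)
Lemma rank1_traceless (f : E -> E) (w : E) i j :
  (forall x, al i (J x) = - al j x) -> (forall x, al j (J x) = al i x) ->
  (forall x, f x = al i x *: w + al j x *: J w) ->
  endo_trace f = 0 -> endo_trace (fun x => J (f x)) = 0 -> al i w = 0 /\ al j w = 0.
Proof.
move=> hi hj hf.
have lal k p : endo_trace (fun z => al k z *: p) = al k p.
  by rewrite (tr_rank1 (al := coord X k))// => c a b; rewrite linearP.
rewrite (eq_trace hf) trD !lal hj => h1.
rewrite (@eq_trace _ _ _ (fun x => al i x *: J w + - (al j x *: w))); last first.
  by move=> x; rewrite hf JD !JZ JK scalerN.
rewrite trD trN !lal hi => h2; split; lra.
Qed.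

Lemma bilinear_traceless_eq0 (b : E -> E -> E) :
  (forall x y, b x y = b y x) -> (forall x, lin (b x)) ->
  (forall x y, b x (J y) = J (b x y)) ->
  (forall x, endo_trace (b x) = 0) -> (forall x, endo_trace (fun y => J (b x y)) = 0) ->
  b u u = 0 -> b v v = 0 -> forall x y, b x y = 0.
Proof.
move=> bC bl bJ t1 t2 buu bvv.
have bJl x y : b (J x) y = J (b x y) by rewrite bC bJ bC.
have bE x y : b x y = al i0 y *: b x u + al i1 y *: J (b x u)
    + al i2 y *: b x v + al i3 y *: J (b x v).
  by rewrite {1}[y]X_expand !(linD (bl x)) !(linZ (bl x)) !bJ.
have [a0 a1] : al i0 (b v u) = 0 /\ al i1 (b v u) = 0.
  apply: (rank1_traceless _ _ _ (t1 v) (t2 v)) => x; try by have [] := al_J x.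
  by rewrite bE bvv J0 !scaler0 !addr0.
have [a2 a3] : al i2 (b v u) = 0 /\ al i3 (b v u) = 0.
  rewrite bC; apply: (rank1_traceless _ _ _ (t1 u) (t2 u)) => x; try by have [] := al_J x.
  by rewrite bE buu J0 !scaler0 !add0r.
have bvu : b v u = 0 by rewrite [b v u]X_expand a0 a1 a2 a3 !scale0r !addr0.
have bvy y : b v y = 0 by rewrite bE bvu bvv J0 !scaler0 !addr0.
have buy y : b u y = 0 by rewrite bE [b u v]bC bvu buu J0 !scaler0 !addr0.
by move=> x y; rewrite bE ![b x _]bC buy bvy J0 !scaler0 !addr0.
Qed.
End ComplexPlane.

Lemma hom_on (R : realType) (V W : vectType R) (U : {vspace V}) (f : V -> W) :
  (forall k x y, x \in U -> y \in U -> f (k *: x + y) = k *: f x + f y) ->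
  exists h : 'Hom(V, W), forall x, x \in U -> h x = f x.
Proof.
move=> hf; exists (linfun (fun x => f (projv U x))) => x xU.
rewrite linfunE ?projv_id// => k y z.
by rewrite linearP hf// memv_proj.
Qed.

Section Iso.
Variables (R : realType) (n : nat) (G Jx : 'M[R]_(n.*2)).
Local Notation E := 'rV[R]_(n.*2).

Lemma irreducible_iso (V1 V2 : vectType R) (act1 : 'End(E) -> V1 -> V1)
    (act2 : 'End(E) -> V2 -> V2) (W1 : {vspace V1}) (W2 : {vspace V2}) :
  irreducible G Jx act1 W1 -> module_iso G Jx act1 act2 W1 W2 ->
  irreducible G Jx act2 W2.
Proof.
move=> [sW1 W1n0 irr] [f [fW fK feq]].
have injf w : w \in W1 -> f w = 0 -> w = 0.
  by move=> wW fw; apply/eqP; rewrite -memv0 -fK memv_cap wW memv_ker fw eqxx.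
split.
- move=> a ua w; rewrite -fW => /memv_imgP[v vW ->].
  by rewrite -feq// memv_img// sW1.
- move=> W20; apply: W1n0; apply/eqP; rewrite -subv0; apply/subvP => w wW.
  rewrite (injf w)// ?mem0v//; apply/eqP; rewrite -memv0 -W20 -fW.
  exact: memv_img.
- move=> U sU UW2; pose P := (W1 :&: f @^-1: U)%VS.
  have sP : submodule G Jx act1 P.
    move=> a ua w /[!memv_cap] /andP[wW]; rewrite -!memv_preim => fwU.
    by rewrite sW1//= feq// sU.
  have fP : (f @: P)%VS = U.
    apply/eqP; rewrite eqEsubv; apply/andP; split.
      apply/subvP => _ /memv_imgP[w + ->]; rewrite memv_cap -memv_preim.
      by case/andP.
    apply/subvP => x xU; move: (subvP UW2 _ xU); rewrite -fW => /memv_imgP[w wW xE].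
    by rewrite xE memv_img// memv_cap wW -memv_preim -xE.
  have [P0|PW] := irr P sP (capvSl _ _); [left|right].
    by rewrite -fP P0 limg0.
  by rewrite -fP PW.
Qed.

End Iso.

Section Assembly.
Variables (R : realType) (n : nat) (G Jx : 'M[R]_(n.*2)).
Local Notation E := 'rV[R]_(n.*2).
Local Notation J v := (v *m Jx).
Local Notation g := (bilin G).
Local Notation tens := (tensor5 R n).
Local Notation act := (@act_tensor5 R n).

Hypothesis Gsym : G^T = G.

Definition tfun (T : tens) (x y z w : E) : E := T x y z w.

Lemma tfun_lin T : lin4 (tfun T).
Proof.
by split=> [y z w|x z w|x y w|x y z] k a b; rewrite /tfun !linearP ?add_lfunE ?scale_lfunE.
Qed.

Lemma tfun_hom4 f : lin4 f -> tfun (hom4 f) = f.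
Proof. by move=> hf; do 4![apply/funext => ?]; rewrite /tfun hom4E. Qed.

Lemma tfun_inj T T' : (forall x y z w, tfun T x y z w = tfun T' x y z w) -> T = T'.
Proof. by move=> h; do 4![apply/lfunP => ?]; exact: h. Qed.

Lemma tfunP k T T' x y z w :
  tfun (k *: T + T') x y z w = k *: tfun T x y z w + tfun T' x y z w.
Proof. by rewrite /tfun !(add_lfunE, scale_lfunE). Qed.

Lemma hom_act_lin1 (a : 'End(E)) : lin (hom_act a a).
Proof. by apply: hom_act_lin; exact: lin_lfun. Qed.
Lemma hom_act_lin2 (a : 'End(E)) : lin (hom_act a (hom_act a a)).
Proof. by apply: hom_act_lin; [exact: lin_lfun|exact: hom_act_lin1]. Qed.
Lemma hom_act_lin3 (a : 'End(E)) : lin (hom_act a (hom_act a (hom_act a a))).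
Proof. by apply: hom_act_lin; [exact: lin_lfun|exact: hom_act_lin2]. Qed.
Lemma act_lin (a : 'End(E)) : lin (act a).
Proof. by apply: hom_act_lin; [exact: lin_lfun|exact: hom_act_lin3]. Qed.

Lemma hom_act2E (V1 V2 W : vectType R) (a1 : 'End(V1)) (a2 : 'End(V2))
    (b : W -> W) (f : 'Hom(V1, 'Hom(V2, W))) x y : lin b ->
  hom_act a1 (hom_act a2 b) f x y = b (f x y) - f x (a2 y) - f (a1 x) y.
Proof.
move=> hb; have l1 : lin a1 := @lin_lfun _ _ _ a1; have l2 : lin a2 := @lin_lfun _ _ _ a2.
rewrite (hom_actE _ _ l1 (hom_act_lin l2 hb)) add_lfunE opp_lfunE.
by rewrite (hom_actE _ _ l2 hb).
Qed.

Lemma act_bilE (a : 'End(E)) (b : 'Hom(E, 'End(E))) x y :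
  act_bil a b x y = a (b x y) - b x (a y) - b (a x) y.
Proof. exact: hom_act2E (@lin_lfun _ _ _ a). Qed.

Lemma tfun_act a T : tfun (act a T) = actf4 a (tfun T).
Proof.
apply/funext => x; apply/funext => y; apply/funext => z; apply/funext => w.
have e : act a T x y = hom_act a (hom_act a a) (T x y) - T x (a y) - T (a x) y.
  exact: hom_act2E (@hom_act_lin2 a).
have e2 : hom_act a (hom_act a a) (T x y) z w = a (T x y z w) - T x y z (a w) - T x y (a z) w.
  exact: hom_act2E (@lin_lfun _ _ _ a).
rewrite /tfun e /actf4.
have -> (X Y Z : 'Hom(E, 'End(E))) : (X - Y - Z) z w = X z w - Y z w - Z z w.
  by rewrite !(add_lfunE, opp_lfunE).
rewrite e2; move: (T x y z w) (T x y z (a w)) (T x y (a z) w) (T x (a y) z w) (T (a x) y z w).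
by move=> *; vring.
Qed.

Lemma nabla_curvP T : nabla_curvature_tensor G Jx T <-> nabla_curv G Jx (tfun T).
Proof.
split=> [[h b2]|[_ sk u jj b1 b2]].
  split; first exact: tfun_lin.
  - by move=> x y z w; have [sk _ _] := h x; rewrite /tfun sk opp_lfunE.
  - move=> x y z v w; have [_ /(_ y z)[u _] _] := h x.
    by apply/eqP; rewrite -addr_eq0 (gC Gsym (tfun T x y z w)); apply/eqP; exact: u.
  - by move=> x y z v; have [_ /(_ y z)[_ jj] _] := h x; rewrite /tfun jj.
  - by move=> x y z w; have [_ _ b1] := h x; exact: b1.
  - by move=> x y z w; rewrite /tfun -!add_lfunE b2 zero_lfunE.
split=> [x|x y z]; last by apply/lfunP => w; rewrite !add_lfunE zero_lfunE; exact: b2.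
split=> [y z|y z|y z w]; last exact: b1.
  by apply/lfunP => w; rewrite opp_lfunE; exact: sk.
split=> [v w|v]; last exact: jj.
by rewrite (gC Gsym v); apply/eqP; rewrite addr_eq0; apply/eqP; exact: u.
Qed.
End Assembly.

Lemma directv3 (K : fieldType) (V : vectType K) (A B C : {vspace V}) :
  directv (A + B + C) ->
  [/\ (A :&: (B + C) = 0)%VS, (B :&: (A + C) = 0)%VS, (C :&: (A + B) = 0)%VS &
     [/\ (B :&: C = 0)%VS, (A :&: C = 0)%VS & (A :&: B = 0)%VS]].
Proof.
rewrite directv_addE/= => /and3P[].
rewrite directv_addE/= => /and3P[_ _ /eqP dAB] _ /eqP dC.
have z0 (X Y : {vspace V}) : (forall x, x \in X -> x \in Y -> x = 0) -> (X :&: Y = 0)%VS.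
  move=> h; apply/eqP; rewrite -subv0; apply/subvP => x; rewrite memv_cap.
  by case/andP=> xA xB; rewrite (h x)// mem0v.
have eAB x : x \in A -> x \in B -> x = 0.
  by move=> xA xB; apply/eqP; rewrite -memv0 -dAB memv_cap xA.
have eC x : x \in (A + B)%VS -> x \in C -> x = 0.
  by move=> xA xB; apply/eqP; rewrite -memv0 -dC memv_cap xA.
have sl := subvP (addvSl A B); have sr := subvP (addvSr A B).
split; [apply: z0 => x..|split; apply: z0 => x].
- move=> xA /memv_addP[b bB [c cC xE]]; have c0 : c = 0.
    apply: eC => //; have -> : c = x - b by rewrite xE addrC addKr.
    by rewrite memvB ?(sl x) ?(sr b).
  by apply: eAB => //; rewrite xE c0 addr0.
- move=> xB /memv_addP[a aA [c cC xE]]; have c0 : c = 0.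
    apply: eC => //; have -> : c = x - a by rewrite xE addrC addKr.
    by rewrite memvB ?(sr x) ?(sl a).
  by apply: eAB => //; rewrite xE c0 addr0.
- by move=> xC xAB; exact: eC.
- by move=> xB xC; apply: eC => //; exact: sr.
- by move=> xA xC; apply: eC => //; exact: sl.
- exact: eAB.
Qed.

Section Abstract.
Variables (R : realType) (n : nat) (G Jx : 'M[R]_(n.*2)).
Local Notation E := 'rV[R]_(n.*2).
Variables (V : vectType R) (act : 'End(E) -> V -> V).
Hypothesis actD : forall a, {morph act a : u v / u + v}.
Variables (Q0 Q' Q1 : {vspace V}).
Local Notation U := (Q0 + Q' + Q1)%VS.
Hypotheses (dQ : directv (Q0 + Q' + Q1)).
Hypotheses (i0 : irreducible G Jx act Q0) (i' : irreducible G Jx act Q').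
Hypothesis (i1 : irreducible G Jx act Q1).
Hypotheses (n0' : ~ module_iso G Jx act act Q0 Q').
Hypotheses (n01 : ~ module_iso G Jx act act Q0 Q1).
Hypotheses (n'1 : ~ module_iso G Jx act act Q' Q1).
Hypothesis (iso1 : module_iso G Jx act (@act_vec R n) Q1 fullv).

Variables (gr : V -> E) (eT : E -> V) (PD : V -> V).
Hypothesis E0 : exists v : E, v != 0.
Hypothesis gr_lin : forall k S T, S \in U -> T \in U -> gr (k *: S + T) = k *: gr S + gr T.
Hypothesis gr_act : equivariant G Jx act (@act_vec R n) U gr.
Hypothesis eT_lin : lin eT.
Hypothesis eT_mem : forall v, eT v \in U.
Hypothesis eT_act : forall a v, in_u G Jx a -> eT (a v) = act a (eT v).
Hypothesis gr_eT : forall v, gr (eT v) = v.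
Hypothesis PD_lin : forall k S T, S \in U -> T \in U -> PD (k *: S + T) = k *: PD S + PD T.
Hypothesis PD_mem : forall T, T \in U -> PD T \in U.
Hypothesis PD_act : equivariant G Jx act act U PD.
Hypothesis PD_PD : forall T, T \in U -> PD (PD T) = PD T.
Hypothesis PD_eT : forall v, PD (eT v) = 0.
Hypothesis PD_neq0 : ~ (forall T, T \in U -> PD T = 0).

Let s0 : submodule G Jx act Q0. Proof. by case: i0. Qed.
Let s' : submodule G Jx act Q'. Proof. by case: i'. Qed.
Let s1 : submodule G Jx act Q1. Proof. by case: i1. Qed.
Let sU : submodule G Jx act U.
Proof. by apply: submoduleD => //; apply: submoduleD. Qed.

Let QU : [/\ (Q0 <= U)%VS, (Q' <= U)%VS & (Q1 <= U)%VS].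
Proof.
split; [exact: subv_trans (addvSl Q0 Q') (addvSl _ _)
       |exact: subv_trans (addvSr Q0 Q') (addvSl _ _)|exact: addvSr].
Qed.

Lemma not_id_of_iso (V' : vectType R) (act' : 'End(E) -> V' -> V')
    (W : {vspace V'}) (f : V -> V') :
  (forall a, act' a 0 = 0) -> module_iso G Jx act act' Q' W ->
  (forall k S T, S \in U -> T \in U -> f (k *: S + T) = k *: f S + f T) ->
  (forall T, T \in U -> f T \in W) -> equivariant G Jx act act' U f ->
  (forall T, T \in U -> f T = 0 -> PD T = 0) ->
  ~ (forall T, T \in Q0 -> PD T = T).
Proof.
move=> act0 iso' f_lin fW feq fPD PD_id; have [q0 q' q1] := QU.
have [h hE] := hom_on f_lin.
have hW : (h @: Q0 <= W)%VS.
  by apply/subvP => _ /memv_imgP[w /(subvP q0) wU ->]; rewrite hE ?fW.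
have heq : equivariant G Jx act act' Q0 h.
  by move=> a ua w wQ; have wU := subvP q0 _ wQ; rewrite !hE ?feq// sU.
have [h0|iso] := schur act0 i0 (irreducible_iso i' iso') hW heq; last first.
  by apply: n0'; apply: module_iso_trans iso (module_iso_sym s' iso').
have [_ Q0n0 _] := i0; apply: Q0n0; apply/eqP; rewrite -subv0; apply/subvP => T TQ.
have TU := subvP q0 _ TQ.
by rewrite memv0 -(PD_id T)// fPD// -hE ?h0.
Qed.

Lemma not_id_of_dim (V' : vectType R) (f : V -> V') :
  (\dim {:V'} < \dim Q0)%N ->
  (forall k S T, S \in U -> T \in U -> f (k *: S + T) = k *: f S + f T) ->
  (forall T, T \in U -> f T = 0 -> PD T = 0) ->
  ~ (forall T, T \in Q0 -> PD T = T).
Proof.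
move=> dimQ f_lin fPD PD_id; have [q0 q' q1] := QU.
have [h hE] := hom_on f_lin.
suff K0 : (Q0 :&: lker h = 0)%VS.
  move: dimQ; rewrite -(limg_ker_dim h Q0) K0 dimv0 add0n.
  by rewrite ltnNge dimvS// subvf.
apply/eqP; rewrite -subv0; apply/subvP => T; rewrite memv_cap memv_ker => /andP[TQ /eqP hT].
have TU := subvP q0 _ TQ.
by rewrite memv0 -(PD_id T)// fPD// -hE.
Qed.

Hypothesis PD_Q0 : ~ (forall T, T \in Q0 -> PD T = T).

Lemma grad_summand (Q : {vspace V}) : (Q <= U)%VS -> irreducible G Jx act Q ->
  ~ module_iso G Jx act act Q Q1 -> forall T, T \in Q -> gr T = 0.
Proof.
move=> sQU iQ nQ; have QU' := subvP sQU.
have [f fE] := hom_on gr_lin.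
have iE : irreducible G Jx (@act_vec R n) fullv by exact: irreducible_iso i1 iso1.
have act0 a : @act_vec R n a 0 = 0 by rewrite /act_vec linear0.
have feq : equivariant G Jx act (@act_vec R n) Q f.
  move=> a ua w wQ; have wU := QU' _ wQ; rewrite !fE ?gr_act//.
  exact: sU.
have [h T TQ|iso] := schur act0 iQ iE (subvf _) feq.
  by rewrite -fE ?h//; exact: QU'.
by case: nQ; apply: module_iso_trans iso (module_iso_sym s1 iso1).
Qed.

Let gr0 T : T \in Q0 -> gr T = 0.
Proof. by have [q0 q' q1] := QU; exact: grad_summand. Qed.

Let gr' T : T \in Q' -> gr T = 0.
Proof. by have [q0 q' q1] := QU; exact: grad_summand. Qed.

Lemma split3 T : T \in U -> exists A B C,
  [/\ A \in Q0, B \in Q', C \in Q1 & T = A + B + C].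
Proof.
by case/memv_addP => _ /memv_addP[A AQ [B BQ ->]] [C CQ ->]; exists A, B, C.
Qed.

Lemma eT_gr_Q1 T : T \in Q1 -> eT (gr T) = T.
Proof.
have hl k S T' : S \in U -> T' \in U -> eT (gr (k *: S + T')) = k *: eT (gr S) + eT (gr T').
  by move=> SU TU; rewrite gr_lin// eT_lin.
have [P PE] := hom_on hl; have [q0 q' q1] := QU.
have [d0 d' d1 [d'1 d01 d0']] := directv3 dQ.
have UE : U = (Q1 + (Q0 + Q'))%VS by rewrite addvC.
have PU S : S \in U -> P S \in U by move=> SU; rewrite PE.
have Peq : equivariant G Jx act act U P.
  by move=> a ua w wU; rewrite !PE ?sU// gr_act// /act_vec eT_act.
have PP S : S \in U -> P (P S) = P S.
  by move=> SU; have := PU _ SU; rewrite PE// => h; rewrite PE// gr_eT.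
have n10 : ~ module_iso G Jx act act Q1 Q0 by move/(module_iso_sym s1).
have n1' : ~ module_iso G Jx act act Q1 Q' by move/(module_iso_sym s1).
have := idempotent_on_summand actD i1 i0 i' n10 n1' d1 d0' (P := P).
rewrite -UE => /(_ PU Peq PP) [h|h]; last first.
  by move=> TQ; rewrite -PE ?h//; exact: (subvP q1).
suff P0 S : S \in U -> P S = 0.
  have [x] := E0; have eT0 : eT x = 0 by rewrite -(P0 (eT x))// PE// gr_eT.
  have gr00 : gr 0 = 0.
    apply: (addrI (gr 0)); rewrite addr0 -[X in _ = X]scale1r.
    by rewrite -{1}[gr 0]scale1r -gr_lin ?mem0v// scale1r addr0 scale1r.
  by rewrite -[x]gr_eT eT0 gr00 eqxx.
move=> SU; have [A [B [C [AQ BQ CQ SE]]]] := split3 SU.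
have eT0 : eT 0 = 0 by exact: lin0.
have AU := subvP q0 _ AQ; have BU := subvP q' _ BQ.
by rewrite SE !linearD/= (h C)// !PE// gr0// gr'// eT0 !addr0.
Qed.

Lemma PD_Q1 T : T \in Q1 -> PD T = 0.
Proof. by move=> TQ; rewrite -[T]eT_gr_Q1. Qed.

Lemma PD_on_Q0 T : T \in Q0 -> PD T = 0.
Proof.
have [P PE] := hom_on PD_lin; have [q0 q' q1] := QU.
have [d0 d' d1 [d'1 d01 d0']] := directv3 dQ.
have UE : U = (Q0 + (Q' + Q1))%VS by rewrite addvA.
have PU S : S \in U -> P S \in U by move=> SU; rewrite PE ?PD_mem.
have Peq : equivariant G Jx act act U P.
  by move=> a ua w wU; rewrite !PE ?sU// PD_act.
have PP S : S \in U -> P (P S) = P S by move=> SU; rewrite !PE ?PD_mem ?PD_PD.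
have := idempotent_on_summand actD i0 i' i1 n0' n01 d0 d'1 (P := P).
rewrite -UE => /(_ PU Peq PP) [h|h] TQ; first by rewrite -PE ?h//; exact: (subvP q0).
by case: PD_Q0 => S SQ; rewrite -PE ?h//; exact: (subvP q0).
Qed.

Lemma PD_on_Q' T : T \in Q' -> PD T = T.
Proof.
have [P PE] := hom_on PD_lin; have [q0 q' q1] := QU.
have [d0 d' d1 [d'1 d01 d0']] := directv3 dQ.
have UE : U = (Q' + (Q0 + Q1))%VS by rewrite addvA (addvC Q').
have PU S : S \in U -> P S \in U by move=> SU; rewrite PE ?PD_mem.
have Peq : equivariant G Jx act act U P.
  by move=> a ua w wU; rewrite !PE ?sU// PD_act.
have PP S : S \in U -> P (P S) = P S by move=> SU; rewrite !PE ?PD_mem ?PD_PD.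
have n'0 : ~ module_iso G Jx act act Q' Q0 by move/(module_iso_sym s').
have := idempotent_on_summand actD i' i0 i1 n'0 n'1 d' d01 (P := P).
rewrite -UE => /(_ PU Peq PP) [h|h] TQ; last by rewrite -PE ?h//; exact: (subvP q').
case: PD_neq0 => S SU; have [A [B [C [AQ BQ CQ SE]]]] := split3 SU.
have AU := subvP q0 _ AQ; have CU := subvP q1 _ CQ.
by rewrite -PE// SE !linearD/= (h B)// addr0 !PE// PD_on_Q0// PD_Q1// addr0.
Qed.

Theorem components T : T \in U ->
  [/\ PD T \in Q', eT (gr T) \in Q1 & T - PD T - eT (gr T) \in Q0].
Proof.
move=> TU; have [A [B [C [AQ BQ CQ TE]]]] := split3 TU.
have [q0 q' q1] := QU.
have AU := subvP q0 _ AQ; have BU := subvP q' _ BQ; have CU := subvP q1 _ CQ.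
have PT : PD T = B.
  have [P PE] := hom_on PD_lin.
  rewrite -PE// TE !linearD/= !PE// PD_on_Q0// PD_on_Q'// PD_Q1//.
  by rewrite addr0 add0r.
have gT : eT (gr T) = C.
  have [P PE] := hom_on gr_lin.
  by rewrite -PE// TE !linearD/= !PE// gr0// gr'// !add0r eT_gr_Q1.
rewrite PT gT; split=> //; rewrite TE.
by have -> : A + B + C - B - C = A; rewrite // addrAC addrK addrK.
Qed.
End Abstract.

Section Linearity.
Variables (R : realType) (n : nat) (G Jx : 'M[R]_(n.*2)).
Local Notation E := 'rV[R]_(n.*2).
Local Notation J v := (v *m Jx).
Local Notation g := (bilin G).
Local Notation wJ := (wedgeJ G Jx).
Local Notation wJg := (wedgeJg G Jx).
Hypotheses (Gsym : G^T = G) (Gunit : G \in unitmx).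
Hypotheses (JJ : Jx *m Jx = - 1%:M) (GJ : forall u v, g (J u) (J v) = g u v).
Local Notation g_inj := (g_inj Gunit).

Lemma div_typeP k D D' : div_type G Jx D -> div_type G Jx D' ->
  div_type G Jx (fun x y => k *: D x y + D' x y).
Proof.
move=> [[D1 D2] u j s t] [[D1' D2'] u' j' s' t']; split.
- split=> [y|x]; apply: lin_add; try exact: lin_scale; done.
- by move=> x y z; rewrite !gDl !gZl u u' mulrN opprD.
- by move=> x y; rewrite j j' JD JZ.
- move=> x y; transitivity (k *: (D x y - D y x) + (D' x y - D' y x)); first by vring.
  rewrite s s' -JZ -JD; congr (J _).
  by vring.
- move=> x; transitivity (endo_trace (fun y => k *: (J (D x y)) + J (D' x y))).
    by apply: eq_trace => y; rewrite JD JZ.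
  by rewrite trD trZ t t' mulr0 addr0.
Qed.

Lemma embedP k D D' u v w z : lin2 D -> lin2 D' ->
  embed G Jx (fun x y => k *: D x y + D' x y) u v w z =
  k *: embed G Jx D u v w z + embed G Jx D' u v w z.
Proof.
move=> hD hD'.
have cE F : embed G Jx F u v w z = - (2 * (n%:R + 3))^-1 *:
   (wJg (hop Jx F u) v w z - (F (wJ v w u) z + wJ u (F w v - F v w) z)).
  by rewrite embed_psi /psi1f /psi2f scalerBr.
rewrite !cE.
have -> : wJg (hop Jx (fun x y => k *: D x y + D' x y) u) v w z =
  k *: wJg (hop Jx D u) v w z + wJg (hop Jx D' u) v w z.
  by rewrite -wedgeJg_lin0; apply: eq_wedgeJg => t; rewrite /hop JD JZ.
have -> : wJ u (k *: D w v + D' w v - (k *: D v w + D' v w)) z =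
  k *: wJ u (D w v - D v w) z + wJ u (D' w v - D' v w) z.
  rewrite -[RHS](@wedgeJ_lin2 R n G Jx u z); congr (wJ u _ z); vring.
move: (wJ u _ z) (wJ u _ z) (wJ v w u) => p q r.
by generalize wJg => W; vring.
Qed.

Lemma embedTP k v v' x y z w : embedT G Jx (k *: v + v') x y z w =
  k *: embedT G Jx v x y z w + embedT G Jx v' x y z w.
Proof. by rewrite /embedT -wedgeJg_lin0; apply: eq_wedgeJg => t; exact: Tf_linv. Qed.

Section Comb.
Variables (k : R) (S T ST : E -> E -> E -> E -> E).
Hypothesis STE : forall x y z w, ST x y z w = k *: S x y z w + T x y z w.
Hypotheses (hS : nabla_curv G Jx S) (hT : nabla_curv G Jx T) (hST : nabla_curv G Jx ST).

Lemma ricE_P x u : ricE G ST x u = k *: ricE G S x u + ricE G T x u.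
Proof.
apply: g_inj => v; rewrite gDl gZl !(@g_ricE R n G Jx Gunit)// /ricf -trZ -trD.
by apply: eq_trace => z; rewrite STE.
Qed.

Lemma gradfP : gradf G ST = k *: gradf G S + gradf G T.
Proof.
apply: g_inj => x; rewrite gDl gZl !(@g_gradf R n G Jx Gsym Gunit)// !(@dscalE R n G Jx Gsym Gunit)//.
by rewrite -trZ -trD; apply: eq_trace => u; rewrite ricE_P.
Qed.

Lemma tildefP z w : tildef G Jx ST z w = k *: tildef G Jx S z w + tildef G Jx T z w.
Proof.
rewrite !(tildeE Gsym Gunit JJ GJ)// ricE_P gradfP JD JZ.
rewrite (@wedgeJg_lin1 R n G Jx _ z w (@half_lin R n)).
by generalize wJg => W; vring.
Qed.
End Comb.
End Linearity.

Section Decomposition.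
Variables (R : realType) (n : nat) (G Jx : 'M[R]_(n.*2)).
Local Notation E := 'rV[R]_(n.*2).
Local Notation J v := (v *m Jx).
Local Notation g := (bilin G).
Hypotheses (Gsym : G^T = G) (Gunit : G \in unitmx).
Hypotheses (JJ : Jx *m Jx = - 1%:M) (GJ : forall u v, g (J u) (J v) = g u v).

(* [V] is [tensor5 R n], kept abstract because its vector space structure is
   expensive to unify; [tf] and [mk] convert to and from functions. *)
Variables (V : vectType R) (act : 'End(E) -> V -> V).
Variables (tf : V -> E -> E -> E -> E -> E) (mk : (E -> E -> E -> E -> E) -> V).
Hypothesis actD : forall a, {morph act a : u v / u + v}.
Hypothesis tf_lin : forall k S T x y z w,
  tf (k *: S + T) x y z w = k *: tf S x y z w + tf T x y z w.
Hypothesis tf_mk : forall f, lin4 f -> tf (mk f) = f.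
Hypothesis tf_inj : forall S T, (forall x y z w, tf S x y z w = tf T x y z w) -> S = T.
Hypothesis tf_act : forall a T, tf (act a T) = actf4 a (tf T).

Variable U : {vspace V}.
Hypothesis memU : forall T, T \in U <-> nabla_curv G Jx (tf T).
Local Notation tdf T := (tildef G Jx (tf T)).
Local Notation grf T := (gradf G (tf T)).

Definition projD (T : V) : V := mk (embed G Jx (tdf T)).
Definition eT (v : E) : V := mk (embedT G Jx v).
Fact hm_key : unit. Proof. exact: tt. Qed.
Definition hm : V -> 'Hom(E, 'End(E)) := locked_with hm_key
  (fun T => hom2 (hol Jx (tdf T))).

Let memU1 T : T \in U -> nabla_curv G Jx (tf T). Proof. by case: (memU T). Qed.
Let memU2 T : nabla_curv G Jx (tf T) -> T \in U. Proof. by case: (memU T). Qed.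

Lemma tdf_div T : T \in U -> div_type G Jx (tdf T).
Proof. by move=> /memU1; exact: (tilde_div_type Gsym Gunit JJ GJ). Qed.

Let nce D : div_type G Jx D -> nabla_curv G Jx (embed G Jx D).
Proof. exact: (embed_nabla_curv Gsym Gunit JJ GJ). Qed.

Let nct v : nabla_curv G Jx (embedT G Jx v).
Proof. exact: (embedT_nabla_curv Gsym Gunit JJ GJ). Qed.

Lemma embed_mem D : div_type G Jx D -> mk (embed G Jx D) \in U.
Proof. by move=> /nce h; apply: memU2; rewrite tf_mk//; exact: nc_lin h. Qed.

Lemma eT_mem v : eT v \in U.
Proof. by apply: memU2; rewrite tf_mk//; exact: nc_lin (nct v). Qed.

Lemma tdf_embed D : div_type G Jx D -> tdf (mk (embed G Jx D)) = D.
Proof.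
move=> hD; rewrite tf_mk; last exact: nc_lin (nce hD).
by apply/funext => x; apply/funext => y; exact: tilde_embed.
Qed.

Lemma tdf_eT v : tdf (eT v) = fun _ _ => 0.
Proof.
rewrite tf_mk; last exact: nc_lin (nct v).
by apply/funext => x; apply/funext => y; exact: tilde_embedT.
Qed.

Lemma grf_eT v : grf (eT v) = v.
Proof. by rewrite tf_mk; [exact: grad_embedT|exact: nc_lin (nct v)]. Qed.

Let mem_comb k S T : S \in U -> T \in U -> k *: S + T \in U.
Proof. by move=> SU TU; rewrite memvD// memvZ. Qed.

Lemma grf_lin k S T : S \in U -> T \in U -> grf (k *: S + T) = k *: grf S + grf T.
Proof.
move=> SU TU; apply: (gradfP Gsym Gunit (tf_lin k S T) (memU1 SU) (memU1 TU)).
exact: memU1 (mem_comb k SU TU).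
Qed.

Lemma tdf_lin k S T : S \in U -> T \in U ->
  tdf (k *: S + T) = fun x y => k *: tdf S x y + tdf T x y.
Proof.
move=> SU TU; apply/funext => x; apply/funext => y.
apply: (tildefP Gsym Gunit JJ GJ (tf_lin k S T) (memU1 SU) (memU1 TU)).
exact: memU1 (mem_comb k SU TU).
Qed.

Lemma eT_lin : lin eT.
Proof.
move=> k v w; apply: tf_inj => x y z t; rewrite tf_lin !tf_mk ?embedTP//;
  exact: nc_lin (nct _).
Qed.

Lemma projD_lin k S T : S \in U -> T \in U ->
  projD (k *: S + T) = k *: projD S + projD T.
Proof.
move=> SU TU; rewrite /projD tdf_lin//.
have hS := tdf_div SU; have hT := tdf_div TU.
apply: tf_inj => x y z t; rewrite tf_lin !tf_mk.
- by apply: embedP; [exact: dt_lin hS|exact: dt_lin hT].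
- exact: nc_lin (nce hT).
- exact: nc_lin (nce hS).
- exact: nc_lin (nce (div_typeP k hS hT)).
Qed.

Hypothesis sU : submodule G Jx act U.

Lemma tdf_act a T : in_u G Jx a -> T \in U -> tdf (act a T) = actf2 a (tdf T).
Proof.
move=> ua TU; have := memU1 (sU ua TU); rewrite tf_act => h.
apply/funext => x; apply/funext => y.
exact: (tilde_act Gsym Gunit JJ GJ ua (memU1 TU) h).
Qed.

Lemma grf_act : equivariant G Jx act (@act_vec R n) U (fun T => grf T).
Proof.
move=> a ua T TU; have := memU1 (sU ua TU); rewrite tf_act => h.
exact: (grad_act Gsym Gunit ua (memU1 TU) h).
Qed.

Lemma projD_act : equivariant G Jx act act U projD.
Proof.
move=> a ua T TU; have hD := tdf_div TU; have hD' := tdf_div (sU ua TU).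
rewrite (tdf_act ua TU) in hD'.
rewrite /projD tdf_act//; apply: tf_inj => x y z w; rewrite tf_act.
rewrite !tf_mk ?(embed_act ua)//; first exact: nc_lin (nce hD).
exact: nc_lin (nce hD').
Qed.

Lemma eT_act a v : in_u G Jx a -> eT (a v) = act a (eT v).
Proof.
move=> ua; apply: tf_inj => x y z w; rewrite tf_act.
rewrite !tf_mk ?(embedT_act JJ ua)//; exact: nc_lin (nct _).
Qed.

Lemma projD_mem T : T \in U -> projD T \in U.
Proof. by move=> TU; exact: embed_mem (tdf_div TU). Qed.

Lemma projD_id T : T \in U -> projD (projD T) = projD T.
Proof. by move=> TU; rewrite {1}/projD tdf_embed//; exact: tdf_div. Qed.

Lemma mk_0 (F : E -> E -> E -> E -> E) : (forall x y z w, F x y z w = 0) -> mk F = 0.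
Proof.
move=> F0; apply: tf_inj => x y z w; rewrite tf_mk ?F0; first symmetry.
  have := tf_lin (-1) 0 0 x y z w; rewrite scaler0 addr0 => ->.
  by rewrite scaleN1r addNr.
by split=> *; move=> k a b; rewrite !F0 scaler0 addr0.
Qed.

Lemma embed_0 D x y z w : (forall a b, D a b = 0) -> embed G Jx D x y z w = 0.
Proof.
move=> D0; have l0 : lin2 D by split=> *; move=> k a b; rewrite !D0 scaler0 addr0.
have := embedP G Jx (-1) x y z w l0 l0; rewrite scaleN1r addNr => <-.
congr (embed G Jx _ x y z w); apply/funext => a; apply/funext => b.
by rewrite D0 scaler0 addr0.
Qed.

Lemma projD_eT v : projD (eT v) = 0.
Proof. by apply: mk_0 => x y z w; rewrite tdf_eT; exact: embed_0. Qed.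

Lemma projD_neq0 : (2 <= n)%N -> ~ (forall T, T \in U -> projD T = 0).
Proof.
move=> n2 h; have [D hD D0] := exists_div_type Gsym Gunit JJ GJ n2.
apply: D0 => x y; rewrite -(tdf_embed hD).
have e : mk (embed G Jx D) = 0.
  by rewrite -(h _ (embed_mem hD)) /projD tdf_embed.
have := congr1 (fun F => F x y) (tdf_lin (-1) (mem0v U) (mem0v U)).
by rewrite /= scaler0 addr0 scaleN1r addNr e.
Qed.

Lemma tdf_of_hol T : T \in U -> (forall x y, hol Jx (tdf T) x y = 0) -> projD T = 0.
Proof.
move=> TU h; have hD := tdf_div TU; apply: mk_0 => x y z w; apply: embed_0 => a b.
by apply: (g_inj Gunit) => q; rewrite (g_D JJ GJ hD) /be !h !g0l subrr.
Qed.

Lemma hol_lin2 D : div_type G Jx D -> lin2 (hol Jx D).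
Proof. by move=> hD; split=> [y|x]; [exact: hol_lin1 hD y|exact: lin_hol2 hD x]. Qed.

Lemma hmE T x y : T \in U -> hm T x y = hol Jx (tdf T) x y.
Proof. by move=> /tdf_div/hol_lin2 l; rewrite /hm locked_withE; exact: hom2E l. Qed.

Lemma hm_tracefree T : T \in U -> tracefree_sym Jx (hm T).
Proof.
move=> TU; have hD := tdf_div TU; split.
- by move=> x y; rewrite (hmE x y TU) (hmE y x TU) (holC hD).
- by move=> x y; rewrite (hmE _ y TU) (hmE x y TU) (hol_Jl JJ hD).
- move=> x; split.
    rewrite -[RHS](tr_hol Gsym Gunit hD x); apply: eq_trace => y; exact: hmE.
  rewrite -[RHS](tr_hol Gsym Gunit hD (J x)); apply: eq_trace => y.
  by rewrite (hmE x y TU) (hol_Jl JJ hD).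
Qed.

Lemma hm_lin k S T : S \in U -> T \in U -> hm (k *: S + T) = k *: hm S + hm T.
Proof.
move=> SU TU; apply/lfunP => x; apply/lfunP => y.
rewrite (hmE x y (mem_comb k SU TU)) tdf_lin//.
have -> : (k *: hm S + hm T) x y = k *: hm S x y + hm T x y.
  by rewrite add_lfunE scale_lfunE add_lfunE scale_lfunE.
rewrite (hmE x y SU) (hmE x y TU) /hol JD JZ; vring.
Qed.

Lemma hm_act : equivariant G Jx act (@act_bil R n) U hm.
Proof.
move=> a ua T TU; apply/lfunP => x; apply/lfunP => y; rewrite act_bilE.
rewrite (hmE x y (sU ua TU)) (hmE x y TU) (hmE x _ TU) (hmE _ y TU) tdf_act//.
by rewrite (hol_act ua) /actf2; vring.
Qed.

Lemma hm_eq0 T : T \in U -> hm T = 0 -> projD T = 0.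
Proof.
move=> TU h; apply: tdf_of_hol => // x y.
by rewrite -(hmE x y TU) h zero_lfunE zero_lfunE.
Qed.

Lemma projD_not_id (Q0 Q' Q1 : {vspace V}) : (2 <= n)%N -> U = (Q0 + Q' + Q1)%VS ->
  irreducible G Jx act Q0 -> irreducible G Jx act Q' ->
  irreducible G Jx act Q1 -> ~ module_iso G Jx act act Q0 Q' ->
  ((3 <= n)%N -> exists2 W : {vspace 'Hom(E, 'End(E))},
     (forall b, b \in W <-> tracefree_sym Jx b) &
     module_iso G Jx act (@act_bil R n) Q' W) ->
  (n = 2%N -> \dim Q0 = 12%N) ->
  ~ (forall T, T \in Q0 -> projD T = T).
Proof.
move=> n2 UE i0 i' i1 n0' ge3 eq2; move: n2; rewrite leq_eqVlt => /orP[/eqP/esym n2|n3].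
  have [u [v bX]] := complex_basis JJ n2.
  pose f T : 'M[R]_(1 + 1, n.*2) := col_mx (hol Jx (tdf T) u u) (hol Jx (tdf T) v v).
  apply: (not_id_of_dim (Q' := Q') (Q1 := Q1) (f := f)) => //.
  - by rewrite eq2// dimvf /dim /= n2.
  - move=> k S T; rewrite -UE => SU TU; rewrite /f tdf_lin// scale_col_mx add_col_mx.
    by congr col_mx; rewrite /hol JD JZ; vring.
  - move=> T; rewrite -UE => TU /eqP; rewrite col_mx_eq0 => /andP[/eqP hu /eqP hv].
    have hD := tdf_div TU; apply: tdf_of_hol => //.
    apply: (bilinear_traceless_eq0 JJ bX _ _ _ _ _ hu hv).
    + exact: (holC hD).
    + exact: (lin_hol2 hD).
    + exact: (hol_Jr JJ hD).
    + exact: (tr_hol Gsym Gunit hD).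
    + move=> x; rewrite -[RHS](tr_hol Gsym Gunit hD (J x)); apply: eq_trace => y.
      by rewrite (hol_Jl JJ hD).
have [W WE isoW] := ge3 n3.
have act0 a : @act_bil R n a 0 = 0 by exact: (lin0 (@hom_act_lin2 R n a)).
have mW T : T \in (Q0 + Q' + Q1)%VS -> hm T \in W.
  by rewrite -UE => TU; apply/WE; exact: hm_tracefree.
apply: (not_id_of_iso actD i0 i' i1 n0' act0 isoW _ mW); rewrite -UE.
- exact: hm_lin.
- exact: hm_act.
- exact: hm_eq0.
Qed.

Lemma components_mem (Q0 Q' Q1 : {vspace V}) S : (2 <= n)%N ->
  U = (Q0 + Q' + Q1)%VS -> directv (Q0 + Q' + Q1) ->
  irreducible G Jx act Q0 -> irreducible G Jx act Q' -> irreducible G Jx act Q1 ->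
  ~ module_iso G Jx act act Q0 Q' -> ~ module_iso G Jx act act Q0 Q1 ->
  ~ module_iso G Jx act act Q' Q1 ->
  module_iso G Jx act (@act_vec R n) Q1 fullv ->
  ((3 <= n)%N -> exists2 W : {vspace 'Hom(E, 'End(E))},
     (forall b, b \in W <-> tracefree_sym Jx b) &
     module_iso G Jx act (@act_bil R n) Q' W) ->
  (n = 2%N -> \dim Q0 = 12%N) -> nabla_curv G Jx S ->
  [/\ exists2 T, T \in Q0 & forall x y z w, tf T x y z w =
        S x y z w - embed G Jx (tildef G Jx S) x y z w - embedT G Jx (gradf G S) x y z w,
      exists2 T, T \in Q' & tf T = embed G Jx (tildef G Jx S) &
      exists2 T, T \in Q1 & tf T = embedT G Jx (gradf G S)].
Proof.
move=> n2 UE dQ i0 i' i1 n0' n01 n'1 iso1 ge3 eq2 hS.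
have tS : tf (mk S) = S by rewrite tf_mk//; exact: nc_lin hS.
have SU : mk S \in U by apply: memU2; rewrite tS.
have E0 : exists v : E, v != 0.
  by have [v [_ [? _ _ _]]] := orthogonal_pair JJ GJ n2; exists v.
have not_id := projD_not_id n2 UE i0 i' i1 n0' ge3 eq2.
have hD : div_type G Jx (tildef G Jx S) by exact: (tilde_div_type Gsym Gunit JJ GJ hS).
have tD : tf (projD (mk S)) = embed G Jx (tildef G Jx S).
  by rewrite /projD tS tf_mk//; exact: nc_lin (nce hD).
have tT : tf (eT (grf (mk S))) = embedT G Jx (gradf G S).
  by rewrite tS /eT tf_mk//; exact: nc_lin (nct _).
have lg := grf_lin; have lD := projD_lin; have me := eT_mem; have mD := projD_mem.
have ag := grf_act; have aD := projD_act; have nD := projD_neq0 n2; have pp := projD_id.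
rewrite UE in SU lg lD me mD ag aD nD pp.
have [m' m1 m0] := components actD dQ i0 i' i1 n0' n01 n'1 iso1 E0 lg ag eT_lin me
  eT_act grf_eT lD mD aD pp projD_eT nD not_id SU.
split; [exists (mk S - projD (mk S) - eT (grf (mk S))) => // x y z w
       |by exists (projD (mk S)) | by exists (eT (grf (mk S)))].
have tB A B x' y' z' w' : tf (A - B) x' y' z' w' = tf A x' y' z' w' - tf B x' y' z' w'.
  by rewrite addrC -scaleN1r tf_lin scaleN1r addrC.
by rewrite 2!tB tT tD tS.
Qed.
End Decomposition.

Section Instance.
Variables (R : realType) (n : nat) (G Jx : 'M[R]_(n.*2)).
Hypotheses (Gsym : G^T = G) (Gunit : G \in unitmx).
Hypotheses (JJ : Jx *m Jx = - 1%:M).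
Hypotheses (GJ : forall u v, bilin G (u *m Jx) (v *m Jx) = bilin G u v).

Lemma nabla_decomposition_mem (Q0 Q' Q1 : {vspace tensor5 R n}) S :
  (2 <= n)%N -> nabla_decomposition G Jx Q0 Q' Q1 -> nabla_curv G Jx S ->
  [/\ tensor_in Q0 (fun x y z w => S x y z w - embed G Jx (tildef G Jx S) x y z w
                                   - embedT G Jx (gradf G S) x y z w),
      tensor_in Q' (embed G Jx (tildef G Jx S)) &
      tensor_in Q1 (embedT G Jx (gradf G S))].
Proof.
move=> n2 hQ hS.
have memU T : T \in (Q0 + Q' + Q1)%VS <-> nabla_curv G Jx (tfun T).
  exact: iff_trans (dec_sum hQ T) (nabla_curvP _ Gsym T).
have aD a := linD (@act_lin R n a).
have sU : submodule G Jx (@act_tensor5 R n) (Q0 + Q' + Q1)%VS.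
  exact: (irreducible_submoduleD aD (dec_irr0 hQ) (dec_irr' hQ) (dec_irr1 hQ)).
have ge3 : (3 <= n)%N -> exists2 W : {vspace 'Hom('rV[R]_(n.*2), 'End('rV[R]_(n.*2)))},
     (forall b, b \in W <-> tracefree_sym Jx b) &
     module_iso G Jx (@act_tensor5 R n) (@act_bil R n) Q' W.
  by move=> n3; have [_ _ h] := dec_ge3 hQ n3; exact: h.
have eq2 : n = 2%N -> \dim Q0 = 12%N.
  by move=> /(dec_eq2 hQ)[[_ ->]].
have [[T0 m0 e0] [T' m' e'] [T1 m1 e1]] := components_mem Gsym Gunit JJ GJ aD
  (@tfunP R n) (@tfun_hom4 R n) (@tfun_inj R n) (@tfun_act R n) memU sU n2 erefl
  (dec_direct hQ) (dec_irr0 hQ) (dec_irr' hQ) (dec_irr1 hQ) (dec_niso0' hQ)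
  (dec_niso01 hQ) (dec_niso'1 hQ) (dec_vec hQ) ge3 eq2 hS.
split; [by exists T0 | exists T' => // x y z w | exists T1 => // x y z w].
  by rewrite -e'.
by rewrite -e1.
Qed.
End Instance.

(** * Calculus on open sets *)

Import numFieldNormedType.Exports.
Local Open Scope classical_set_scope.
Local Open Scope ring_scope.

Section Calculus.
Variables (R : realType) (m : nat).
Local Notation E := 'rV[R]_m.
Implicit Types (f : E -> R) (x u v : E).

Lemma is_derive_line f x u (s : R) : derivable f (s *: u + x) u ->
  is_derive s 1 (fun r : R => f (r *: u + x)) ('D_u f (s *: u + x)).
Proof.
move=> df; have e : (fun h : R => h^-1 *: (((fun r : R => f (r *: u + x)) \o shift s) (h *: 1) -
    f (s *: u + x))) = (fun h : R => h^-1 *: ((f \o shift (s *: u + x)) (h *: u) - f (s *: u + x))).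
  by apply/funext => h /=; rewrite [h *: 1]mulr1 scalerDl addrA.
by split; rewrite /derivable /derive e.
Qed.

Lemma mvt_line f x u (h : R) :
  (forall s : R, `|s| <= `|h| -> derivable f (s *: u + x) u) ->
  exists2 s : R, `|s| <= `|h| & f (h *: u + x) - f x = h * 'D_u f (s *: u + x).
Proof.
move=> df; have dl (s : R) : `|s| <= `|h| -> is_derive s 1 (fun r : R => f (r *: u + x)) ('D_u f (s *: u + x)).
  by move=> /df; exact: is_derive_line.
have cont (a b : R) : (forall s : R, s \in `[a, b]%R -> `|s| <= `|h|) ->
    {within `[a, b], continuous (fun r : R => f (r *: u + x))}.
  move=> ab; apply: derivable_within_continuous => s sab.
  by have [] := dl s (ab _ sab).
have [h0|h0|->] := ltgtP h 0.
- have hh (s : R) : s \in `[h, 0]%R -> `|s| <= `|h|.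
    by rewrite in_itv/= => /andP[hs s0]; rewrite (ltr0_norm h0) ler0_norm// lerN2.
  have [s sh e] := MVT h0 (fun (s : R) sh => dl s (hh s (subset_itv_oo_cc sh))) (cont _ _ hh).
  exists s; first by apply: hh; exact: subset_itv_oo_cc.
  move: e; rewrite scale0r add0r => e.
  by rewrite -opprB e sub0r mulrN opprK mulrC.
- have hh (s : R) : s \in `[0, h]%R -> `|s| <= `|h|.
    by rewrite in_itv/= => /andP[s0 sh]; rewrite (gtr0_norm h0) ger0_norm.
  have [s sh e] := MVT h0 (fun (s : R) sh => dl s (hh s (subset_itv_oo_cc sh))) (cont _ _ hh).
  exists s; first by apply: hh; exact: subset_itv_oo_cc.
  by move: e; rewrite scale0r add0r subr0 mulrC.
- by exists 0 => //; rewrite scale0r add0r subrr mul0r.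
Qed.

Lemma is_derive_dirD f x u v :
  (\forall y \near x, derivable f y u) -> {for x, continuous (fun y => 'D_u f y)} ->
  derivable f x v -> is_derive x (u + v) f ('D_u f x + 'D_v f x).
Proof.
move=> du cu dv.
suff cv : (fun h : R => h^-1 *: ((f \o shift x) (h *: (u + v)) - f x)) @ 0^' -->
    'D_u f x + 'D_v f x.
  split; first by apply/cvg_ex; exists ('D_u f x + 'D_v f x).
  exact: cvg_lim cv.
have -> : (fun h : R => h^-1 *: ((f \o shift x) (h *: (u + v)) - f x)) =
   (fun h : R => h^-1 *: (f (h *: u + (h *: v + x)) - f (h *: v + x))) +
   (fun h : R => h^-1 *: ((f \o shift x) (h *: v) - f x)).
  apply/funext => h /=; rewrite -[RHS]scalerDr; congr (_ *: _).
  by rewrite scalerDr -[h *: u + _ + x]addrA subrKA.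
apply: (cvgD _ dv).
apply/cvgrPdist_le => /= e e0.
have : \forall y \near x, derivable f y u /\ `|'D_u f x - 'D_u f y| <= e.
  near=> y; split; first by near: y.
  by near: y; move/cvgrPdist_le : cu; exact.
case/nbhs_ballP => d /= d0 hd.
have c0 : 0 < `|u| + `|v| + 1 by rewrite ltr_wpDl// addr_ge0.
near=> h.
have small (s : R) : `|s| <= `|h| -> ball x d (s *: u + (h *: v + x)).
  move=> sh; rewrite -ball_normE/= addrA opprD addrCA subrr addr0 normrN.
  rewrite (le_lt_trans (ler_normD _ _))// !normrZ.
  have : `|s| * `|u| + `|h| * `|v| <= `|h| * (`|u| + `|v| + 1).
    by rewrite !mulrDr mulr1 -addrA lerD ?ler_wpM2r// lerDl.
  move/le_lt_trans; apply; rewrite -ltr_pdivlMr//.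
  near: h; apply: dnbhs0_lt; exact: divr_gt0.
have h0 : h != 0 by near: h; exact: nbhs_dnbhs_neq.
have [s sh ->] := @mvt_line f (h *: v + x) u h (fun s sh => (hd _ (small s sh)).1).
rewrite [_ *: _]mulrA mulVf// mul1r.
exact: (hd _ (small s sh)).2.
Unshelve. all: by end_near. Qed.

Lemma is_derive_dirZ f x u (c : R) : derivable f x u ->
  is_derive x (c *: u) f (c * 'D_u f x).
Proof.
move=> du; have := @is_derive_line f x u 0; rewrite scale0r add0r => /(_ du) d1.
have [->|c0] := eqVneq c 0.
  by rewrite scale0r mul0r; exact: is_derive0.
suff cv : (fun h : R => h^-1 *: ((f \o shift x) (h *: (c *: u)) - f x)) @ 0^' --> c * 'D_u f x.
  split; first by apply/cvg_ex; exists (c * 'D_u f x).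
  exact: cvg_lim cv.
have -> : (fun h : R => h^-1 *: ((f \o shift x) (h *: (c *: u)) - f x)) =
    (fun h => c * ((fun k : R => k^-1 *: ((f \o shift x) (k *: u) - f x)) \o ( *%R c)) h).
  apply/funext => h /=; rewrite scalerA (mulrC h c); set d := f _ - f x.
  by rewrite -[LHS]/(h^-1 * d) -[_ *: d]/((c * h)^-1 * d) invfM mulrA mulrA mulfV// mul1r.
apply: cvgMr; apply: cvg_comp du => P /nbhs_ballP[e /= e0 hP].
apply/nbhs_ballP; exists (e / `|c|) => /=; first by rewrite divr_gt0// normr_gt0.
move=> h; rewrite -ball_normE/= sub0r normrN => he h0; apply: hP; last by rewrite mulf_neq0.
by rewrite -ball_normE/= sub0r normrN normrM mulrC -ltr_pdivlMr// normr_gt0.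
Qed.

Lemma is_derive_translate f x w u : derivable f (w + x) u ->
  is_derive x u (fun y => f (w + y)) ('D_u f (w + x)).
Proof.
move=> df; have e : (fun h : R => h^-1 *: (((fun y => f (w + y)) \o shift x) (h *: u) -
    f (w + x))) = (fun h : R => h^-1 *: ((f \o shift (w + x)) (h *: u) - f (w + x))).
  by apply/funext => h /=; rewrite addrCA.
by split; rewrite /derivable /derive e.
Qed.

Lemma second_difference f x u v (h : R) :
  (forall s t : R, `|s| <= `|h| -> `|t| <= `|h| ->
     derivable f (t *: v + (s *: u + x)) u /\
     derivable (fun y => 'D_u f y) (t *: v + (s *: u + x)) v) ->
  exists s t : R, [/\ `|s| <= `|h|, `|t| <= `|h| &
    f (h *: v + (h *: u + x)) - f (h *: u + x) - (f (h *: v + x) - f x) =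
    h * (h * 'D_v (fun y => 'D_u f y) (t *: v + (s *: u + x)))].
Proof.
move=> df; pose F y := f (h *: v + y) - f y.
have n0h : `|0 : R| <= `|h| by rewrite normr0.
have hh : `|h| <= `|h| by [].
have dF (s : R) : `|s| <= `|h| -> is_derive (s *: u + x) u F
    ('D_u f (h *: v + (s *: u + x)) - 'D_u f (s *: u + x)).
  move=> sh; apply: is_deriveB.
    by apply: is_derive_translate; exact: (df s h sh hh).1.
  by apply: derivableP; have := (df s 0 sh n0h).1; rewrite scale0r add0r.
have dF1 (s : R) : `|s| <= `|h| -> derivable F (s *: u + x) u by move=> /dF[].
have [s sh e1] := mvt_line dF1.
have [t th e2] := @mvt_line (fun y => 'D_u f y) (s *: u + x) v h
   (fun (t : R) th => (df s t sh th).2).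
exists s, t; split=> //; rewrite -e2.
by have -> : 'D_u f (h *: v + (s *: u + x)) - 'D_u f (s *: u + x) = 'D_u F (s *: u + x)
  by case: (dF s sh).
Qed.

Lemma schwarz f x u v :
  (\forall y \near x, derivable f y u) -> (\forall y \near x, derivable f y v) ->
  (\forall y \near x, derivable (fun y => 'D_u f y) y v) ->
  (\forall y \near x, derivable (fun y => 'D_v f y) y u) ->
  {for x, continuous (fun y => 'D_v (fun y => 'D_u f y) y)} ->
  {for x, continuous (fun y => 'D_u (fun y => 'D_v f y) y)} ->
  'D_v (fun y => 'D_u f y) x = 'D_u (fun y => 'D_v f y) x.
Proof.
move=> du dv duv dvu cuv cvu.
apply/eqP; rewrite -subr_eq0 -normr_le0; apply/ler_addgt0Pr => e e0; rewrite add0r.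
have e20 : 0 < e / 2 by rewrite divr_gt0.
have : \forall y \near x, [/\ derivable f y u, derivable f y v,
    derivable (fun y => 'D_u f y) y v /\ derivable (fun y => 'D_v f y) y u,
    `|'D_v (fun y => 'D_u f y) x - 'D_v (fun y => 'D_u f y) y| <= e / 2 &
    `|'D_u (fun y => 'D_v f y) x - 'D_u (fun y => 'D_v f y) y| <= e / 2].
  have h1 : \forall y \near x, `|'D_v (fun y => 'D_u f y) x - 'D_v (fun y => 'D_u f y) y| <= e / 2.
    by move/cvgrPdist_le : cuv; apply.
  have h2 : \forall y \near x, `|'D_u (fun y => 'D_v f y) x - 'D_u (fun y => 'D_v f y) y| <= e / 2.
    by move/cvgrPdist_le : cvu; apply.
  apply: filterS (filterI (filterI du dv) (filterI (filterI duv dvu) (filterI h1 h2))).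
  by move=> y [[? ?] [[? ?] [? ?]]].
case/nbhs_ballP => d /= d0 hd.
have c0 : 0 < `|u| + `|v| + 1 by rewrite ltr_wpDl// addr_ge0.
pose h := d / 2 / (`|u| + `|v| + 1).
have h0 : 0 < h by rewrite !divr_gt0.
have small (s t : R) : `|s| <= `|h| -> `|t| <= `|h| -> ball x d (s *: u + (t *: v + x)).
  move=> sh th; rewrite -ball_normE/= addrA opprD addrCA subrr addr0 normrN.
  rewrite (le_lt_trans (ler_normD _ _))// !normrZ.
  have : `|s| * `|u| + `|t| * `|v| <= `|h| * (`|u| + `|v| + 1).
    by rewrite !mulrDr mulr1 -addrA lerD ?ler_wpM2r// (le_trans (ler_wpM2r _ th))// lerDl.
  move/le_lt_trans; apply; rewrite gtr0_norm// /h mulfVK ?gt_eqF//.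
  by rewrite ltr_pdivrMr// ltr_pMr// ltr1n.
have hn0 : h != 0 by rewrite gt_eqF.
have [s [t [sh th e1]]] := @second_difference f x v u h (fun s t sh th =>
  let: And5 _ dv' (conj _ dvu') _ _ := hd _ (small t s th sh) in conj dv' dvu').
have small' (s' t' : R) : `|s'| <= `|h| -> `|t'| <= `|h| -> ball x d (t' *: v + (s' *: u + x)).
  by move=> sh' th'; rewrite addrCA; exact: small.
have [s2 [t2 [sh2 th2 e2]]] := @second_difference f x u v h (fun s t sh th =>
  let: And5 du' _ (conj duv' _) _ _ := hd _ (small' s t sh th) in conj du' duv').
have [_ _ _ b1 _] := hd _ (small' _ _ sh2 th2); have [_ _ _ _ b2] := hd _ (small _ _ th sh).
have e12 : 'D_v (fun y => 'D_u f y) (t2 *: v + (s2 *: u + x)) =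
           'D_u (fun y => 'D_v f y) (t *: u + (s *: v + x)).
  apply: (mulfI hn0); apply: (mulfI hn0); rewrite -[LHS]e2 -[RHS]e1.
  rewrite (addrCA (h *: v)).
  by move: (f (h *: u + (h *: v + x))) (f (h *: v + x)) (f (h *: u + x)) (f x) => *; ring.
rewrite -(subrKA ('D_v (fun y => 'D_u f y) (t2 *: v + (s2 *: u + x)))) (splitr e).
apply: le_trans (ler_normD _ _) _; apply: lerD; first exact: b1.
by rewrite e12 distrC; exact: b2.
Qed.

End Calculus.

Section Smoothness.
Variables (R : realType) (m : nat) (U : set 'rV[R]_m).
Hypothesis oU : open U.
Local Notation E := 'rV[R]_m.
Implicit Types (f h : E -> R) (x u v : E).
Local Notation e i := (delta_mx 0 i : E).

Lemma near_U x (P : E -> Prop) : U x -> (forall y, U y -> P y) -> \forall y \near x, P y.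
Proof. by move=> Ux UP; apply: filterS UP _; exact: open_nbhs_nbhs. Qed.

Lemma eqU_derive f h x u : U x -> (forall y, U y -> f y = h y) -> 'D_u f x = 'D_u h x.
Proof. by move=> Ux fh; apply: near_eq_derive; exact: near_U. Qed.

Lemma eqU_derivable f h x u : U x -> (forall y, U y -> f y = h y) ->
  derivable f x u -> derivable h x u.
Proof. by move=> Ux fh; apply: near_eq_derivable; exact: near_U. Qed.

Lemma eqU_continuous f h x : U x -> (forall y, U y -> f y = h y) ->
  {for x, continuous f} -> {for x, continuous h}.
Proof.
move=> Ux fh cf; rewrite /prop_for/continuous_at -(fh _ Ux).
have fhx : \forall y \near x, f y = h y by exact: (near_U Ux fh).
exact: cvg_trans (near_eq_cvg fhx) cf.
Qed.

Lemma iter_partial_eqU s f h : (forall y, U y -> f y = h y) ->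
  forall x, U x -> iter_partial s f x = iter_partial s h x.
Proof.
elim: s f h => [|i s IH] f h fh x Ux; first exact: fh.
by apply: IH => // y Uy; exact: eqU_derive.
Qed.

Lemma smooth_eqU f h : (forall y, U y -> f y = h y) -> smooth_on U f -> smooth_on U h.
Proof.
move=> fh sf s x Ux; have [c d] := sf s x Ux.
have e y : U y -> iter_partial s f y = iter_partial s h y by exact: iter_partial_eqU.
split; first exact: eqU_continuous e c.
by move=> i; apply: eqU_derivable e (d i).
Qed.

Lemma smooth_partial f i : smooth_on U f -> smooth_on U (fun x => 'D_(e i) f x).
Proof. by move=> sf s x Ux; have := sf (i :: s) x Ux. Qed.

Lemma iter_partialP k f h s x : smooth_on U f -> smooth_on U h -> U x ->
  iter_partial s (fun y => k * f y + h y) x = k * iter_partial s f x + iter_partial s h x.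
Proof.
elim: s f h x => [//|i s IH] f h x sf sh Ux /=.
rewrite -(IH _ _ _ (smooth_partial i sf) (smooth_partial i sh) Ux).
apply: iter_partial_eqU => // y Uy.
have [_ df] := sf [::] y Uy; have [_ dh] := sh [::] y Uy.
have dk : derivable (fun y => k * f y) y (e i) by exact: derivableZ (df i).
have := deriveD dk (dh i) => /= ->; congr (_ + _).
exact: (deriveZ (f := f) _ (df i)).
Qed.

Lemma smoothP k f h : smooth_on U f -> smooth_on U h -> smooth_on U (fun y => k * f y + h y).
Proof.
move=> sf sh s x Ux; have [cf df] := sf s x Ux; have [ch dh] := sh s x Ux.
have e y : U y -> k * iter_partial s f y + iter_partial s h y =
    iter_partial s (fun y => k * f y + h y) y by move=> Uy; rewrite iter_partialP.
split.
  apply: eqU_continuous e _ => //.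
  by apply: continuousD; [apply: continuousM => //; exact: cst_continuous|].
move=> i; apply: eqU_derivable e _ => //; apply: derivableD => //.
exact: derivableZ.
Qed.

Lemma smooth_cst (c : R) : smooth_on U (fun=> c).
Proof.
have it s d : exists d', forall x, iter_partial s (fun=> d) x = d'.
  elim: s d => [|i s IH] d; first by exists d.
  have [d' hd'] := IH 0; exists d' => x /=; rewrite -(hd' x).
  congr (iter_partial s _ x); apply/funext => y; exact: derive_cst.
move=> s x Ux; have [d' hd'] := it s c.
have -> : iter_partial s (fun=> c) = fun=> d' by apply/funext.
by split; [exact: cst_continuous | move=> i; exact: derivable_cst].
Qed.

Lemma smooth_sum (I : Type) (r : seq I) (k : I -> R) (F : I -> E -> R) :
  (forall i, smooth_on U (F i)) -> smooth_on U (fun y => \sum_(i <- r) k i * F i y).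
Proof.
move=> sF; elim: r => [|i r IH].
  by apply: smooth_eqU (smooth_cst 0) => y _; rewrite big_nil.
by apply: smooth_eqU (smoothP (k i) (sF i) IH) => y _; rewrite big_cons.
Qed.

Lemma smooth_is_derive f x v : smooth_on U f -> U x ->
  is_derive x v f (\sum_i v 0 i * 'D_(e i) f x).
Proof.
move=> sf Ux; rewrite {1}(row_sum_delta v).
elim: (index_enum _) => [|i r IH]; first by rewrite !big_nil; exact: is_derive0.
rewrite !big_cons.
have pd y : U y -> derivable f y (e i) by move=> Uy; have [_] := sf [::] y Uy.
have dz y (Uy : U y) := is_derive_dirZ (v 0 i) (pd y Uy).
have [_ e1] := dz x Ux; have [d2 e2] := IH.
rewrite -e1 -e2; apply: is_derive_dirD; last exact: d2.
  by apply: near_U Ux _ => y Uy; have [] := dz y Uy.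
apply: (@eqU_continuous (fun y => v 0 i * 'D_(e i) f y)); first exact: Ux.
  by move=> y Uy; have [_ ->] := dz y Uy.
have [c _] := (smooth_partial i sf) [::] x Ux.
by apply: continuousM; [exact: cst_continuous|exact: c].
Qed.

Lemma smooth_derivable f x v : smooth_on U f -> U x -> derivable f x v.
Proof. by move=> sf Ux; have [] := smooth_is_derive v sf Ux. Qed.

Lemma smooth_deriveE f x v : smooth_on U f -> U x ->
  'D_v f x = \sum_i v 0 i * 'D_(e i) f x.
Proof. by move=> sf Ux; have [_] := smooth_is_derive v sf Ux. Qed.

Lemma smooth_derive f v : smooth_on U f -> smooth_on U (fun x => 'D_v f x).
Proof.
move=> sf; apply: (@smooth_eqU (fun y => \sum_i v 0 i * 'D_(e i) f y)).
  by move=> y Uy; rewrite -smooth_deriveE.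
by apply: smooth_sum => i; exact: smooth_partial.
Qed.

Lemma derive_dir_lin f x k u v : smooth_on U f -> U x ->
  'D_(k *: u + v) f x = k * 'D_u f x + 'D_v f x.
Proof.
move=> sf Ux; rewrite !smooth_deriveE// mulr_sumr -big_split.
by apply: eq_bigr => i _; rewrite !mxE/=; ring.
Qed.

Lemma smooth_schwarz f x u v : smooth_on U f -> U x ->
  'D_v (fun y => 'D_u f y) x = 'D_u (fun y => 'D_v f y) x.
Proof.
move=> sf Ux; have su := smooth_derive u sf; have sv := smooth_derive v sf.
have near_d (h : E -> R) (w : E) : smooth_on U h -> \forall y \near x, derivable h y w.
  by move=> sh; apply: near_U Ux _ => y Uy; exact: (smooth_derivable sh Uy).
have [cuv _] := (smooth_derive v su) [::] x Ux.
have [cvu _] := (smooth_derive u sv) [::] x Ux.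
exact: (schwarz (near_d _ u sf) (near_d _ v sf) (near_d _ v su) (near_d _ u sv) cuv cvu).
Qed.
End Smoothness.

Section MatrixCalculus.
Variables (R : realType) (m : nat).
Local Notation E := 'rV[R]_m.
Implicit Types (x u v : E).

Record dbl k l (F : E -> 'M[R]_(k, l)) x u : Prop := Dbl {
  dblE : forall i j, derivable (fun y => F y i j) x u }.
Arguments dblE {k l F x u} _ i j.

Definition dm k l u (F : E -> 'M[R]_(k, l)) x : 'M[R]_(k, l) :=
  \matrix_(i, j) 'D_u (fun y => F y i j) x.

Lemma derive_dm k l (F : E -> 'M[R]_(k, l)) x u : dbl F x u -> 'D_u F x = dm u F x.
Proof. by move=> dF; apply: derive_mx; apply/derivable_mxP; exact: dblE dF. Qed.

Lemma dbl_cst k l (A : 'M[R]_(k, l)) x u : dbl (fun=> A) x u.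
Proof. by split=> i j; exact: derivable_cst. Qed.
Lemma dm_cst k l (A : 'M[R]_(k, l)) x u : dm u (fun=> A) x = 0.
Proof. by apply/matrixP => i j; rewrite !mxE; exact: derive_cst. Qed.

Section Ops.
Variables (k l : nat) (F H : E -> 'M[R]_(k, l)) (x u : E).
Hypotheses (dF : dbl F x u) (dH : dbl H x u).

Lemma dbl_add : dbl (fun y => F y + H y) x u.
Proof.
split=> i j; have -> : (fun y => (F y + H y) i j) = (fun y => F y i j) + (fun y => H y i j).
  by apply/funext => y; rewrite mxE.
by apply: derivableD; [exact: (dblE dF)|exact: (dblE dH)].
Qed.

Lemma dm_add : dm u (fun y => F y + H y) x = dm u F x + dm u H x.
Proof.
apply/matrixP => i j; rewrite !mxE -(deriveD (dblE dF i j) (dblE dH i j)); congr ('D_u _ x).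
by apply/funext => y; rewrite mxE.
Qed.

Lemma dbl_opp : dbl (fun y => - F y) x u.
Proof.
split=> i j; have -> : (fun y => (- F y) i j) = - (fun y => F y i j).
  by apply/funext => y; rewrite mxE.
by apply: derivableN; exact: (dblE dF).
Qed.

Lemma dm_opp : dm u (fun y => - F y) x = - dm u F x.
Proof.
apply/matrixP => i j; rewrite !mxE -(deriveN (dblE dF i j)); congr ('D_u _ x).
by apply/funext => y; rewrite mxE.
Qed.

Lemma dbl_tr : dbl (fun y => (F y)^T) x u.
Proof.
split=> i j; have -> : (fun y => (F y)^T i j) = (fun y => F y j i); last exact: dblE dF _ _.
by apply/funext => y; rewrite mxE.
Qed.

Lemma dm_tr : dm u (fun y => (F y)^T) x = (dm u F x)^T.
Proof.
by apply/matrixP => i j; rewrite !mxE; congr ('D_u _ x); apply/funext => y; rewrite mxE.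
Qed.

Lemma dbl_scale (al : E -> R) : derivable al x u -> dbl (fun y => al y *: F y) x u.
Proof.
move=> da; split=> i j; have -> : (fun y => (al y *: F y) i j) = al * (fun y => F y i j).
  by apply/funext => y; rewrite mxE.
apply: derivableM; [exact: da|exact: dblE dF _ _].
Qed.

Lemma dm_scale (al : E -> R) : derivable al x u ->
  dm u (fun y => al y *: F y) x = 'D_u al x *: F x + al x *: dm u F x.
Proof.
move=> da; apply/matrixP => i j; rewrite !mxE.
have -> : (fun y => (al y *: F y) i j) = al * (fun y => F y i j).
  by apply/funext => y; rewrite mxE.
by rewrite (deriveM da (dblE dF i j)) addrC; congr (_ + _); exact: mulrC.
Qed.
End Ops.

Lemma is_derive_bigsum n (h : 'I_n -> E -> R) x u : (forall i, derivable (h i) x u) ->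
  is_derive x u (fun y => \sum_(i < n) h i y) (\sum_(i < n) 'D_u (h i) x).
Proof.
move=> dh; have -> : (fun y => \sum_(i < n) h i y) = \sum_(i < n) h i.
  by apply/funext => y; rewrite fct_sumE.
by apply: is_derive_sum => i; exact: derivableP.
Qed.

Section Mul.
Variables (k l p : nat) (F : E -> 'M[R]_(k, l)) (H : E -> 'M[R]_(l, p)) (x u : E).
Hypotheses (dF : dbl F x u) (dH : dbl H x u).

Let mul_entry i j : is_derive x u (fun y => (F y *m H y) i j)
  ((dm u F x *m H x + F x *m dm u H x) i j).
Proof.
have -> : (fun y => (F y *m H y) i j) = (fun y => \sum_r F y i r * H y r j).
  by apply/funext => y; rewrite mxE.
have dp r : derivable (fun y => F y i r * H y r j) x u.
  apply: derivableM; [exact: dblE dF _ _|exact: dblE dH _ _].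
have [d e] := is_derive_bigsum dp; split; first exact: d.
rewrite e !mxE -big_split; apply: eq_bigr => r _.
rewrite (deriveM (dblE dF i r) (dblE dH r j)) !mxE addrC; congr (_ + _); exact: mulrC.
Qed.

Lemma dbl_mul : dbl (fun y => F y *m H y) x u.
Proof. by split=> i j; have [] := mul_entry i j. Qed.

Lemma dm_mul : dm u (fun y => F y *m H y) x = dm u F x *m H x + F x *m dm u H x.
Proof. by apply/matrixP => i j; rewrite [LHS]mxE; have [_ ->] := mul_entry i j. Qed.
End Mul.

Section Open.
Variable U : set E.
Hypothesis oU : open U.

Lemma eqU_dm k l (F H : E -> 'M[R]_(k, l)) x u : U x -> (forall y, U y -> F y = H y) ->
  dm u F x = dm u H x.
Proof.
move=> Ux FH; apply/matrixP => i j; rewrite !mxE.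
by apply: (eqU_derive oU u Ux) => y Uy; rewrite FH.
Qed.

Lemma eqU_dbl k l (F H : E -> 'M[R]_(k, l)) x u : U x -> (forall y, U y -> F y = H y) ->
  dbl F x u -> dbl H x u.
Proof.
move=> Ux FH dF; split=> i j; apply: (eqU_derivable oU Ux) (dblE dF i j) => y Uy.
by rewrite FH.
Qed.

Variables (k l : nat) (F : E -> 'M[R]_(k, l)).
Hypothesis sF : smooth_mx_on U F.

Lemma smooth_dbl x u : U x -> dbl F x u.
Proof. by move=> Ux; split=> i j; exact: (smooth_derivable oU (sF i j) Ux). Qed.

Lemma smooth_dm u : smooth_mx_on U (dm u F).
Proof.
move=> i j; have -> : (fun x => dm u F x i j) = (fun x => 'D_u (fun y => F y i j) x).
  by apply/funext => x; rewrite mxE.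
exact: smooth_derive (sF i j).
Qed.

Lemma dm_dir_lin x c u v : U x -> dm (c *: u + v) F x = c *: dm u F x + dm v F x.
Proof.
move=> Ux; apply/matrixP => i j; rewrite !mxE; exact: (derive_dir_lin oU c u v (sF i j) Ux).
Qed.

Lemma dm_schwarz x u v : U x -> dm v (dm u F) x = dm u (dm v F) x.
Proof.
move=> Ux; apply/matrixP => i j; rewrite [LHS]mxE [RHS]mxE.
have e w : (fun y => dm w F y i j) = (fun y => 'D_w (fun z => F z i j) y).
  by apply/funext => y; rewrite mxE.
rewrite (e u) (e v); exact: (smooth_schwarz oU u v (sF i j) Ux).
Qed.
End Open.

Lemma smooth_mx_cst (U : set E) k l (A : 'M[R]_(k, l)) : open U -> smooth_mx_on U (fun=> A).
Proof. by move=> oU i j; exact: smooth_cst. Qed.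

End MatrixCalculus.
Arguments dblE {R m k l F x u} _ i j.

(** * Curvature in a coordinate domain *)

(* The library lemmas, restated so that all products carry the same instance
   path from [R] and can be matched syntactically. *)
Section RealProducts.
Variables (R : realType) (k l j r : nat).
Implicit Types (A : 'M[R]_(k, l)) (B : 'M[R]_(l, j)) (C : 'M[R]_(j, r)).

Lemma rmulDl A A' B : (A + A') *m B = A *m B + A' *m B. Proof. exact: mulmxDl. Qed.
Lemma rmulDr A B B' : A *m (B + B') = A *m B + A *m B'. Proof. exact: mulmxDr. Qed.
Lemma rmulNl A B : (- A) *m B = - (A *m B). Proof. exact: mulNmx. Qed.
Lemma rmulNr A B : A *m (- B) = - (A *m B). Proof. exact: mulmxN. Qed.
Lemma rmulZl c A B : (c *: A) *m B = c *: (A *m B). Proof. by rewrite scalemxAl. Qed.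
Lemma rmulZr c A B : A *m (c *: B) = c *: (A *m B). Proof. by rewrite scalemxAr. Qed.
Lemma rmulA A B C : A *m (B *m C) = A *m B *m C. Proof. exact: mulmxA. Qed.
End RealProducts.
Definition rmulE := (rmulDl, rmulDr, rmulNl, rmulNr, rmulZl, rmulZr, rmulA).

(* Identities between noncommutative polynomials in matrices: the monomials are
   made opaque, because [ring] compares its atoms up to conversion. *)
Ltac mxatoms :=
  repeat match goal with |- context [@dm ?R ?m ?k ?l ?u ?F ?x] =>
    let h := fresh "d" in generalize (@dm R m k l u F x); intro h end;
  repeat match goal with |- context [@mulmx ?R ?m ?n ?p ?A ?B] =>
    let h := fresh "a" in generalize (@mulmx R m n p A B); intro h end.
Ltac mxring :=
  rewrite ?rmulE; mxatoms; vring.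

Section ConstantFactor.
Variables (R : realType) (m k l j : nat) (A : 'M[R]_(k, l)) (F : 'rV[R]_m -> 'M[R]_(l, j)).
Variables (x u : 'rV[R]_m) (dF : dbl F x u).

Lemma dbl_mull : dbl (fun y => A *m F y) x u.
Proof. exact: dbl_mul (dbl_cst _ _ _) dF. Qed.

Lemma dm_mull : dm u (fun y => A *m F y) x = A *m dm u F x.
Proof. by rewrite (dm_mul (dbl_cst A x u) dF) dm_cst mul0mx add0r. Qed.
End ConstantFactor.

Lemma dm_P (R : realType) m k l (c : R) (F H : 'rV[R]_m -> 'M[R]_(k, l)) x u :
  dbl F x u -> dbl H x u ->
  dm u (fun y => c *: F y + H y) x = c *: dm u F x + dm u H x.
Proof.
move=> dF dH; have dc : derivable (fun=> c) x u by exact: derivable_cst.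
by rewrite (dm_add (dbl_scale dF dc) dH) (dm_scale dF dc) derive_cst scale0r add0r.
Qed.

Section Geometry.
Variables (R : realType) (n : nat).
Local Notation m := (n.*2).
Local Notation E := 'rV[R]_m.
Local Notation e i := (delta_mx 0 i : E).
Variable Gam : 'I_m -> 'I_m -> E -> E.

(* Connection matrices: nabla_u of the constant field w is w *m conn_mx u. *)
Definition conn_mx (u : E) (x : E) : 'M[R]_m :=
  \matrix_(j, k) \sum_i u 0 i * Gam i j x 0 k.

Lemma mul_conn_mx (u w : E) x : w *m conn_mx u x = \sum_i \sum_j (u 0 i * w 0 j) *: Gam i j x.
Proof.
apply/rowP => k; rewrite mxE summxE.
under eq_bigr do rewrite mxE mulr_sumr.
rewrite exchange_big; apply: eq_bigr => i _; rewrite summxE.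
by apply: eq_bigr => j _; rewrite mxE; ring.
Qed.

Lemma covE X Y x : cov Gam X Y x = 'D_(X x) Y x + Y x *m conn_mx (X x) x.
Proof. by rewrite mul_conn_mx. Qed.

Lemma cov_cst u w x : cov Gam (cst u) (cst w) x = w *m conn_mx u x.
Proof. by rewrite covE derive_cst add0r. Qed.

Lemma conn_mx_lin k u v x : conn_mx (k *: u + v) x = k *: conn_mx u x + conn_mx v x.
Proof.
apply/matrixP => i j; rewrite !mxE mulr_sumr -big_split; apply: eq_bigr => l _.
by rewrite !mxE /=; ring.
Qed.

Variable U : set E.
Hypothesis oU : open U.
Hypothesis sGam : forall i j, smooth_mx_on U (Gam i j).

Lemma smooth_conn_mx u : smooth_mx_on U (conn_mx u).
Proof.
move=> j k; have -> : (fun x => conn_mx u x j k) = (fun x => \sum_i u 0 i * Gam i j x 0 k).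
  by apply/funext => x; rewrite mxE.
by apply: smooth_sum => // i; exact: sGam.
Qed.

Let dC u t x : U x -> dbl (conn_mx u) x t.
Proof. exact: (smooth_dbl oU (smooth_conn_mx u)). Qed.

Let ddC u v t x : U x -> dbl (dm v (conn_mx u)) x t.
Proof. exact: (smooth_dbl oU (smooth_dm oU (smooth_conn_mx u) v)). Qed.

Definition curv_mx u v (x : E) : 'M[R]_m :=
  dm u (conn_mx v) x - dm v (conn_mx u) x + conn_mx v x *m conn_mx u x - conn_mx u x *m conn_mx v x.

Ltac curvature_ring :=
  rewrite ?rmulE;
  repeat match goal with
  | |- context [curv_mx ?u ?v ?x] => let h := fresh "r" in generalize (curv_mx u v x); intro h
  | |- context [conn_mx ?u ?x] => let h := fresh "c" in generalize (conn_mx u x); intro h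
  end; mxring.

Lemma derive_mulC u v (w : E) x : U x -> 'D_u (fun y => w *m conn_mx v y) x = w *m dm u (conn_mx v) x.
Proof.
move=> Ux; have dCv := @dC v u _ Ux.
by rewrite (derive_dm (dbl_mull w dCv)) dm_mull.
Qed.

Lemma curvE x u v w : U x -> curv Gam x u v w = w *m curv_mx u v x.
Proof.
move=> Ux; rewrite /curv /curvature_op.
have cc a b : cov Gam (cst a) (cst b) = fun y => b *m conn_mx a y.
  by apply/funext => y; exact: cov_cst.
rewrite !cc !covE /= !derive_mulC// derive_cst add0r.
have -> : bracket (cst u) (cst v) x = 0 by rewrite /bracket !derive_cst subrr.
have -> : conn_mx 0 x = 0.
  have := conn_mx_lin (-1) 0 0 x; rewrite scaler0 addr0 => ->; by rewrite scaleN1r addNr.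
rewrite mulmx0 subr0 /cst.
by rewrite /curv_mx; mxring.
Qed.

Lemma dbl_curv_mx u v x t : U x -> dbl (curv_mx u v) x t.
Proof.
move=> Ux.
have h1 : dbl (fun y => dm u (conn_mx v) y - dm v (conn_mx u) y) x t.
  exact: dbl_add (ddC _ _ _ Ux) (dbl_opp (ddC _ _ _ Ux)).
have h2 a b : dbl (fun y => conn_mx a y *m conn_mx b y) x t := dbl_mul (dC _ _ Ux) (dC _ _ Ux).
exact: dbl_add (dbl_add h1 (h2 _ _)) (dbl_opp (h2 _ _)).
Qed.

Lemma dm_curv_mx u v x t : U x -> dm t (curv_mx u v) x =
  dm t (dm u (conn_mx v)) x - dm t (dm v (conn_mx u)) x
  + (dm t (conn_mx v) x *m conn_mx u x + conn_mx v x *m dm t (conn_mx u) x)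
  - (dm t (conn_mx u) x *m conn_mx v x + conn_mx u x *m dm t (conn_mx v) x).
Proof.
move=> Ux.
have h1 : dbl (fun y => dm u (conn_mx v) y - dm v (conn_mx u) y) x t.
  exact: dbl_add (ddC _ _ _ Ux) (dbl_opp (ddC _ _ _ Ux)).
have h2 a b : dbl (fun y => conn_mx a y *m conn_mx b y) x t := dbl_mul (dC _ _ Ux) (dC _ _ Ux).
rewrite {1}/curv_mx dm_add; [|exact: (dbl_add h1 (h2 _ _))|exact: (dbl_opp (h2 _ _))].
rewrite dm_opp; last exact: h2.
rewrite dm_add; [|exact: h1|exact: h2].
rewrite dm_add; [|exact: ddC|exact: dbl_opp (ddC _ _ _ Ux)].
rewrite dm_opp; last exact: ddC.
by rewrite (dm_mul (dC _ _ Ux) (dC _ _ Ux)) (dm_mul (dC _ _ Ux) (dC _ _ Ux)).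
Qed.

Lemma curv_mx_lin1 k u u' v x : U x -> curv_mx (k *: u + u') v x = k *: curv_mx u v x + curv_mx u' v x.
Proof.
move=> Ux; rewrite /curv_mx (dm_dir_lin oU (smooth_conn_mx v))// conn_mx_lin.
have -> : dm v (conn_mx (k *: u + u')) x = k *: dm v (conn_mx u) x + dm v (conn_mx u') x.
  have -> : conn_mx (k *: u + u') = (fun y => k *: conn_mx u y + conn_mx u' y).
    by apply/funext => y; exact: conn_mx_lin.
  by rewrite (dm_P k (dC _ _ Ux) (dC _ _ Ux)).
mxring.
Qed.

Lemma curv_mx_skew u v x : curv_mx u v x = - curv_mx v u x.
Proof. by rewrite /curv_mx; vring. Qed.

Lemma curv_mx_lin2 k u v v' x : U x -> curv_mx u (k *: v + v') x = k *: curv_mx u v x + curv_mx u v' x.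
Proof.
by move=> Ux; rewrite curv_mx_skew curv_mx_lin1// (curv_mx_skew u v) (curv_mx_skew u v'); curvature_ring.
Qed.

Lemma dm_curv_mx_lin1 k u u' v t x : U x ->
  dm t (curv_mx (k *: u + u') v) x = k *: dm t (curv_mx u v) x + dm t (curv_mx u' v) x.
Proof.
move=> Ux; have -> : dm t (curv_mx (k *: u + u') v) x = dm t (fun y => k *: curv_mx u v y + curv_mx u' v y) x.
  by apply: (eqU_dm oU) => // y Uy; exact: curv_mx_lin1.
by rewrite (dm_P k (dbl_curv_mx _ _ _ Ux) (dbl_curv_mx _ _ _ Ux)).
Qed.

Lemma dm_curv_mx_skew u v t x : U x -> dm t (curv_mx u v) x = - dm t (curv_mx v u) x.
Proof.
move=> Ux; have -> : dm t (curv_mx u v) x = dm t (fun y => - curv_mx v u y) x.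
  by apply: (eqU_dm oU) => // y Uy; exact: curv_mx_skew.
by rewrite (dm_opp (dbl_curv_mx _ _ _ Ux)).
Qed.

Lemma dm_curv_mx_lint k s t u v x : U x ->
  dm (k *: s + t) (curv_mx u v) x = k *: dm s (curv_mx u v) x + dm t (curv_mx u v) x.
Proof.
move=> Ux; rewrite !dm_curv_mx//.
rewrite !(dm_dir_lin oU (smooth_conn_mx _))// !(dm_dir_lin oU (smooth_dm oU (smooth_conn_mx _) _))//.
curvature_ring.
Qed.

(* The matrix of (nabla_t R)(u, v). *)
Definition nabla_mx t u v x : 'M[R]_m :=
  dm t (curv_mx u v) x + curv_mx u v x *m conn_mx t x - conn_mx t x *m curv_mx u v x
  - curv_mx (u *m conn_mx t x) v x - curv_mx u (v *m conn_mx t x) x.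

Lemma nablaRE x t u v w : U x -> nablaR Gam x t u v w = w *m nabla_mx t u v x.
Proof.
move=> Ux; rewrite /nablaR /cov_tensor !cov_cst covE !curvE//.
have -> : 'D_(cst t x) (fun y => curv Gam y u v w) x = w *m dm t (curv_mx u v) x.
  rewrite /= derive_dm; last first.
    apply: (@eqU_dbl _ _ _ oU _ _ (fun y => w *m curv_mx u v y)) => // [y Uy|].
      by rewrite curvE.
    exact: dbl_mull (dbl_curv_mx _ _ _ Ux).
  rewrite (@eqU_dm _ _ _ oU _ _ _ (fun y => w *m curv_mx u v y))//; last by move=> y Uy; rewrite curvE.
  by rewrite (dm_mull w (dbl_curv_mx _ _ _ Ux)).
by rewrite /nabla_mx; curvature_ring.
Qed.

Lemma nabla_mx_lin1 k s t u v x : U x -> nabla_mx (k *: s + t) u v x = k *: nabla_mx s u v x + nabla_mx t u v x.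
Proof.
move=> Ux; rewrite /nabla_mx dm_curv_mx_lint// conn_mx_lin.
have C_lin w : w *m (k *: conn_mx s x + conn_mx t x) = k *: (w *m conn_mx s x) + w *m conn_mx t x :> E.
  by rewrite mulmxDr -scalemxAr.
rewrite (C_lin u) (C_lin v).
rewrite (curv_mx_lin1 k (u *m conn_mx s x) (u *m conn_mx t x))//.
rewrite (curv_mx_lin2 k u (v *m conn_mx s x) (v *m conn_mx t x))//.
curvature_ring.
Qed.

Lemma nabla_mx_skew t u v x : U x -> nabla_mx t u v x = - nabla_mx t v u x.
Proof.
move=> Ux; rewrite /nabla_mx dm_curv_mx_skew// (curv_mx_skew u) (curv_mx_skew (u *m _)) (curv_mx_skew u (v *m _)).
curvature_ring.
Qed.

Lemma nabla_mx_lin2 k t u u' v x : U x -> nabla_mx t (k *: u + u') v x = k *: nabla_mx t u v x + nabla_mx t u' v x.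
Proof.
move=> Ux; rewrite /nabla_mx dm_curv_mx_lin1// !curv_mx_lin1//.
have -> : (k *: u + u') *m conn_mx t x = k *: (u *m conn_mx t x) + u' *m conn_mx t x.
  by rewrite mulmxDl -scalemxAl.
rewrite (curv_mx_lin1 k (u *m conn_mx t x) (u' *m conn_mx t x))//; curvature_ring.
Qed.

Lemma nabla_mx_lin3 k t u v v' x : U x -> nabla_mx t u (k *: v + v') x = k *: nabla_mx t u v x + nabla_mx t u v' x.
Proof.
move=> Ux; rewrite nabla_mx_skew// nabla_mx_lin2// (nabla_mx_skew _ u v)// (nabla_mx_skew _ u v')//.
by move: (nabla_mx t v u x) (nabla_mx t v' u x) => a b; vring.
Qed.

Section Torsion.
Hypothesis tor : torsion_free Gam U.

Lemma conn_mx_sym u v x : U x -> v *m conn_mx u x = u *m conn_mx v x.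
Proof.
move=> Ux; have := tor (smooth_mx_cst u oU) (smooth_mx_cst v oU) Ux.
rewrite !cov_cst /bracket !derive_cst subrr => /eqP.
by rewrite subr_eq0 => /eqP.
Qed.

Lemma dmC_sym t u v x : U x -> v *m dm t (conn_mx u) x = u *m dm t (conn_mx v) x.
Proof.
move=> Ux; rewrite -(derive_mulC t u v Ux) -(derive_mulC t v u Ux).
rewrite (derive_dm (dbl_mull v (dC u t Ux))) (derive_dm (dbl_mull u (dC v t Ux))).
by apply: (eqU_dm oU) => // y Uy; exact: conn_mx_sym.
Qed.

Lemma curv_mx_b1 u v w x : U x -> w *m curv_mx u v x + u *m curv_mx v w x + v *m curv_mx w u x = 0.
Proof.
move=> Ux; rewrite /curv_mx; rewrite !rmulE.
rewrite (dmC_sym u v w)// (dmC_sym v w u)// (dmC_sym w u v)//.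
rewrite (conn_mx_sym v w)// (conn_mx_sym w u)// (conn_mx_sym u v)//.
mxring.
Qed.

Lemma dm_curv_mx_b1 t u v w x : U x ->
  w *m dm t (curv_mx u v) x + u *m dm t (curv_mx v w) x + v *m dm t (curv_mx w u) x = 0.
Proof.
move=> Ux; have hd (a b c : E) : dbl (fun y => a *m curv_mx b c y) x t.
  exact: dbl_mull (dbl_curv_mx _ _ _ Ux).
have dE (a : E) b c : a *m dm t (curv_mx b c) x = dm t (fun y => a *m curv_mx b c y) x.
  by rewrite (dm_mull a (dbl_curv_mx _ _ _ Ux)).
rewrite !dE -(dm_add (hd w u v) (hd u v w)).
rewrite -(dm_add (dbl_add (hd w u v) (hd u v w)) (hd v w u)) -[RHS](dm_cst (0 : E) x t).
by apply: (eqU_dm oU) => // y Uy; exact: curv_mx_b1.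
Qed.

Lemma nabla_mx_b1 t u v w x : U x -> w *m nabla_mx t u v x + u *m nabla_mx t v w x + v *m nabla_mx t w u x = 0.
Proof.
move=> Ux; rewrite /nabla_mx.
have h0 := dm_curv_mx_b1 t u v w Ux.
have h1 := curv_mx_b1 u v w Ux.
have h2 := curv_mx_b1 (u *m conn_mx t x) v w Ux.
have h3 := curv_mx_b1 u (v *m conn_mx t x) w Ux.
have h4 := curv_mx_b1 u v (w *m conn_mx t x) Ux.
transitivity ((w *m dm t (curv_mx u v) x + u *m dm t (curv_mx v w) x + v *m dm t (curv_mx w u) x)
  + (w *m curv_mx u v x + u *m curv_mx v w x + v *m curv_mx w u x) *m conn_mx t x
  - (w *m curv_mx (u *m conn_mx t x) v x + (u *m conn_mx t x) *m curv_mx v w x + v *m curv_mx w (u *m conn_mx t x) x)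
  - (w *m curv_mx u (v *m conn_mx t x) x + u *m curv_mx (v *m conn_mx t x) w x + (v *m conn_mx t x) *m curv_mx w u x)
  - ((w *m conn_mx t x) *m curv_mx u v x + u *m curv_mx v (w *m conn_mx t x) x + v *m curv_mx (w *m conn_mx t x) u x)).
  curvature_ring.
have sum0 (a b c d f : E) (M : 'M[R]_m) :
  a = 0 -> b = 0 -> c = 0 -> d = 0 -> f = 0 -> a + b *m M - c - d - f = 0.
  by move=> -> -> -> -> ->; rewrite mul0mx !subr0 addr0.
exact: sum0 h0 h1 h2 h3 h4.
Qed.

Lemma nabla_mx_b2 t u v x : U x -> nabla_mx t u v x + nabla_mx u v t x + nabla_mx v t u x = 0.
Proof.
move=> Ux; rewrite /nabla_mx !dm_curv_mx//.
rewrite (conn_mx_sym t u)// (conn_mx_sym t v)// (conn_mx_sym u v)//.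
rewrite (curv_mx_skew (t *m conn_mx v x) u) (curv_mx_skew (u *m conn_mx v x) t) (curv_mx_skew (t *m conn_mx u x) v).
rewrite (dm_schwarz oU (smooth_conn_mx v) u t Ux) (dm_schwarz oU (smooth_conn_mx u) v t Ux).
rewrite (dm_schwarz oU (smooth_conn_mx t) v u Ux).
move: (curv_mx v (t *m conn_mx u x) x) (curv_mx u (t *m conn_mx v x) x) (curv_mx t (u *m conn_mx v x) x) => a b c.
rewrite /curv_mx; curvature_ring.
Qed.
End Torsion.
End Geometry.

Lemma bilin_delta (R : realType) m (G : 'M[R]_m) i j :
  bilin G (delta_mx 0 i) (delta_mx 0 j) = G i j.
Proof. by rewrite /bilin trmx_delta -colE -rowE !mxE. Qed.

Lemma mul_row_eq (R : realType) m (A B : 'M[R]_m) :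
  (forall u : 'rV_m, u *m A = u *m B) -> A = B.
Proof. by move=> AB; apply/row_matrixP => i; rewrite !rowE AB. Qed.

Lemma bilin_mul (R : realType) m (G A : 'M[R]_m) u v :
  bilin G (u *m A) v + bilin G u (v *m A) = bilin (A *m G + G *m A^T) u v.
Proof.
by rewrite /bilin trmx_mul mulmxDr mulmxDl !mulmxA [RHS]mxE.
Qed.

Lemma rtrD (R : realType) k l (A B : 'M[R]_(k, l)) : (A + B)^T = A^T + B^T.
Proof. exact: linearD. Qed.
Lemma rtrN (R : realType) k l (A : 'M[R]_(k, l)) : (- A)^T = - A^T.
Proof. exact: linearN. Qed.
Lemma rtrM (R : realType) k l j (A : 'M[R]_(k, l)) (B : 'M[R]_(l, j)) :
  (A *m B)^T = B^T *m A^T.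
Proof. exact: trmx_mul. Qed.

Section Kaehler.
Variables (R : realType) (n : nat).
Local Notation m := (n.*2).
Local Notation E := 'rV[R]_m.
Local Notation e i := (delta_mx 0 i : E).
Variables (Gam : 'I_m -> 'I_m -> E -> E) (U : set E) (g J : E -> 'M[R]_m).
Hypotheses (oU : open U) (lc : levi_civita Gam U g) (pJ : parallel_endo Gam U J).
Hypotheses (sg : smooth_mx_on U g) (sJ : smooth_mx_on U J).

Let sGam i j : smooth_mx_on U (Gam i j). Proof. by case: lc. Qed.
Let tor : torsion_free Gam U. Proof. by case: lc. Qed.
Let met : metric_connection Gam U g. Proof. by case: lc. Qed.
Local Notation C := (conn_mx Gam).
Local Notation Rm := (curv_mx Gam).
Local Notation NR := (nabla_mx Gam).

Let dC u t x : U x -> dbl (C u) x t.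
Proof. exact: (smooth_dbl oU (smooth_conn_mx oU sGam u)). Qed.
Let dg x t : U x -> dbl g x t. Proof. exact: (smooth_dbl oU sg). Qed.
Let dJ x t : U x -> dbl J x t. Proof. exact: (smooth_dbl oU sJ). Qed.
Let dR u v t x : U x -> dbl (Rm u v) x t. Proof. exact: dbl_curv_mx. Qed.

Lemma dm_metric u x : U x -> dm u g x = C u x *m g x + g x *m (C u x)^T.
Proof.
move=> Ux; apply/matrixP => i j; rewrite [LHS]mxE.
have := met (smooth_mx_cst u oU) (smooth_mx_cst (e i) oU) (smooth_mx_cst (e j) oU) Ux.
rewrite !cov_cst.
have -> : (fun y => bilin (g y) (cst (e i) y) (cst (e j) y)) = (fun y => g y i j).
  by apply/funext => y; exact: bilin_delta.
by move=> ->; rewrite -[RHS]bilin_delta -bilin_mul.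
Qed.

Lemma dm_complex u x : U x -> dm u J x = C u x *m J x - J x *m C u x.
Proof.
move=> Ux; apply: mul_row_eq => w.
have := pJ (smooth_mx_cst u oU) (smooth_mx_cst w oU) Ux.
rewrite cov_cst covE /cst (derive_dm (dbl_mull w (dJ u Ux))) (dm_mull w (dJ u Ux)).
by move=> /(canRL (addrK _)) ->; rewrite mulmxBr !mulmxA.
Qed.

Let dCg u t x : U x -> dm t (fun y => C u y *m g y + g y *m (C u y)^T) x =
  dm t (C u) x *m g x + C u x *m dm t g x + (dm t g x *m (C u x)^T + g x *m (dm t (C u) x)^T).
Proof.
move=> Ux; have c := dC u t Ux; have d := dg t Ux.
rewrite (dm_add (dbl_mul c d) (dbl_mul d (dbl_tr c))).
by rewrite (dm_mul c d) (dm_mul d (dbl_tr c)) dm_tr.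
Qed.

Lemma curv_mx_metric u v x : U x -> Rm u v x *m g x + g x *m (Rm u v x)^T = 0.
Proof.
move=> Ux; have h : dm u (dm v g) x - dm v (dm u g) x = 0.
  by rewrite (dm_schwarz oU sg v u Ux) subrr.
rewrite -[RHS]h (eqU_dm oU u Ux (fun y Uy => dm_metric v Uy)).
rewrite (eqU_dm oU v Ux (fun y Uy => dm_metric u Uy)) (dCg v u Ux) (dCg u v Ux).
rewrite (dm_metric u Ux) (dm_metric v Ux) /curv_mx.
rewrite !(rtrD, rtrN, rtrM).
move: (dm u (C v) x) (dm v (C u) x) => a b; mxring.
Qed.

Lemma curv_mx_complex u v x : U x -> Rm u v x *m J x = J x *m Rm u v x.
Proof.
move=> Ux; have h : dm u (dm v J) x - dm v (dm u J) x = 0.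
  by rewrite (dm_schwarz oU sJ v u Ux) subrr.
have dCJ a t : dm t (fun y => C a y *m J y - J y *m C a y) x =
  dm t (C a) x *m J x + C a x *m dm t J x - (dm t J x *m C a x + J x *m dm t (C a) x).
  have c := dC a t Ux; have d := dJ t Ux.
  rewrite (dm_add (dbl_mul c d) (dbl_opp (dbl_mul d c))) (dm_opp (dbl_mul d c)).
  by rewrite (dm_mul c d) (dm_mul d c).
apply/eqP; rewrite -subr_eq0; apply/eqP.
rewrite -[RHS]h (eqU_dm oU u Ux (fun y Uy => dm_complex v Uy)).
rewrite (eqU_dm oU v Ux (fun y Uy => dm_complex u Uy)) !dCJ.
rewrite (dm_complex u Ux) (dm_complex v Ux) /curv_mx.
move: (dm u (C v) x) (dm v (C u) x) => a b; mxring.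
Qed.

Lemma nabla_mx_metric t u v x : U x -> NR t u v x *m g x + g x *m (NR t u v x)^T = 0.
Proof.
move=> Ux.
have h0 : dm t (Rm u v) x *m g x + Rm u v x *m dm t g x
    + (dm t g x *m (Rm u v x)^T + g x *m (dm t (Rm u v) x)^T) = 0.
  rewrite -(dm_cst (0 : 'M[R]_m) x t) -(eqU_dm oU t Ux (fun y Uy => curv_mx_metric u v Uy)).
  have r := dR u v t Ux; have d := dg t Ux.
  rewrite (dm_add (dbl_mul r d) (dbl_mul d (dbl_tr r))).
  by rewrite (dm_mul r d) (dm_mul d (dbl_tr r)) dm_tr.
have h1 := curv_mx_metric u v Ux.
have h2 := curv_mx_metric (u *m C t x) v Ux.
have h3 := curv_mx_metric u (v *m C t x) Ux.
rewrite (dm_metric t Ux) in h0.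
transitivity ((dm t (Rm u v) x *m g x + Rm u v x *m (C t x *m g x + g x *m (C t x)^T)
    + ((C t x *m g x + g x *m (C t x)^T) *m (Rm u v x)^T + g x *m (dm t (Rm u v) x)^T))
  - (Rm u v x *m g x + g x *m (Rm u v x)^T) *m (C t x)^T
  - C t x *m (Rm u v x *m g x + g x *m (Rm u v x)^T)
  - (Rm (u *m C t x) v x *m g x + g x *m (Rm (u *m C t x) v x)^T)
  - (Rm u (v *m C t x) x *m g x + g x *m (Rm u (v *m C t x) x)^T)).
  rewrite /nabla_mx !(rtrD, rtrN, rtrM).
  move: (Rm (u *m C t x) v x) (Rm u (v *m C t x) x) (dm t (Rm u v) x) (Rm u v x) => a b c d.
  mxring.
have sum0 (a b c d f : 'M[R]_m) (M N : 'M[R]_m) :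
  a = 0 -> b = 0 -> c = 0 -> d = 0 -> f = 0 -> a - b *m M - N *m c - d - f = 0.
  by move=> -> -> -> -> ->; rewrite mul0mx mulmx0 !subr0.
exact: (sum0 _ _ _ _ _ _ _ h0 h1 h1 h2 h3).
Qed.

Lemma nabla_mx_complex t u v x : U x -> NR t u v x *m J x = J x *m NR t u v x.
Proof.
move=> Ux.
have h0 : dm t (Rm u v) x *m J x + Rm u v x *m dm t J x
    - (dm t J x *m Rm u v x + J x *m dm t (Rm u v) x) = 0.
  have r := dR u v t Ux; have d := dJ t Ux.
  rewrite -(dm_mul r d) -(dm_mul d r).
  by rewrite (eqU_dm oU t Ux (fun y Uy => curv_mx_complex u v Uy)) subrr.
have c u' v' : Rm u' v' x *m J x - J x *m Rm u' v' x = 0.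
  by rewrite curv_mx_complex// subrr.
have h1 := c u v; have h2 := c (u *m C t x) v; have h3 := c u (v *m C t x).
rewrite (dm_complex t Ux) in h0.
apply/eqP; rewrite -subr_eq0; apply/eqP.
transitivity ((dm t (Rm u v) x *m J x + Rm u v x *m (C t x *m J x - J x *m C t x)
    - ((C t x *m J x - J x *m C t x) *m Rm u v x + J x *m dm t (Rm u v) x))
  + (Rm u v x *m J x - J x *m Rm u v x) *m C t x
  - C t x *m (Rm u v x *m J x - J x *m Rm u v x)
  - (Rm (u *m C t x) v x *m J x - J x *m Rm (u *m C t x) v x)
  - (Rm u (v *m C t x) x *m J x - J x *m Rm u (v *m C t x) x)).
  rewrite /nabla_mx.
  move: (Rm (u *m C t x) v x) (Rm u (v *m C t x) x) (dm t (Rm u v) x) (Rm u v x) => a b f d.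
  mxring.
have sum0 (a b f d k : 'M[R]_m) (M N : 'M[R]_m) :
  a = 0 -> b = 0 -> f = 0 -> d = 0 -> k = 0 -> a + b *m M - N *m f - d - k = 0.
  by move=> -> -> -> -> ->; rewrite mul0mx mulmx0 !subr0 addr0.
exact: (sum0 _ _ _ _ _ _ _ h0 h1 h1 h2 h3).
Qed.

Hypothesis gsym : forall x, U x -> (g x)^T = g x.

Lemma nabla_curv_nablaR x : U x -> nabla_curv (g x) (J x) (nablaR Gam x).
Proof.
move=> Ux; have E4 t u v w := nablaRE oU sGam t u v w Ux.
split.
- split=> [u v w|t v w|t u w|t u v] k a b; rewrite !E4.
  + rewrite (nabla_mx_lin1 oU sGam k a b u v Ux) rmulDr rmulZr; exact: erefl.
  + rewrite (nabla_mx_lin2 oU sGam k t a b v Ux) rmulDr rmulZr; exact: erefl.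
  + rewrite (nabla_mx_lin3 oU sGam k t u a b Ux) rmulDr rmulZr; exact: erefl.
  + rewrite rmulDl rmulZl; exact: erefl.
- move=> t u v w; rewrite !E4 (nabla_mx_skew oU sGam t u v Ux) rmulNr; exact: erefl.
- move=> t u v w z; rewrite !E4; apply/eqP; rewrite -addr_eq0; apply/eqP.
  rewrite (gC (gsym Ux) (z *m _)) bilin_mul (nabla_mx_metric t u v Ux).
  by rewrite /bilin mulmx0 mul0mx mxE.
- move=> t u v w; rewrite !E4 -!mulmxA (nabla_mx_complex t u v Ux); exact: erefl.
- move=> t u v w; rewrite !E4; exact: (nabla_mx_b1 oU sGam tor).
- move=> t u v w; rewrite !E4 -!mulmxDr (nabla_mx_b2 oU sGam tor t u v Ux) mulmx0; exact: erefl.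
Qed.
End Kaehler.

Section Inverse.
Variables (R : realType) (m : nat).
Implicit Types (x t : 'rV[R]_m).

Lemma derivable_prod (I : Type) (r : seq I) (f : I -> 'rV[R]_m -> R) x t :
  (forall i, derivable (f i) x t) -> derivable (fun y => \prod_(i <- r) f i y) x t.
Proof.
move=> df; elim: r => [|i r IH].
  have -> : (fun y => \prod_(i <- [::]) f i y) = cst 1 by apply/funext => y; rewrite big_nil.
  exact: derivable_cst.
have -> : (fun y => \prod_(j <- i :: r) f j y) = f i * (fun y => \prod_(j <- r) f j y).
  by apply/funext => y; rewrite big_cons.
apply: derivableM; [exact: df|exact: IH].
Qed.

Lemma derivable_bigsum (I : Type) (r : seq I) (f : I -> 'rV[R]_m -> R) x t :
  (forall i, derivable (f i) x t) -> derivable (fun y => \sum_(i <- r) f i y) x t.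
Proof.
move=> df; elim: r => [|i r IH].
  have -> : (fun y => \sum_(i <- [::]) f i y) = cst 0 by apply/funext => y; rewrite big_nil.
  exact: derivable_cst.
have -> : (fun y => \sum_(j <- i :: r) f j y) = f i + (fun y => \sum_(j <- r) f j y).
  by apply/funext => y; rewrite big_cons.
apply: derivableD; [exact: df|exact: IH].
Qed.

Lemma derivable_det k (F : 'rV[R]_m -> 'M[R]_k) x t :
  dbl F x t -> derivable (fun y => \det (F y)) x t.
Proof.
move=> dF; rewrite /determinant; apply: derivable_bigsum => s.
apply: derivableM; first exact: derivable_cst.
by apply: derivable_prod => i; exact: (dblE dF).
Qed.

Lemma dbl_invmx k (F : 'rV[R]_m -> 'M[R]_k) (U : set 'rV[R]_m) x t : open U -> U x ->
  (forall y, U y -> F y \in unitmx) -> dbl F x t -> dbl (fun y => invmx (F y)) x t.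
Proof.
move=> oU Ux uF dF.
apply: (@eqU_dbl _ _ _ oU _ _ (fun y => (\det (F y))^-1 *: \adj (F y))) => //.
  by move=> y Uy; rewrite /invmx uF.
have dn0 : \det (F x) != 0 by have := uF x Ux; rewrite unitmxE unitfE.
apply: dbl_scale; last first.
  exact: (@derivableV _ _ (fun y => \det (F y)) _ _ dn0 (derivable_det dF)).
split=> i j.
have -> : (fun y => (\adj (F y)) i j) =
    (fun y => (-1) ^+ (j + i) * \det (row' j (col' i (F y)))).
  by apply/funext => y; rewrite mxE.
apply: derivableM; first exact: derivable_cst.
apply: derivable_det; split=> a b.
have -> : (fun y => (row' j (col' i (F y))) a b) = (fun y => F y (lift j a) (lift i b)).
  by apply/funext => y; rewrite !mxE.
exact: (dblE dF).
Qed.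
End Inverse.

Lemma sum_inv_tr (R : realType) m (G A : 'M[R]_m) : G^T = G ->
  \sum_a \sum_b invmx G a b * A a b = \tr (A *m invmx G).
Proof.
move=> Gs; apply: eq_bigr => a _; rewrite mxE; apply: eq_bigr => b _.
by rewrite mulrC -[invmx G in LHS]trmxK trmx_inv Gs mxE.
Qed.

Lemma form_expand (R : realType) m (f : 'rV[R]_m -> R) :
  (forall k u v, f (k *: u + v) = k * f u + f v) ->
  forall u, f u = \sum_i u 0 i * f (delta_mx 0 i).
Proof.
move=> hf u; have f0 : f 0 = 0 by have := hf 1 0 0; rewrite scaler0 addr0; lra.
rewrite {1}[u]row_sum_delta; elim: (index_enum _) => [|i r IH]; first by rewrite !big_nil.
by rewrite !big_cons hf IH.
Qed.

Section Fields.
Variables (R : realType) (n : nat).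
Local Notation m := (n.*2).
Local Notation E := 'rV[R]_m.
Local Notation e i := (delta_mx 0 i : E).
Variables (Gam : 'I_m -> 'I_m -> E -> E) (U : set E) (g J : E -> 'M[R]_m).
Hypotheses (oU : open U) (lc : levi_civita Gam U g) (pJ : parallel_endo Gam U J).
Hypotheses (sg : smooth_mx_on U g) (sJ : smooth_mx_on U J).
Hypothesis gsym : forall x, U x -> (g x)^T = g x.
Hypothesis gunit : forall x, U x -> g x \in unitmx.

Let sGam i j : smooth_mx_on U (Gam i j). Proof. by case: lc. Qed.
Local Notation C := (conn_mx Gam).
Local Notation Rm := (curv_mx Gam).
Local Notation NR := (nabla_mx Gam).
Let dR u v t x : U x -> dbl (Rm u v) x t. Proof. exact: dbl_curv_mx. Qed.

Definition ricm (x : E) : 'M[R]_m := \matrix_(a, b) ric Gam x (e a) (e b).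

Lemma ric_sum x u v : U x -> ric Gam x u v = \sum_i (v *m Rm (e i) u x) 0 i.
Proof.
by move=> Ux; rewrite /ric endo_traceE; apply: eq_bigr => i _; rewrite (curvE oU sGam _ _ _ Ux).
Qed.

Lemma bilin_of (b : E -> E -> R) (M : 'M[R]_m) :
  (forall v k u u', b (k *: u + u') v = k * b u v + b u' v) ->
  (forall u k v v', b u (k *: v + v') = k * b u v + b u v') ->
  (forall i j, M i j = b (e i) (e j)) -> forall u v, b u v = bilin M u v.
Proof.
move=> b1 b2 Mb u v; rewrite (form_expand (b1 v)).
rewrite (form_expand (f := fun u => bilin M u v)); last by move=> k x y; rewrite gDl gZl.
apply: eq_bigr => i _; congr (_ * _); rewrite (form_expand (b2 (e i))).
rewrite (form_expand (f := bilin M (e i))); last by move=> k x y; rewrite gDr gZr.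
by apply: eq_bigr => j _; rewrite bilin_delta Mb.
Qed.

Lemma ric_bilin x u v : U x -> ric Gam x u v = bilin (ricm x) u v.
Proof.
move=> Ux; apply: bilin_of => [w k a b|w k a b|i j]; last by rewrite mxE.
  rewrite !ric_sum// mulr_sumr -big_split; apply: eq_bigr => i _.
  by rewrite (curv_mx_lin2 oU sGam k (e i) a b Ux) rmulDr rmulZr mx_addE mx_scaleE.
rewrite !ric_sum// mulr_sumr -big_split; apply: eq_bigr => i _.
by rewrite rmulDl rmulZl mx_addE mx_scaleE.
Qed.

Lemma ric_derivable u v x t : U x -> is_derive x t (fun y => ric Gam y u v)
  (\sum_i (v *m dm t (Rm (e i) u) x) 0 i).
Proof.
move=> Ux; have d i : derivable (fun y => (v *m Rm (e i) u y) 0 i) x t.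
  exact: dblE (dbl_mull v (dR (e i) u t Ux)) 0 i.
have [d1 e1] := is_derive_bigsum d; split.
  apply: (eqU_derivable oU Ux) d1 => y Uy; by rewrite ric_sum.
rewrite (eqU_derive oU t Ux (fun y Uy => ric_sum u v Uy)) e1.
apply: eq_bigr => i _; rewrite -(dm_mull v (dR (e i) u t Ux)) mxE; exact: erefl.
Qed.

Lemma ricf_nablaR x t u v : U x -> ricf (nablaR Gam x) t u v =
  'D_t (fun y => ric Gam y u v) x - ric Gam x (u *m C t x) v - ric Gam x u (v *m C t x).
Proof.
move=> Ux; have [_ ->] := ric_derivable u v t Ux.
have f_lin : lin (fun z => v *m Rm z u x).
  by move=> k a b; rewrite (curv_mx_lin1 oU sGam k a b u Ux) rmulDr rmulZr.
have C_lin : lin (fun z : E => z *m C t x) by move=> k a b; rewrite rmulDl rmulZl.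
have com := tr_comp f_lin C_lin.
transitivity (\sum_i (v *m dm t (Rm (e i) u) x) 0 i
  + endo_trace (fun z => v *m Rm z u x *m C t x)
  - endo_trace (fun z => v *m Rm (z *m C t x) u x)
  - ric Gam x (u *m C t x) v - ric Gam x u (v *m C t x)); last first.
  by rewrite com; ring.
rewrite /ricf !ric_sum// !endo_traceE -!(sumrN, big_split)/=.
apply: eq_bigr => i _; rewrite (nablaRE oU sGam _ _ _ _ Ux) /nabla_mx !rmulE !mx_linE.
mxatoms; ring.
Qed.
End Fields.

Section RicciField.
Variables (R : realType) (n : nat).
Local Notation m := (n.*2).
Local Notation E := 'rV[R]_m.
Local Notation e i := (delta_mx 0 i : E).
Variables (Gam : 'I_m -> 'I_m -> E -> E) (U : set E) (g J : E -> 'M[R]_m).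
Hypotheses (oU : open U) (lc : levi_civita Gam U g) (pJ : parallel_endo Gam U J).
Hypotheses (sg : smooth_mx_on U g) (sJ : smooth_mx_on U J).
Hypothesis gsym : forall x, U x -> (g x)^T = g x.
Hypothesis gunit : forall x, U x -> g x \in unitmx.

Let sGam i j : smooth_mx_on U (Gam i j). Proof. by case: lc. Qed.
Local Notation C := (conn_mx Gam).
Local Notation S := (nablaR Gam).
Local Notation ricm := (ricm Gam).
Let dg x t : U x -> dbl g x t. Proof. exact: (smooth_dbl oU sg). Qed.
Let hS x : U x -> nabla_curv (g x) (J x) (S x).
Proof. by move=> Ux; exact: (nabla_curv_nablaR oU lc pJ sg sJ gsym Ux). Qed.

(* [K] is a field of endomorphisms with covariant derivative [DK] at [x] in the
   direction [t]. *)
Record endo_derive (K : E -> 'M[R]_m) (x t : E) (DK : 'M[R]_m) : Prop := EndoDerive {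
  endo_dbl : dbl K x t;
  endo_deriveE : dm t K x + K x *m C t x - C t x *m K x = DK }.

Definition nric x t : 'M[R]_m := \matrix_(a, b) ricf (S x) t (e a) (e b).

Lemma nric_bilin x t u v : U x -> ricf (S x) t u v = bilin (nric x t) u v.
Proof.
move=> Ux; apply: bilin_of => [w k a b|w k a b|i j]; last by rewrite mxE.
  exact: (ric_lin2 (hS Ux)).
exact: (ric_lin3 (hS Ux)).
Qed.

Lemma dbl_ricm x t : U x -> dbl ricm x t.
Proof.
move=> Ux; split=> i j.
have -> : (fun y => ricm y i j) = (fun y => ric Gam y (e i) (e j)).
  by apply/funext => y; rewrite mxE.
by have [] := ric_derivable oU lc (e i) (e j) t Ux.
Qed.

Lemma dm_ricm x t : U x ->
  dm t ricm x = nric x t + C t x *m ricm x + ricm x *m (C t x)^T.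
Proof.
move=> Ux; apply/matrixP => i j; rewrite [LHS]mxE.
have -> : (fun y => ricm y i j) = (fun y => ric Gam y (e i) (e j)).
  by apply/funext => y; rewrite mxE.
have := ricf_nablaR oU lc t (e i) (e j) Ux.
rewrite (nric_bilin _ _ _ Ux) !(ric_bilin oU lc _ _ Ux) bilin_delta => h.
have h2 := bilin_mul (ricm x) (C t x) (e i) (e j).
rewrite bilin_delta in h2.
by rewrite -addrA mx_addE -h2 h; ring.
Qed.

Definition ricp (x : E) : 'M[R]_m := ricm x *m invmx (g x).

Lemma ricp_derive x t : U x -> endo_derive ricp x t (nric x t *m invmx (g x)).
Proof.
move=> Ux; have di := dbl_invmx oU Ux gunit (dg t Ux).
have dr := dbl_ricm t Ux.
split; first exact: dbl_mul dr di.
apply: (can_inj (mulmxK (gunit Ux))); rewrite mulmxKV ?gunit//.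
have ig y : U y -> ricp y *m g y = ricm y by move=> Uy; rewrite /ricp mulmxKV ?gunit.
have := dm_ricm t Ux; rewrite -(eqU_dm oU t Ux ig) (dm_mul (dbl_mul dr di) (dg t Ux)).
rewrite -/(ricp x) -/ricp (dm_metric oU lc t Ux) -(ig x Ux).
move: (ricp x) (dm t ricp x) (nric x t) => P dP N.
move=> /(canRL (addrK _)) h.
rewrite !rmulE; rewrite h; mxring.
Qed.

Lemma scalE x : U x -> scal g Gam x = \tr (ricp x).
Proof.
move=> Ux; rewrite -(sum_inv_tr _ (gsym Ux)).
by apply: eq_bigr => a _; apply: eq_bigr => b _; rewrite mxE.
Qed.

Lemma scal_derive x t : U x -> is_derive x t (scal g Gam) (dscalf (g x) (S x) t).
Proof.
move=> Ux; have [dP eP] := ricp_derive t Ux.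
have d i : derivable (fun y => ricp y i i) x t by exact: (dblE dP i i).
have [d1 e1] := is_derive_bigsum d; split.
  by apply: (eqU_derivable oU Ux) d1 => y Uy; rewrite scalE.
rewrite (eqU_derive oU t Ux scalE) e1.
have -> : dscalf (g x) (S x) t = \tr (nric x t *m invmx (g x)).
  rewrite -(sum_inv_tr _ (gsym Ux)).
  by apply: eq_bigr => a _; apply: eq_bigr => b _; rewrite [nric x t a b]mxE.
rewrite -eP linearB linearD/= mxtrace_mulC addrK.
by apply: eq_bigr => i _; rewrite mxE.
Qed.

Lemma grad_scalE x : U x -> grad_scal g Gam x = gradf (g x) (S x).
Proof.
move=> Ux; rewrite /grad_scal /gradf; congr sharp; apply/funext => u.
by have [_] := scal_derive u Ux.
Qed.

Definition Kmx (x : E) : 'M[R]_m :=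
  - (2 * (n%:R + 2))^-1 *: (ricp x - (scal g Gam x / (4 * (n%:R + 1))) *: 1%:M).

Lemma sharp_mul (G M : 'M[R]_m) u : sharp G (bilin M u) = u *m (M *m invmx G).
Proof.
rewrite /sharp mulmxA; congr (_ *m _); apply/rowP => j.
by rewrite mxE /bilin trmx_delta -colE mxE.
Qed.

Lemma K_endoE x u : U x -> K_endo g Gam x u = u *m Kmx x.
Proof.
move=> Ux; rewrite /K_endo /Kmx rmulZr rmulDr rmulNr rmulZr mulmx1; congr (_ *: (_ - _)).
rewrite /ric_endo -sharp_mul; congr sharp; apply/funext => v.
exact: (ric_bilin oU lc).
Qed.

Definition nabla_K x t u : E :=
  - (2 * (n%:R + 2))^-1 *: (ricE (g x) (S x) t u
    - (dscalf (g x) (S x) t / (4 * (n%:R + 1))) *: u).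

Lemma Kmx_derive x t : U x -> exists2 DK, endo_derive Kmx x t DK &
  forall u, u *m DK = nabla_K x t u.
Proof.
move=> Ux; have [dP eP] := ricp_derive t Ux; have [ds es] := scal_derive t Ux.
exists (- (2 * (n%:R + 2))^-1 *: (nric x t *m invmx (g x)
    - (dscalf (g x) (S x) t / (4 * (n%:R + 1))) *: 1%:M)); last first.
  move=> u; rewrite rmulZr rmulDr rmulNr rmulZr mulmx1 /nabla_K; congr (_ *: (_ - _)).
  rewrite /ricE -sharp_mul; congr sharp; apply/funext => v.
  by rewrite nric_bilin.
set k : R := (4 * (n%:R + 1))^-1.
have dk : derivable (fun=> k) x t by exact: derivable_cst.
have da : derivable (fun y => scal g Gam y * k) x t by exact: derivableM ds dk.
have ea : 'D_t (fun y => scal g Gam y * k) x = dscalf (g x) (S x) t * k.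
  have := deriveM ds dk; rewrite derive_cst es scaler0 add0r => h.
  by rewrite mulrC; exact: h.
have d1 : dbl (fun y => (scal g Gam y * k) *: (1%:M : 'M[R]_m)) x t.
  exact: (dbl_scale (dbl_cst (1%:M : 'M[R]_m) x t) da).
have d2 := dbl_add dP (dbl_opp d1).
have dc : derivable (fun=> - (2 * (n%:R + 2))^-1 : R) x t by exact: derivable_cst.
split; first exact (dbl_scale d2 dc).
rewrite (dm_scale d2 dc) derive_cst scale0r add0r (dm_add dP (dbl_opp d1)) (dm_opp d1).
rewrite (dm_scale (dbl_cst (1%:M : 'M[R]_m) x t) da) dm_cst scaler0 addr0 ea -eP /Kmx -/k.
rewrite !rmulE !mul1mx !mulmx1.
move: (dm t ricp x) (ricp x) (scal g Gam x) (dscalf (g x) (S x) t) => a b c d.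
mxring.
Qed.
End RicciField.

(** * The Bochner tensor and the decomposition *)

Section CovariantLeibniz.
Variables (R : realType) (n : nat).
Local Notation m := (n.*2).
Local Notation E := 'rV[R]_m.
Local Notation e i := (delta_mx 0 i : E).
Variables (Gam : 'I_m -> 'I_m -> E -> E) (U : set E) (g J : E -> 'M[R]_m).
Hypotheses (oU : open U) (lc : levi_civita Gam U g) (pJ : parallel_endo Gam U J).
Hypotheses (sg : smooth_mx_on U g) (sJ : smooth_mx_on U J).
Hypothesis gsym : forall x, U x -> (g x)^T = g x.
Hypothesis gunit : forall x, U x -> g x \in unitmx.
Local Notation C := (conn_mx Gam).
Let sGam i j : smooth_mx_on U (Gam i j). Proof. by case: lc. Qed.
Let dg x t : U x -> dbl g x t. Proof. exact: (smooth_dbl oU sg). Qed.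
Let dJ x t : U x -> dbl J x t. Proof. exact: (smooth_dbl oU sJ). Qed.

Section At.
Variables (x t : E).
Hypothesis Ux : U x.

(* The vector field [V] has covariant derivative [W] at [x] in the direction [t]. *)
Record vec_derive (V : E -> E) (W : E) : Prop := VecDerive {
  vec_dbl : dbl V x t;
  vec_deriveE : dm t V x + V x *m C t x = W }.

Lemma vec_derive_cov V W : vec_derive V W -> cov Gam (cst t) V x = W.
Proof. by move=> [dV <-]; rewrite covE (derive_dm dV). Qed.

Lemma vec_derive_cst u : vec_derive (fun=> u) (u *m C t x).
Proof. by split; [exact: dbl_cst|rewrite dm_cst add0r]. Qed.

Lemma vec_derive_add V V' W W' : vec_derive V W -> vec_derive V' W' ->
  vec_derive (fun y => V y + V' y) (W + W').
Proof.
move=> [dV <-] [dV' <-]; split; first exact: dbl_add.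
rewrite (dm_add dV dV') rmulDl; vring.
Qed.

Lemma vec_derive_opp V W : vec_derive V W -> vec_derive (fun y => - V y) (- W).
Proof.
move=> [dV <-]; split; first exact: dbl_opp.
rewrite (dm_opp dV) rmulNl; vring.
Qed.

Lemma vec_derive_J V W : vec_derive V W -> vec_derive (fun y => V y *m J y) (W *m J x).
Proof.
move=> [dV <-]; have d := dJ t Ux; split; first exact: dbl_mul.
rewrite (dm_mul dV d) (dm_complex oU pJ sJ t Ux).
move: (dm t V x) (V x) (J x) => a b c; mxring.
Qed.

Lemma vec_derive_K K DK V W : endo_derive Gam K x t DK -> vec_derive V W ->
  vec_derive (fun y => V y *m K y) (W *m K x + V x *m DK).
Proof.
move=> [dK <-] [dV <-]; split; first exact: dbl_mul.
rewrite (dm_mul dV dK).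
move: (dm t V x) (V x) (K x) (dm t K x) => a b c d; mxring.
Qed.

Lemma vec_derive_scale (f : E -> R) (a : R) V W : is_derive x t f a -> vec_derive V W ->
  vec_derive (fun y => f y *: V y) (a *: V x + f x *: W).
Proof.
move=> [df <-] [dV <-]; split; first exact: dbl_scale.
rewrite (dm_scale dV df) rmulZl.
move: ('D_t f x) (dm t V x) (V x) => a' b c; mxring.
Qed.

Lemma is_derive_bilin A A' B B' : vec_derive A A' -> vec_derive B B' ->
  is_derive x t (fun y => bilin (g y) (A y) (B y))
    (bilin (g x) A' (B x) + bilin (g x) (A x) B').
Proof.
move=> [dA <-] [dB <-]; have d := dg t Ux.
have dAg := dbl_mul dA d; have dM := dbl_mul dAg (dbl_tr dB).
split; first exact: (dblE dM 0 0).
transitivity (dm t (fun y => A y *m g y *m (B y)^T) x 0 0); first by rewrite mxE.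
rewrite (dm_mul dAg (dbl_tr dB)) (dm_mul dA d) (dm_tr B) (dm_metric oU lc t Ux) /bilin.
rewrite -mx_addE; congr (fun_of_matrix _ 0 0).
rewrite rtrD rtrM.
move: (dm t A x) (A x) (g x) (B x) (dm t B x) => a b c d' f; mxring.
Qed.

Lemma vec_derive_wedge A A' B B' Z Z' :
  vec_derive A A' -> vec_derive B B' -> vec_derive Z Z' ->
  vec_derive (fun y => wedge (g y) (A y) (B y) (Z y))
    (wedge (g x) A' (B x) (Z x) + wedge (g x) (A x) B' (Z x) + wedge (g x) (A x) (B x) Z').
Proof.
move=> dA dB dZ.
have h1 := vec_derive_scale (is_derive_bilin dA dZ) dB.
have h2 := vec_derive_scale (is_derive_bilin dB dZ) dA.
have [d eq] := vec_derive_add h1 (vec_derive_opp h2).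
split; first exact: d.
rewrite -[LHS]/(_ + _ *m _) eq /wedge; move: (bilin (g x)) => b; vring.
Qed.

Lemma vec_derive_wedgeJ A A' B B' Z Z' :
  vec_derive A A' -> vec_derive B B' -> vec_derive Z Z' ->
  vec_derive (fun y => wedgeJ (g y) (J y) (A y) (B y) (Z y))
    (wedgeJ (g x) (J x) A' (B x) (Z x) + wedgeJ (g x) (J x) (A x) B' (Z x)
     + wedgeJ (g x) (J x) (A x) (B x) Z').
Proof.
move=> dA dB dZ.
have h1 := vec_derive_wedge dA dB dZ.
have h2 := vec_derive_wedge (vec_derive_J dA) (vec_derive_J dB) dZ.
have [d eq] := vec_derive_add h1 h2.
split; first exact: d.
rewrite -[LHS]/(_ + _ *m _) eq /wedgeJ; move: (wedge (g x)) => b; vring.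
Qed.

Lemma vec_derive_wedgeJg K DK u v w : endo_derive Gam K x t DK ->
  vec_derive (fun y => wedgeJg (g y) (J y) (fun z => z *m K y) u v w)
    (wedgeJg (g x) (J x) (fun z => z *m K x) (u *m C t x) v w
     + wedgeJg (g x) (J x) (fun z => z *m K x) u (v *m C t x) w
     + wedgeJg (g x) (J x) (fun z => z *m K x) u v (w *m C t x)
     + wedgeJg (g x) (J x) (fun z => z *m DK) u v w).
Proof.
move=> dK; have [du dv dw] := And3 (vec_derive_cst u) (vec_derive_cst v) (vec_derive_cst w).
have h1 := vec_derive_wedgeJ (vec_derive_K dK du) dv dw.
have h2 := vec_derive_wedgeJ du (vec_derive_K dK dv) dw.
have i2 : is_derive x t (fun=> 2 : R) 0 by split; [exact: derivable_cst|exact: derive_cst].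
have twice (f : E -> R) (a : R) : is_derive x t f a -> is_derive x t (fun y => 2 * f y) (2 * a).
  move=> [df <-]; have d2 : derivable (fun=> 2 : R) x t by exact: derivable_cst.
  split; first exact (derivableM d2 df).
  by rewrite (deriveM d2 df) derive_cst scaler0 addr0.
have h3 := vec_derive_scale
  (twice _ _ (is_derive_bilin (vec_derive_K dK (vec_derive_J du)) dv)) (vec_derive_J dw).
have h4 := vec_derive_scale
  (twice _ _ (is_derive_bilin (vec_derive_J du) dv)) (vec_derive_J (vec_derive_K dK dw)).
have [d eq] := vec_derive_add (vec_derive_add (vec_derive_add h1 h2) h3) h4.
split; first exact: d.
rewrite -[LHS]/(_ + _ *m _) eq !wedgeJgE.
rewrite (linD (wedgeJ_lin1 (g x) (J x) _ _)) (linD (wedgeJ_lin2 (g x) (J x) _ _)).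
rewrite !gDl !JD.
move: (wedgeJ (g x) (J x)) (bilin (g x)) => b c; mxring.
Qed.
End At.

Lemma vec_derive_eqU x t V V' W : U x -> (forall y, U y -> V y = V' y) ->
  vec_derive x t V W -> vec_derive x t V' W.
Proof.
move=> Ux VV' [dV <-]; split; first exact: (eqU_dbl oU Ux VV').
by rewrite (eqU_dm oU t Ux VV') VV'.
Qed.

Lemma nablaBE x t u v w : U x -> nablaB g J Gam x t u v w =
  nablaR Gam x t u v w - wedgeJg (g x) (J x) (nabla_K Gam g x t) u v w.
Proof.
move=> Ux; have [DK dK hDK] := Kmx_derive oU lc pJ sg sJ gsym gunit t Ux.
have dc : vec_derive x t (fun y => curv Gam y u v w)
    (cov Gam (cst t) (fun y => curv Gam y u v w) x).
  have d : dbl (fun y => curv Gam y u v w) x t.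
    apply: (eqU_dbl oU Ux (F := fun y => w *m curv_mx Gam u v y)).
      by move=> y Uy; rewrite (curvE oU sGam u v w Uy).
    exact: dbl_mull (dbl_curv_mx oU sGam u v t Ux).
  by split; [exact: d|rewrite covE (derive_dm d)].
have bE y a b c : U y -> bochner g J Gam y a b c = curv Gam y a b c
    - wedgeJg (g y) (J y) (fun z => z *m Kmx Gam g y) a b c.
  move=> Uy; rewrite /bochner; congr (_ - _); apply: eq_wedgeJg => z.
  exact: (K_endoE oU lc).
have dF := vec_derive_add dc (vec_derive_opp (vec_derive_wedgeJg Ux u v w dK)).
have db := vec_derive_eqU Ux (fun y Uy => esym (bE y u v w Uy)) dF.
rewrite /nablaB /nablaR /cov_tensor (vec_derive_cov db) !cov_cst !(bE x)//.
rewrite (eq_wedgeJg (H := fun z => z *m DK) (H' := nabla_K Gam g x t) _ _ _ _ _ hDK).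
move: (cov _ _ _ _) (curv Gam x) (wedgeJg (g x) (J x)) => a b c; vring.
Qed.

End CovariantLeibniz.

Lemma wedgeJg_nabla_K (R : realType) n (G Jx : 'M[R]_(n.*2)) S :
  G^T = G -> G \in unitmx -> Jx *m Jx = - 1%:M ->
  (forall u v, bilin G (u *m Jx) (v *m Jx) = bilin G u v) -> nabla_curv G Jx S ->
  forall t a b z, wedgeJg G Jx (fun u => - (2 * (n%:R + 2))^-1 *: (ricE G S t u
      - (dscalf G S t / (4 * (n%:R + 1))) *: u)) a b z =
    ((n%:R + 3) / (n%:R + 2)) *: psi1f G Jx (tildef G Jx S) t a b z
    + embedT G Jx (gradf G S) t a b z.
Proof.
move=> Gsym Gunit JJ GJ hS t a b z.
have n1 : n%:R + 1 != 0 :> R := @n1_neq0 R n.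
have [n2 _] := @c_neq0 R n.
have n3 : n%:R + 3 != 0 :> R by rewrite -natrD pnatr_eq0 addn3.
rewrite /embedT (@eq_wedgeJg R n G Jx _ (fun u => (- (2 * (n%:R + 2))^-1) *:
  (tildef G Jx S (t *m Jx) u *m Jx) + Tf G Jx (gradf G S) t u)).
  rewrite wedgeJg_lin0 /psi1f scalerA; congr (_ *: _ + _); field.
  by rewrite n2 n3.
move=> u; rewrite (tildeE Gsym Gunit JJ GJ hS) wJg_half /Tf.
rewrite (wedgeJJr G JJ (gradf G S) t u) (g_gradf Gsym Gunit hS t).
rewrite !(JK JJ) (linN (ricE_lin1 Gunit hS u)) !(JD, JZ, JN) !(JK JJ) GJ.
rewrite (g_gradf Gsym Gunit hS t).
move: (ricE G S t u) (dscalf G S t) (wedgeJ G Jx t (gradf G S *m Jx) u *m Jx) => p q r.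
by vfield; rewrite n1 n2.
Qed.

Lemma has_signature_unit (R : realType) m r (G : 'M[R]_m) : has_signature r G -> G \in unitmx.
Proof.
move=> [P Pu h]; have : P *m G *m P^T \in unitmx.
  rewrite h unitmxE det_diag unitfE prodf_seq_neq0; apply/allP => i _.
  by rewrite mxE; case: ifP => _; rewrite ?oppr_eq0 oner_eq0.
by rewrite !unitmx_mul => /andP[/andP[]].
Qed.

Lemma eq_tensor_in (R : realType) n (Q : {vspace tensor5 R n}) F F' :
  (forall x y z w, F x y z w = F' x y z w) -> tensor_in Q F -> tensor_in Q F'.
Proof. by move=> FF' [S SQ h]; exists S => // x y z w; rewrite h. Qed.

Section Pointwise.
Variables (R : realType) (n : nat).
Local Notation m := (n.*2).
Local Notation E := 'rV[R]_m.
Variables (Gam : 'I_m -> 'I_m -> E -> E) (U : set E) (g J : E -> 'M[R]_m).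
Hypotheses (oU : open U) (lc : levi_civita Gam U g) (pJ : parallel_endo Gam U J).
Hypotheses (sg : smooth_mx_on U g) (sJ : smooth_mx_on U J).
Hypothesis gsym : forall x, U x -> (g x)^T = g x.
Hypothesis gunit : forall x, U x -> g x \in unitmx.
Hypothesis JJ : forall x, U x -> J x *m J x = - 1%:M.
Hypothesis gJ : forall x, U x -> forall u v, bilin (g x) (u *m J x) (v *m J x) = bilin (g x) u v.
Variable x : E.
Hypothesis Ux : U x.
Local Notation S := (nablaR Gam x).
Local Notation D := (tildef (g x) (J x) S).
Local Notation v := (gradf (g x) S).

Lemma tildeDE z w : tildeD g J Gam x z w = D z w.
Proof. by rewrite tilde_div -(grad_scalE oU lc pJ sg sJ gsym gunit Ux). Qed.

Lemma psi1E t a b z : psi1 g J Gam x t a b z = psi1f (g x) (J x) D t a b z.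
Proof.
by rewrite /psi1 /psi1f; congr (_ *: _); apply: eq_wedgeJg => u; rewrite tildeDE.
Qed.

Lemma psi2E t a b z : psi2 g J Gam x t a b z = psi2f (g x) (J x) D t a b z.
Proof. by rewrite /psi2 /psi2f !tildeDE. Qed.

Lemma Q'_tensorE t a b z : Q'_tensor g J Gam x t a b z = embed (g x) (J x) D t a b z.
Proof. by rewrite embed_psi -psi1E -psi2E. Qed.

Lemma Q1_tensorE t a b z : Q1_tensor g J Gam x t a b z = embedT (g x) (J x) v t a b z.
Proof.
rewrite /Q1_tensor /embedT; apply: eq_wedgeJg => u.
by rewrite /T_endo (grad_scalE oU lc pJ sg sJ gsym gunit Ux).
Qed.

Lemma Q0_tensorE t a b z : Q0_tensor g J Gam x t a b z =
  S t a b z - embed (g x) (J x) D t a b z - embedT (g x) (J x) v t a b z.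
Proof.
have hS := nabla_curv_nablaR oU lc pJ sg sJ gsym Ux.
have [n2 _] := @c_neq0 R n.
rewrite /Q0_tensor (nablaBE oU lc pJ sg sJ gsym gunit t a b z Ux) psi1E psi2E embed_psi.
have -> : wedgeJg (g x) (J x) (nabla_K Gam g x t) a b z =
    ((n%:R + 3) / (n%:R + 2)) *: psi1f (g x) (J x) D t a b z
    + embedT (g x) (J x) v t a b z.
  exact: (wedgeJg_nabla_K (gsym Ux) (gunit Ux) (JJ Ux) (gJ Ux) hS).
move: (S t a b z) (psi1f _ _ _ _ _ _ _) (psi2f _ _ _ _ _ _ _) (embedT _ _ _ _ _ _ _).
by move=> s p1 p2 q; vfield.
Qed.

Lemma nablaR_decomposition (Q0 Q' Q1 : {vspace tensor5 R n}) : (2 <= n)%N ->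
  nabla_decomposition (g x) (J x) Q0 Q' Q1 ->
  [/\ forall t u v w, nablaR Gam x t u v w = Q0_tensor g J Gam x t u v w
        + Q'_tensor g J Gam x t u v w + Q1_tensor g J Gam x t u v w,
      tensor_in Q0 (Q0_tensor g J Gam x), tensor_in Q' (Q'_tensor g J Gam x) &
      tensor_in Q1 (Q1_tensor g J Gam x)].
Proof.
move=> n2 hQ; have hS := nabla_curv_nablaR oU lc pJ sg sJ gsym Ux.
have [h0 h' h1] := nabla_decomposition_mem (gsym Ux) (gunit Ux) (JJ Ux) (gJ Ux) n2 hQ hS.
split.
- move=> t a b z; rewrite Q0_tensorE Q'_tensorE Q1_tensorE.
  by move: (S t a b z) (embed _ _ _ _ _ _ _) (embedT _ _ _ _ _ _ _) => s p q; vring.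
- by apply: eq_tensor_in h0 => t a b z; rewrite Q0_tensorE.
- by apply: eq_tensor_in h' => t a b z; rewrite Q'_tensorE.
- by apply: eq_tensor_in h1 => t a b z; rewrite Q1_tensorE.
Qed.
End Pointwise.

Theorem theorem4 (R : realType) (p q : nat) (hpq : (2 <= p + q)%N)
  (M : topologicalType) (A : set (chart R M (p + q).*2))
  (g J : chart R M (p + q).*2 -> 'rV[R]_((p + q).*2) -> 'M[R]_((p + q).*2))
  (Gam : chart R M (p + q).*2 -> 'I_((p + q).*2) -> 'I_((p + q).*2) ->
         'rV[R]_((p + q).*2) -> 'rV[R]_((p + q).*2))
  (hM : pseudo_kaehler A g J Gam)
  (c : chart R M (p + q).*2) (hc : A c) (x : M) (hx : chart_dom c x)
  (Q0 Q' Q1 : {vspace tensor5 R (p + q)})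
  (hQ : nabla_decomposition (g c (chart_map c x)) (J c (chart_map c x)) Q0 Q' Q1) :
  let y := chart_map c x in
  [/\ forall t u v w, nablaR (Gam c) y t u v w =
        Q0_tensor (g c) (J c) (Gam c) y t u v w
        + Q'_tensor (g c) (J c) (Gam c) y t u v w
        + Q1_tensor (g c) (J c) (Gam c) y t u v w,
      tensor_in Q0 (Q0_tensor (g c) (J c) (Gam c) y),
      tensor_in Q' (Q'_tensor (g c) (J c) (Gam c) y) &
      tensor_in Q1 (Q1_tensor (g c) (J c) (Gam c) y)].
Proof.
case: hM => [[_ _ [charts _ _]] [sg gprop _] [sJ JJ _] gJ lc].
have [_ oU _ _ _] := charts c hc; have [lcc pJ] := lc c hc.
have Uy : chart_im c (chart_map c x) by exists x.
have gs y : chart_im c y -> (g c y)^T = g c y by move=> cy; have [] := gprop c y hc cy.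
have gu y : chart_im c y -> g c y \in unitmx.
  by move=> cy; have [_ /has_signature_unit] := gprop c y hc cy.
have jj y : chart_im c y -> J c y *m J c y = - 1%:M by exact: JJ.
have gj y : chart_im c y -> forall u v,
  bilin (g c y) (u *m J c y) (v *m J c y) = bilin (g c y) u v by exact: gJ.
exact: (nablaR_decomposition oU lcc pJ (sg c hc) (sJ c hc) gs gu jj gj Uy hpq hQ).
Qed.
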